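(* Let $0<\alpha<1$, let $\Omega\subset\mathbb R^d$ be open, bounded and connected with $\mathcal C^{2,\alpha}$ boundary. Let $\varphi:\mathbb R^d\to\mathbb R$ be $\kappa$-strongly convex for some $\kappa>0$ and $\mathcal C^{3,\alpha}$ on a neighborhood of $\overline\Omega$. Let $\mu$ be a probability measure on $\Omega$ with a density in $\mathcal C^{1,\alpha}(\overline\Omega)$ bounded below by some $\lambda>0$ on $\Omega$, and let $\nu=(\nabla\varphi)_\#\mu$. For $\varepsilon>0$ let $(f_\varepsilon,g_\varepsilon)$ be a pair of Schrödinger potentials between $\mu$ and $\nu$ with regularization $\varepsilon$, and set $\varphi_\varepsilon=\frac12\|\cdot\|^2-f_\varepsilon$, $\psi_\varepsilon=\frac12\|\cdot\|^2-g_\varepsilon$. Then there exist constants $C>0$ and $\varepsilon_0>0$ such that, for every $\varepsilon\in(0,\varepsilon_0)$, $$\frac1C\,\varepsilon\log(1/\varepsilon)\le\|\varphi_\varepsilon\oplus\psi_\varepsilon-\varphi\oplus\varphi^*\|_{L^1(\mu\otimes\nu)}\le C\,\varepsilon\log(1/\varepsilon).$$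
   Context: A function $f$ is $\kappa$-strongly convex if $f-\frac\kappa2\|\cdot\|^2$ is convex. $\varphi^*(y)=\sup_{x\in\mathbb R^d}\{\langle y,x\rangle-\varphi(x)\}$, and $(f\oplus g)(x,y)=f(x)+g(y)$. Let $\Omega'=\nabla\varphi(\Omega)$. Schrödinger potentials: a pair $(f_\varepsilon,g_\varepsilon)$ attaining $$\sup_{f,g}\int_\Omega f\,d\mu+\int_{\Omega'}g\,d\nu-\varepsilon\int_{\Omega\times\Omega'}\exp\Big(\frac{f(x)+g(y)-\frac12\|x-y\|^2}{\varepsilon}\Big)\mu(dx)\nu(dy)+\varepsilon,$$ the dual of the problem $\min_{\pi\in\Pi(\mu,\nu)}\int\frac12\|x-y\|^2\,d\pi+\varepsilon H(\pi\mid\mu\otimes\nu)$, where $\Pi(\mu,\nu)$ is the set of couplings and $H$ is relative entropy. Equivalently (and uniquely up to $(f_\varepsilon+c,g_\varepsilon-c)$), they satisfy $$\int_{\Omega'}e^{(f_\varepsilon(x)+g_\varepsilon(y)-\frac12\|x-y\|^2)/\varepsilon}\nu(dy)=1\ \text{ for }\mu\text{-a.e. }x,\qquad\int_{\Omega}e^{(f_\varepsilon(x)+g_\varepsilon(y)-\frac12\|x-y\|^2)/\varepsilon}\mu(dx)=1\ \text{ for }\nu\text{-a.e. }y.$$ *)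

(* Defs.v *)
From HB Require Import structures.
From mathcomp Require Import all_boot all_order all_algebra.
From mathcomp Require Import all_classical all_reals all_analysis.

Set Implicit Arguments.
Unset Strict Implicit.
Unset Printing Implicit Defensive.

Import Order.TTheory GRing.Theory Num.Theory.
Import numFieldNormedType.Exports.

Local Open Scope classical_set_scope.
Local Open Scope ring_scope.

Section Borel.
Context {R : realType} {n : nat}.

Definition rV_display : measure_display := sigma_display (@open 'rV[R]_n).

HB.instance Definition _ := @isMeasurable.Build rV_display 'rV[R]_n
  <<s @open 'rV[R]_n >> (@sigma_algebra0 _ setT _)
  (@sigma_algebraC _ _) (@sigma_algebra_bigcup _ setT _).

Lemma open_measurable_rV (A : set 'rV[R]_n) : open A -> measurable A.
Proof. by move=> oA; apply: sub_sigma_algebra. Qed.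

Lemma measurable_coord (i : 'I_n) :
  measurable_fun setT (fun x : 'rV[R]_n => x 0 i).
Proof.
apply: (measurability _ (measurable_realfun.RGenOpens.measurableE R)).
move=> _ [_ [a [b ->]] <-]; rewrite setTI; apply: open_measurable_rV.
have /continuousP := @coord_continuous R 1 n 0 i.
by apply; exact: interval_open.
Qed.

Lemma measurable_fun_coord d (T : measurableType d) (f : T -> 'rV[R]_n) :
  (forall i, measurable_fun setT (fun t => f t 0 i)) -> measurable_fun setT f.
Proof.
move=> mf; apply: (@measurability _ _ _ _ _ _ (@open 'rV[R]_n)) => //.
move=> _ [A oA <-]; rewrite setTI.
pose box (p : 'rV[rat]_n * 'rV[rat]_n) : set 'rV[R]_n :=
  [set x | forall i, ratr (p.1 0 i) < x 0 i < ratr (p.2 0 i)].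
pose F p := if `[< box p `<=` A >] then f @^-1` box p else set0.
have -> : f @^-1` A = \bigcup_p F p.
  apply/seteqP; split=> [t /= Aft|t [p _]]; last first.
    by rewrite /F; case: asboolP => // sub; exact: sub.
  have : nbhs (f t) A by move: oA; rewrite openE => /(_ _ Aft).
  move=> /nbhs_ballP[e /= e0 sub].
  have le i : f t 0 i - e < f t 0 i by rewrite ltrBlDr ltrDl.
  have re i : f t 0 i < f t 0 i + e by rewrite ltrDl.
  pose a := \row_i projT1 (cid (rat_in_itvoo (le i))).
  pose b := \row_i projT1 (cid (rat_in_itvoo (re i))).
  have abP i : f t 0 i - e < ratr (a 0 i) < f t 0 i /\
               f t 0 i < ratr (b 0 i) < f t 0 i + e.
    rewrite !mxE; case: cid => x /= hx; case: cid => y /= hy.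
    by move: hx hy; rewrite !in_itv.
  exists (a, b) => //; rewrite /F; case: asboolP => [_ i|].
    by have [/andP[_ ->] /andP[-> _]] := abP i.
  case=> x xab; apply: sub; split=> // i j; rewrite ord1.
  have [/andP[a1 _] /andP[_ b2]] := abP j; have /andP[a2 b1] := xab j.
  by rewrite /ball /= distrC ltr_distl (lt_trans a1 a2) (lt_trans b1 b2).
apply: countable_bigcupT_measurable; first exact: countableP.
move=> p; rewrite /F; case: ifP => // _.
have -> : f @^-1` box p = \bigcap_(i in [set: 'I_n])
    ((fun t => f t 0 i) @^-1` `]ratr (p.1 0 i), ratr (p.2 0 i)[).
  apply/seteqP; split=> [t bt i _|t bt i].
    by rewrite /= in_itv; exact: bt.
  by have := bt i Logic.I; rewrite /= in_itv.
apply: fin_bigcap_measurable => [|i _]; first exact: finite_finset.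
by rewrite -[X in measurable X]setTI; apply: mf => //; exact: measurable_itv.
Qed.
End Borel.

Section Lebesgue.
Context {R : realType}.

Definition cons_rV n (p : measurableTypeR R * 'rV[R]_n) : 'rV[R]_n.+1 :=
  \row_i oapp (p.2 0) p.1 (unlift ord0 i).

Definition uncons_rV n (x : 'rV[R]_n.+1) : measurableTypeR R * 'rV[R]_n :=
  (x 0 ord0, \row_i x 0 (lift ord0 i)).

Lemma cons_rV0 n (p : measurableTypeR R * 'rV[R]_n) : cons_rV p 0 ord0 = p.1.
Proof. by rewrite mxE unlift_none. Qed.

Lemma cons_rVS n (p : measurableTypeR R * 'rV[R]_n) i :
  cons_rV p 0 (lift ord0 i) = p.2 0 i.
Proof. by rewrite mxE liftK. Qed.

Lemma cons_rVK n : cancel (@cons_rV n) (@uncons_rV n).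
Proof.
move=> -[a v]; rewrite /uncons_rV cons_rV0; congr (_, _).
by apply/rowP => i; rewrite mxE cons_rVS.
Qed.

Lemma measurable_cons_rV n : measurable_fun setT (@cons_rV n).
Proof.
apply: measurable_fun_coord => i.
case: (unliftP ord0 i) => [j|] ->.
  under eq_fun do rewrite cons_rVS.
  exact: (measurableT_comp (measurable_coord j) measurable_snd).
under eq_fun do rewrite cons_rV0.
exact: measurable_fst.
Qed.

Lemma measurable_uncons_rV n : measurable_fun setT (@uncons_rV n).
Proof.
apply: measurable_fun_pair; first exact: measurable_coord.
apply: measurable_fun_coord => i.
under eq_fun do rewrite mxE.
exact: measurable_coord.
Qed.

Section step.
Variables (n : nat) (m : {sigma_finite_measure set 'rV[R]_n -> \bar R}).

Definition lebesgue_cons : set 'rV[R]_n.+1 -> \bar R :=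
  pushforward (lebesgue_measure \x m)%E (@cons_rV n).

HB.instance Definition _ := Measure.copy lebesgue_cons
  (measure_function_pushforward__canonical__measure_function_Measure
     (lebesgue_measure \x m)%E (@measurable_cons_rV n)).

Lemma sigma_finite_lebesgue_cons : sigma_finite setT lebesgue_cons.
Proof.
have /sigma_finiteP[F [FT ndF Foo]] := sigma_finiteT (@lebesgue_measure R).
have /sigma_finiteP[G [GT ndG Goo]] := sigma_finiteT m.
exists (fun k => @uncons_rV n @^-1` (F k `*` G k)).
  rewrite -preimage_bigcup; apply/esym/seteqP; split=> // x _ /=.
  have [i _ Fi] : (\bigcup_k F k) (uncons_rV x).1 by rewrite -FT.
  have [j _ Gj] : (\bigcup_k G k) (uncons_rV x).2 by rewrite -GT.
  exists (maxn i j) => //; split.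
  - by move: Fi; exact/subsetPset/ndF/leq_maxl.
  - by move: Gj; exact/subsetPset/ndG/leq_maxr.
move=> k; have [mF Fk] := Foo k; have [mG Gk] := Goo k; split.
  rewrite -[X in measurable X]setTI; apply: measurable_uncons_rV => //.
  exact: measurableX.
rewrite /lebesgue_cons /pushforward -comp_preimage.
rewrite (_ : uncons_rV (n:=n) \o _ = id) ?preimage_id.
  by rewrite product_measure1E// lte_mul_pinfty// ge0_fin_numE.
by apply/funext => p /=; exact: cons_rVK.
Qed.

HB.instance Definition _ := Measure_isSigmaFinite.Build _ _ _ lebesgue_cons
  sigma_finite_lebesgue_cons.
End step.

Fixpoint lebesgue_rV n : {sigma_finite_measure set 'rV[R]_n -> \bar R} :=
  match n with
  | 0%N => dirac (0 : 'rV[R]_0)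
  | n'.+1 => lebesgue_cons (lebesgue_rV n')
  end.

Lemma lebesgue_rV_prod n (A : 'I_n -> set R) :
  (forall i, measurable (A i)) ->
  lebesgue_rV n [set x | forall i, A i (x 0 i)]
  = (\prod_i lebesgue_measure (A i))%E.
Proof.
elim: n => [|n IHn] in A *; move=> mA.
  rewrite big_ord0 /= diracE mem_set//.
  by move=> [].
rewrite big_ord_recl -IHn//.
pose B := [set x : 'rV[R]_n | forall i, A (lift ord0 i) (x 0 i)].
have mB : measurable B.
  rewrite (_ : B = \bigcap_(i in [set: 'I_n])
      ((fun x => x 0 i) @^-1` A (lift ord0 i))).
    apply: fin_bigcap_measurable => [|i _]; first exact: finite_finset.
    by rewrite -[X in measurable X]setTI; exact: measurable_coord.
  by apply/seteqP; split=> [x Ax i _|x Ax i]; [exact: Ax|exact: (Ax i)].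
rewrite -product_measure1E//; last exact: mA.
congr ((lebesgue_measure \x lebesgue_rV n)%E _).
apply/seteqP; split=> -[a v] /=.
  move=> h; split; first by have := h ord0; rewrite cons_rV0.
  by move=> i; have := h (lift ord0 i); rewrite cons_rVS.
move=> [a0 h] i; case: (unliftP ord0 i) => [j|] ->.
  by rewrite cons_rVS.
by rewrite cons_rV0.
Qed.
End Lebesgue.

Section Euclidean.
Context {R : realType} {n : nat}.
Implicit Types (x y : 'rV[R]_n) (f : 'rV[R]_n -> R).

Definition dotr x y : R := \sum_i x 0 i * y 0 i.

(* The library norm on row vectors is the sup norm. *)
Definition enorm x : R := Num.sqrt (dotr x x).

Definition half_sqr x : R := enorm x ^+ 2 / 2.

Definition grad f x : 'rV[R]_n := \row_i 'D_(delta_mx 0 i) f x.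

Definition partial (s : seq 'I_n) f : 'rV[R]_n -> R :=
  foldr (fun i g => 'D_(delta_mx 0 i) g) f s.

Definition strongly_convex (kappa : R) f : Prop :=
  convex_function [set: convex_lmodType 'rV[R]_n]
    (fun x => f x - kappa * half_sqr x).

Definition conjugate f y : \bar R :=
  ereal_sup (range (fun x => (dotr y x - f x)%:E)).
End Euclidean.

Section Holder.
Context {R : realType} {n : nat}.
Implicit Types (U : set 'rV[R]_n) (f : 'rV[R]_n -> R).

Definition Ck (k : nat) U f : Prop :=
  (forall s i x, (size s < k)%N -> U x ->
     derivable (partial s f) x (delta_mx 0 i)) /\
  (forall s x, (size s <= k)%N -> U x -> {for x, continuous (partial s f)}).

Definition holder_on (alpha : R) (A : set 'rV[R]_n) f : Prop :=
  exists M : R, forall x y, A x -> A y ->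
    `|f x - f y| <= M * enorm (x - y) `^ alpha.

(* For open U, C^{k,alpha}(U) asks for a Hoelder bound on each compact subset
   of U, whereas C^{k,alpha}(closure U) asks for a bound uniform over U and for
   continuous extensions of all derivatives to the closure. *)
Definition Ck_holder (k : nat) (alpha : R) U f : Prop :=
  Ck k U f /\
  forall s K, size s = k -> compact K -> K `<=` U ->
    holder_on alpha K (partial s f).

Definition Ck_holder_closure (k : nat) (alpha : R) U f : Prop :=
  [/\ Ck k U f,
      forall s, (size s <= k)%N -> exists g : 'rV[R]_n -> R,
        {within closure U, continuous g} /\
        forall x, U x -> g x = partial s f x
    & forall s, size s = k -> holder_on alpha U (partial s f)].
End Holder.

Definition boundary {T : topologicalType} (A : set T) : set T :=
  closure A `\` A°.

(* Near each of its points the boundary is straightened by a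
   C^{k,alpha}-diffeomorphism p : B -> D with inverse q (Gilbarg-Trudinger). *)
Definition Ck_holder_boundary {R : realType} {n : nat} (k : nat) (alpha : R)
    (Omega : set 'rV[R]_n.+1) : Prop :=
  forall x0, boundary Omega x0 ->
  exists (B D : set 'rV[R]_n.+1) (p q : 'rV[R]_n.+1 -> 'rV[R]_n.+1),
    [/\ [/\ open B, B x0, open D, set_bij B D p & forall x, B x -> q (p x) = x],
        (forall i, Ck_holder k alpha B (fun x => p x 0 i)),
        (forall i, Ck_holder k alpha D (fun y => q y 0 i)),
        (forall x, B x -> Omega x -> 0 < p x 0 ord_max)
      & (forall x, B x -> boundary Omega x -> p x 0 ord_max = 0)].

Definition oplus {R : realType} {T1 T2 : Type} (f : T1 -> \bar R)
    (g : T2 -> \bar R) (z : T1 * T2) : \bar R := (f z.1 + g z.2)%E.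

Section Schroedinger.
Context {R : realType} {n : nat}.
Variables (mu nu : probability 'rV[R]_n R) (Omega Omega' : set 'rV[R]_n).
Variable eps : R.
Implicit Types f g : 'rV[R]_n -> R.

Definition dual_objective f g : \bar R :=
  (\int[mu]_(x in Omega) (f x)%:E + \int[nu]_(y in Omega') (g y)%:E
   - eps%:E * \int[(mu \x nu)%E]_(z in Omega `*` Omega')
       (expR ((f z.1 + g z.2 - half_sqr (z.1 - z.2)) / eps))%:E
   + eps%:E)%E.

(* The supremum of the dual problem ranges over L^1(mu) x L^1(nu); for
   integrable f and g only the exponential term can be infinite. *)
Definition dual_admissible f g : Prop :=
  mu.-integrable Omega (EFin \o f) /\ nu.-integrable Omega' (EFin \o g).

Definition schroedinger_potentials f g : Prop :=
  dual_admissible f g /\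
  forall f' g', dual_admissible f' g' ->
    (dual_objective f' g' <= dual_objective f g)%E.
End Schroedinger.

(* Main.v *)
(** Put eps = r^2, T = grad phi and n = d+1, and pull the second variable back
    by y = T z. Optimality of the potentials says that
      p(x,z) = exp (- D(x,z)/eps - U(x) - W(z))
    has both marginals equal to mu; here D is the Bregman divergence of phi,
    and U, W are the errors of the two potentials divided by eps, so that the
    gap is eps * int int |U(x) + W(z)|.

    Integrating e^t >= 1 + t against p compares the mass of the Gaussian kernel
    r^-n exp (- D/eps) with int (U + W): this gives
    int (U + W) <= - n log(1/r) + C, hence the lower bound. Put
    om = exp (- (U + W + n log(1/r)) / 2). The geometric mean of p(x,z) and
    p(z,x) is r^-n om(x) om(z) times a Gaussian and is bounded by their
    arithmetic mean; summing over cells of side r bounds int om, so that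
    int |U + W| <= n log(1/r) + C.

    For V = U - W, the marginal conditions give
    int int (p(z,x) - p(x,z)) (V(x) - V(z)) = 0. Since D is symmetric up to
    third order, the dissipation int int (p(z,x) - p(x,z)) log (p(z,x)/p(x,z)) is
    O(eps); it controls the differences of V at distance at most r, and a
    Poincare inequality going from scale r to scale 1 on Omega (chains of small
    steps, cones at the boundary) bounds int int |V(x) - V(z)|. The upper bound
    follows from 2 (U(x) + W(z)) = (U+W)(x) + (U+W)(z) + V(x) - V(z). *)
Require Import Defs.
From HB Require Import structures.
From mathcomp Require Import all_boot all_order all_algebra.
From mathcomp Require Import all_classical all_reals all_analysis.
From mathcomp Require Import measurable_realfun ring lra.

Set Implicit Arguments.
Unset Strict Implicit.
Unset Printing Implicit Defensive.

Import Order.TTheory GRing.Theory Num.Theory.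
Import numFieldNormedType.Exports.

Local Open Scope classical_set_scope.
Local Open Scope ring_scope.

(** * Tonelli and translation lemmas for row vectors *)

(** Two exponents have to match exactly. Going from differences of V at distance r to all of Omega
    loses r^-(n+1): r^-n normalizes the integral over |x - z| <= r by its volume, and r^-1 is the
    number of chained steps. So the near-diagonal integral of |V x - V z| must be O(r^(n+1)), that
    is, V varies by O(r) on average at distance r. A dissipation of order eps gives just this
    through Young's inequality with weight r^n / r, provided that the reciprocal of the symmetrized
    kernel is under control, which amounts to an L^2 bound on 1/om. Such a bound is obtained only at
    points where little dissipation occurs. The exceptional points have measure O(eps), and for them
    the crude Lipschitz bound O(1/eps), which the potentials inherit from the cost, is enough: it
    gives O(1/r) at distance r. Distances are sup norms, so balls and mesh cells are cubes. The
    marginal equations hold almost everywhere; the estimates are made on a set of full measure where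
    they hold everywhere. This set depends on eps, hence the constants must not depend on it. *)

Section Tonelli.
Context d1 d2 (T1 : measurableType d1) (T2 : measurableType d2) (R : realType).
Variables (m1 : {sigma_finite_measure set T1 -> \bar R})
  (m2 : {sigma_finite_measure set T2 -> \bar R}).
Variables (A : set T1) (B : set T2) (mA : measurable A) (mB : measurable B).
Variable F : T1 * T2 -> R.
Hypotheses (mF : measurable_fun setT F)
  (F0 : forall x y, A x -> B y -> 0 <= F (x, y)).

(** Extension by zero lets Tonelli on the whole product apply, although [F] is nonnegative only over
    [A] and [B]. *)
Let FX : T1 * T2 -> \bar R := (EFin \o F) \_ (A `*` B).

Let mFX : measurable_fun [set: T1 * T2] FX.
Proof.
apply/(measurable_restrictT _ _).1; first exact: measurableX.
by apply/measurable_EFinP; exact: measurable_funTS.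
Qed.

Let FX0 w : (0 <= FX w)%E.
Proof.
rewrite /FX patchE; case: ifPn => //; rewrite inE => -[Aw Bw].
by rewrite lee_fin; case: w Aw Bw => ? ? /=; exact: F0.
Qed.

Let FX_inner x : fubini_F m2 FX x
  = ((fun x => \int[m2]_(y in B) (F (x, y))%:E)%E \_ A) x.
Proof.
rewrite /fubini_F patchE; case: ifPn => xA.
  rewrite [RHS]integral_mkcond; apply: eq_integral => y _.
  by rewrite /FX !patchE in_setX /= xA.
rewrite (eq_integral (cst 0%E)) ?integral0// => y _.
by rewrite /FX patchE in_setX /= (negbTE xA).
Qed.

Lemma tonelli_inner_measurable :
  measurable_fun A (fun x => \int[m2]_(y in B) (F (x, y))%:E)%E.
Proof.
apply/(measurable_restrictT _ mA).2.
have := measurable_fun_fubini_tonelli_F _ mFX FX0.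
by move/(_ m2); congr measurable_fun; apply/funext => x; exact: FX_inner.
Qed.

Lemma tonelli_in : (\int[m1 \x m2]_(w in A `*` B) (F w)%:E
  = \int[m1]_(x in A) \int[m2]_(y in B) (F (x, y))%:E)%E.
Proof.
rewrite integral_mkcond [RHS]integral_mkcond.
rewrite (fubini_tonelli1 _ mFX FX0); apply: eq_integral => x _.
exact: FX_inner.
Qed.

Lemma tonelli_in_swap : (\int[m1]_(x in A) \int[m2]_(y in B) (F (x, y))%:E
  = \int[m2]_(y in B) \int[m1]_(x in A) (F (x, y))%:E)%E.
Proof.
rewrite -tonelli_in integral_mkcond (fubini_tonelli2 _ mFX FX0).
rewrite [RHS]integral_mkcond; apply: eq_integral => y _.
rewrite /fubini_G patchE; case: ifPn => yB.
  rewrite [RHS]integral_mkcond; apply: eq_integral => x _.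
  by rewrite /FX !patchE in_setX /= yB andbT.
rewrite (eq_integral (cst 0%E)) ?integral0// => x _.
by rewrite /FX patchE in_setX /= (negbTE yB) andbF.
Qed.
End Tonelli.

Lemma measurable_indicator d (T : measurableType d) (R : realType) (b : T -> bool) :
  measurable_fun setT b -> measurable_fun setT (fun t => (b t)%:R : R).
Proof.
move=> mb; rewrite (_ : (fun _ => _) = fun t => if b t then 1 else 0 : R).
  by apply: measurable_fun_ifT.
by apply/funext => t; case: (b t).
Qed.

Section Translation.
Context {R : realType}.

Let shift1 (h : R) (x : measurableTypeR R) : measurableTypeR R := x + h.

Let measurable_shift1 h : measurable_fun setT (shift1 h).
Proof. by apply: measurable_funD => //; exact: measurable_cst. Qed.

Lemma lebesgue_measure_shift (h : R) (A : set (measurableTypeR R)) :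
  measurable A ->
  lebesgue_measure ((fun x => x + h) @^-1` A) = lebesgue_measure A.
Proof.
move=> mA.
pose m := measure_function_pushforward__canonical__measure_function_Measure
  (@lebesgue_measure R) (measurable_shift1 h).
rewrite [RHS](@lebesgue_measure_unique _ m)//.
move=> _ [[a b] _ <-] /=.
rewrite /m /= /pushforward.
have -> : shift1 h @^-1` [set` `]a, b]] = [set` `]a - h, b - h]].
  by apply/seteqP; split=> x /=; rewrite !in_itv /= ltrBlDr lerBrDr.
rewrite !lebesgue_measure_itv/= !lte_fin ltrD2r; case: ifP => // _.
by rewrite -!EFinB opprB addrA subrK.
Qed.

Lemma ge0_lebesgue_integral_shift (h : R) (F : measurableTypeR R -> \bar R) :
  measurable_fun setT F -> (forall x, 0 <= F x)%E ->
  (\int[lebesgue_measure]_x F (x + h)%R = \int[lebesgue_measure]_x F x)%E.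
Proof.
move=> mF F0.
pose m := measure_function_pushforward__canonical__measure_function_Measure
  (@lebesgue_measure R) (measurable_shift1 h).
rewrite -[RHS](@eq_measure_integral _ _ _ _ (@lebesgue_measure R) m); last first.
  by move=> A mA _; exact: lebesgue_measure_shift.
by rewrite (ge0_integral_pushforward (measurable_shift1 h)) ?preimage_setT.
Qed.

Lemma measurable_shift n (h : 'rV[R]_n) : measurable_fun setT (fun x : 'rV[R]_n => x + h).
Proof.
apply: measurable_fun_coord => i; under eq_fun do rewrite mxE.
by apply: measurable_funD; [exact: measurable_coord|exact: measurable_cst].
Qed.

(** Induction along the recursive construction of the measure: the first coordinate is translated in
    a one-dimensional integral, the remaining ones inside each section by [IHn]. *)
Lemma lebesgue_rV_shift n (h : 'rV[R]_n) (A : set 'rV[R]_n) : measurable A ->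
  lebesgue_rV n ((fun x => x + h) @^-1` A) = lebesgue_rV n A.
Proof.
elim: n => [|n IHn] in h A *; move=> mA.
  rewrite (_ : (fun x => x + h) = id) ?preimage_id//.
  by apply/funext => x; apply/rowP => -[].
have msec (B : set 'rV[R]_n.+1) : measurable B ->
    measurable (@cons_rV R n @^-1` B).
  by move=> mB; rewrite -[X in measurable X]setTI; exact: measurable_cons_rV.
rewrite /= /lebesgue_cons /pushforward.
pose G (a : measurableTypeR R) :=
  lebesgue_rV n (xsection (@cons_rV R n @^-1` A) a).
transitivity (\int[@lebesgue_measure R]_a G a)%E; last by [].
rewrite -(@ge0_lebesgue_integral_shift (h 0 ord0))//; last 1 first.
  by apply: measurable_fun_xsection; exact: msec.
apply: eq_integral => a _ /=.
rewrite /G -[in RHS](IHn (\row_i h 0 (lift ord0 i))); last first.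
  by apply: measurable_xsection; exact: msec.
congr (lebesgue_rV n _); apply/seteqP; split=> v; rewrite /xsection /= !inE /=.
  congr A; apply/rowP => i; rewrite !mxE.
  by case: (unliftP ord0 i) => [j|] ->; rewrite ?liftK ?unlift_none /= ?mxE.
congr A; apply/rowP => i; rewrite !mxE.
by case: (unliftP ord0 i) => [j|] ->; rewrite ?liftK ?unlift_none /= ?mxE.
Qed.

Lemma ge0_lebesgue_rV_integral_shift n (h : 'rV[R]_n) (F : 'rV[R]_n -> \bar R) :
  measurable_fun setT F -> (forall x, 0 <= F x)%E ->
  (\int[lebesgue_rV n]_x F (x + h)%R = \int[lebesgue_rV n]_x F x)%E.
Proof.
move=> mF F0.
pose m := measure_function_pushforward__canonical__measure_function_Measure
  (lebesgue_rV n) (@measurable_shift n h).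
rewrite -[RHS](@eq_measure_integral _ _ _ _ (lebesgue_rV n) m); last first.
  by move=> A mA _; exact: lebesgue_rV_shift.
by rewrite (ge0_integral_pushforward (@measurable_shift n h)) ?preimage_setT.
Qed.

End Translation.

(** * Row vectors under the sup norm: measurability and volumes of cubes *)

Section Rows.
Context {R : realType} {n : nat}.
Implicit Types (x y : 'rV[R]_n).

Lemma open_measurable_fun (D : set 'rV[R]_n) (F : 'rV[R]_n -> R) :
  open D -> (forall x, D x -> {for x, continuous F}) -> measurable_fun D F.
Proof.
move=> oD cF.
apply: (measurability _ (RGenOpens.measurableE R)).
move=> _ [_ [a [b ->]] <-]; apply: open_measurable_rV.
rewrite openE => x [Dx /= Fx].
apply: filterI; first by move: oD; rewrite openE; exact.
by apply: cF => //; apply: interval_open => //.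
Qed.

Lemma measurable_rV_norm : measurable_fun setT (fun x : 'rV[R]_n => `|x|).
Proof.
apply: open_measurable_fun; first exact: openT.
by move=> x _; exact: norm_continuous.
Qed.

Lemma measurable_rV_sub d (T : measurableType d) (f g : T -> 'rV[R]_n) :
  measurable_fun setT f -> measurable_fun setT g ->
  measurable_fun setT (fun t => f t - g t).
Proof.
move=> mf mg; apply: measurable_fun_coord => i.
under eq_fun do rewrite !mxE.
by apply: measurable_funB; exact: (measurableT_comp (measurable_coord i)).
Qed.

Lemma measurable_rV_add d (T : measurableType d) (f g : T -> 'rV[R]_n) :
  measurable_fun setT f -> measurable_fun setT g ->
  measurable_fun setT (fun t => f t + g t).
Proof.
move=> mf mg; apply: measurable_fun_coord => i.
under eq_fun do rewrite !mxE.
by apply: measurable_funD; exact: (measurableT_comp (measurable_coord i)).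
Qed.

Lemma measurable_dotr d (T : measurableType d) (f g : T -> 'rV[R]_n) :
  measurable_fun setT f -> measurable_fun setT g ->
  measurable_fun setT (fun t => dotr (f t) (g t)).
Proof.
move=> mf mg; apply: measurable_sum => i.
by apply: measurable_funM; exact: (measurableT_comp (measurable_coord i)).
Qed.

Lemma rV_norm_leP x (e : R) : 0 <= e ->
  reflect (forall i, `|x 0 i| <= e) (`|x| <= e).
Proof.
move=> e0; apply: (iffP idP) => [xe i|xe].
  apply: le_trans xe; rewrite /Num.norm/= mx_normrE.
  exact: (le_bigmax _ (fun ij : 'I_1 * 'I_n => `|x ij.1 ij.2|) (0, i)).
rewrite /Num.norm/= mx_normrE; apply/bigmax_leP; split=> // -[i j] _ /=.
by rewrite ord1.
Qed.

Lemma rV_coord_le_norm x i : `|x 0 i| <= `|x|.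
Proof. exact: (rV_norm_leP x (normr_ge0 x) _). Qed.

Lemma lebesgue_rV_cube (a : 'rV[R]_n) (r : R) : 0 <= r ->
  lebesgue_rV n [set x | forall i, a 0 i <= x 0 i < a 0 i + r] = (r ^+ n)%:E.
Proof.
move=> r0.
transitivity (lebesgue_rV n
  [set x | forall i, [set` `[a 0 i, a 0 i + r[] (x 0 i)]).
  congr (lebesgue_rV n _); apply/seteqP; split=> x xa i; have := xa i;
    by rewrite /= in_itv.
rewrite (lebesgue_rV_prod (A := fun i => [set` `[a 0 i, a 0 i + r[]))//.
rewrite (eq_bigr (fun=> r%:E)) => [|i _].
  rewrite big_const card_ord.
  by elim: n => [|k IH] /=; rewrite ?expr0// IH exprS EFinM.
rewrite lebesgue_measure_itv/= lte_fin; case: ltP => [_|].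
  by rewrite -EFinB addrC addKr.
by rewrite gerDl => r0'; congr EFin; apply/eqP; rewrite eq_le r0 r0'.
Qed.

Lemma measurable_cube (a : 'rV[R]_n) (r : R) :
  measurable [set x : 'rV[R]_n | forall i, a 0 i <= x 0 i < a 0 i + r].
Proof.
rewrite (_ : mkset _ = \bigcap_(i in [set: 'I_n])
    ((fun x => x 0 i) @^-1` `[a 0 i, a 0 i + r[)).
  apply: fin_bigcap_measurable => [|i _]; first exact: finite_finset.
  rewrite -[X in measurable X]setTI; apply: measurable_coord => //.
by apply/seteqP; split=> [x h i _|x h i]; have := h i; rewrite /= in_itv//=; exact.
Qed.

(** A sup-norm ball is a cube. The side is 3r instead of 2r because the cubes are half open and the
    ball is closed. *)
Lemma lebesgue_rV_ball_le (x0 : 'rV[R]_n) (r : R) (A : set 'rV[R]_n) :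
  0 < r -> measurable A -> (forall x, A x -> `|x - x0| <= r) ->
  (lebesgue_rV n A <= ((3 * r) ^+ n)%:E)%E.
Proof.
move=> r0 mA Ar.
rewrite -(lebesgue_rV_cube (x0 - const_mx r)) ?mulr_ge0 ?(ltW r0)//.
apply: le_measure; rewrite ?inE//; first exact: measurable_cube.
move=> x /Ar xr i; rewrite !mxE.
have := le_trans (rV_coord_le_norm (x - x0) i) xr.
by rewrite !mxE ler_distl => /andP[h1 h2]; apply/andP; split; lra.
Qed.
Lemma measurable_near (r : R) : measurable_fun setT
  (fun w : 'rV[R]_n * 'rV[R]_n => (`|w.1 - w.2| <= r)%R%:R : R).
Proof.
apply: measurable_indicator; apply: measurable_fun_ler => //.
by apply: (measurableT_comp measurable_rV_norm); exact: measurable_rV_sub.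
Qed.
End Rows.

(** * A Poincare inequality from small to unit scale *)

Section Poincare.
Context {R : realType} {n : nat}.
Variable Om : set 'rV[R]_n.
Hypothesis oOm : open Om.
Local Notation L := (@lebesgue_rV R n).
Implicit Types (r rho : R) (V : 'rV[R]_n -> R) (A B E : set 'rV[R]_n) (x y z w v c : 'rV[R]_n).

Let mOm : measurable Om. Proof. exact: open_measurable_rV. Qed.

Definition oscillation V A B : \bar R :=
  (\int[L]_(x in A) \int[L]_(z in B) (`|V x - V z|)%:E)%E.

Definition local_osc V r y : \bar R :=
  (\int[L]_(z in Om) (`|V y - V z| * (`|y - z| <= r)%R%:R)%:E)%E.

Definition local_oscillation V r : \bar R := (\int[L]_(y in Om) local_osc V r y)%E.

Lemma measurable_diff V : measurable_fun setT V ->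
  measurable_fun setT (fun w : 'rV[R]_n * 'rV[R]_n => `|V w.1 - V w.2|).
Proof.
move=> mV; apply: (measurableT_comp (@normr_measurable _ _)).
by apply: measurable_funB; exact: measurableT_comp.
Qed.

Lemma local_osc_ge0 V r y : (0 <= local_osc V r y)%E.
Proof. by apply: integral_ge0 => z _; rewrite lee_fin mulr_ge0. Qed.

Lemma measurable_local_osc V r : measurable_fun setT V ->
  measurable_fun setT (local_osc V r).
Proof.
move=> mV.
have mF : measurable_fun setT (fun w : 'rV[R]_n * 'rV[R]_n =>
    `|V w.1 - V w.2| * (`|w.1 - w.2| <= r)%R%:R).
  by apply: measurable_funM; [exact: measurable_diff|exact: measurable_near].
have := tonelli_inner_measurable L measurableT mOm mF.
by apply => x y _ _; rewrite mulr_ge0.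
Qed.

Lemma measurable_shift_osc V c : measurable_fun setT V ->
  measurable_fun setT (fun x => V (x + c)).
Proof. by move=> mV; exact: (measurableT_comp mV (@measurable_shift _ _ c)). Qed.

Let cube (rho : R) : set 'rV[R]_n := [set x | forall i, 0 <= x 0 i < rho].

Let mcube rho : measurable (cube rho).
Proof.
have := measurable_cube (0 : 'rV[R]_n) rho; congr measurable.
by apply/seteqP; split=> x h i; have := h i; rewrite /= !mxE add0r.
Qed.

Let cubeE rho : 0 <= rho -> L (cube rho) = (rho ^+ n)%:E.
Proof.
move=> r0; rewrite -(lebesgue_rV_cube (0 : 'rV[R]_n) r0); congr (L _).
by apply/seteqP; split=> x h i; have := h i; rewrite /= !mxE add0r.
Qed.

Let cube_norm rho v : 0 <= rho -> cube rho v -> `|v| <= rho.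
Proof.
move=> r0 h; apply/rV_norm_leP => // i; have /andP[h1 h2] := h i.
by rewrite ger0_norm// ltW.
Qed.

(** Substituting z = y + a + v sends the cube into the domain of [local_osc V r y]: z is in [Om] and
    within [|a| + rho <= r] of y. *)
Let cube_le_local_osc V r rho a y : measurable_fun setT V -> 0 <= rho ->
  `|a| + rho <= r -> (forall v, `|v| <= rho -> Om (y + a + v)) ->
  (\int[L]_(v in cube rho) (`|V y - V (y + a + v)|)%:E <= local_osc V r y)%E.
Proof.
move=> mV r0 ar Om_y.
pose F z := (`|V y - V z| * (`|y - z| <= r)%R%:R * \1_Om z)%:E.
have mF : measurable_fun setT F.
  apply/measurable_EFinP; apply: measurable_funM; last exact: measurable_indic.
  apply: measurable_funM.
    exact: (measurable_fun_pair2 y (measurable_diff mV)).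
  exact: (measurable_fun_pair2 y (measurable_near r)).
have F0 z : (0 <= F z)%E by rewrite lee_fin !mulr_ge0.
have <- : (\int[L]_v F (v + (y + a))%R = local_osc V r y)%E.
  rewrite ge0_lebesgue_rV_integral_shift// /local_osc [RHS]integral_mkcond.
  apply: eq_integral => z _; rewrite patchE /F indicE.
  by case: ifP; rewrite ?mulr1 ?mulr0.
rewrite integral_mkcond; apply: ge0_le_integral => //.
- by move=> v _; rewrite patchE; case: ifP.
- apply/(measurable_restrictT _ _).1 => //; apply/measurable_EFinP.
  apply: measurable_funTS; apply: (measurableT_comp (@normr_measurable _ _)).
  apply: measurable_funB; first exact: measurable_cst.
  under eq_fun do rewrite addrC.
  exact: measurable_shift_osc.
- exact: (measurableT_comp mF (@measurable_shift _ _ (y + a))).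
move=> v _; rewrite patchE; case: ifPn => //; rewrite inE => cv.
have vr := cube_norm r0 cv.
rewrite /F lee_fin [v + _]addrC indicE mem_set ?mulr1; last exact: Om_y.
rewrite (_ : `|y - _| <= r) ?mulr1//.
by rewrite -addrA opprD addNKr normrN (le_trans (ler_normD _ _))// (le_trans _ ar)// lerD2l.
Qed.

#[local] Opaque local_osc.

(** For v in a cube of side [rho], whose volume is the factor on the left, the two values of V are
    compared through the point x + c + w + v, which lies in [Om] within r of both. Integrating over
    v costs one local oscillation per end point. *)
Lemma step_oscillation V r rho E c w : measurable_fun setT V -> 0 <= rho ->
  measurable E -> `|w| + rho <= r ->
  (forall x, E x -> Om (x + c)) ->
  (forall x v, E x -> `|v| <= rho -> Om (x + c + w + v)) ->
  ((rho ^+ n)%:E * \int[L]_(x in E) (`|V (x + c)%R - V (x + c + w)%R|)%:E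
   <= 2%:E * local_oscillation V r)%E.
Proof.
move=> mV r0 mE wr OmE Omv.
have mVc := measurable_shift_osc c mV.
have mVcw : measurable_fun setT (fun x => V (x + c + w)).
  by apply: (measurable_shift_osc c (V := fun x => V (x + w))); exact: measurable_shift_osc.
have mD : measurable_fun setT (fun x => `|V (x + c)%R - V (x + c + w)%R|).
  by apply: (measurableT_comp (@normr_measurable _ _)); exact: measurable_funB.
have mlo := measurable_local_osc r mV.
have int_shift a : (forall x, E x -> Om (x + a)) ->
    (\int[L]_(x in E) local_osc V r (x + a)%R <= local_oscillation V r)%E.
  move=> Oma; pose F := local_osc V r \_ Om.
  have F0 x : (0 <= F x)%E.
    by rewrite /F patchE; case: ifP => // _; exact: local_osc_ge0.
  have mF : measurable_fun setT F.
    by apply/(measurable_restrictT _ _).1 => //; exact: measurable_funTS.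
  rewrite /local_oscillation [leRHS]integral_mkcond.
  rewrite -(ge0_lebesgue_rV_integral_shift a mF F0).
  rewrite [leLHS]integral_mkcond; apply: ge0_le_integral; first exact: measurableT.
  - move=> x _; rewrite patchE; case: ifP => _; last exact: lexx.
    exact: local_osc_ge0.
  - apply/(measurable_restrictT _ _).1; first exact: mE.
    apply: measurable_funTS; exact: (measurableT_comp mlo (@measurable_shift _ _ a)).
  - exact: (measurableT_comp mF (@measurable_shift _ _ a)).
  move=> x _; rewrite patchE; case: ifPn => //; rewrite inE => Ex.
  by rewrite /F patchE mem_set//; exact: Oma.
rewrite -ge0_integralZl_EFin ?exprn_ge0//; last 1 first.
  by apply/measurable_EFinP; exact: measurable_funTS.
have -> : (2%:E * local_oscillation V r
    = local_oscillation V r + local_oscillation V r)%E.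
  by rewrite -mule2n muleC mule_natr.
have mlos a : measurable_fun E (fun x => local_osc V r (x + a)).
  by apply: measurable_funTS; exact: (measurableT_comp mlo (@measurable_shift _ _ a)).
apply: (@le_trans _ _ (\int[L]_(x in E)
   (local_osc V r (x + c)%R + local_osc V r (x + (c + w))%R))%E); last first.
  rewrite (ge0_integralD _ mE _ (mlos _) _ (mlos _)); last 2 first.
  - by move=> x _; exact: local_osc_ge0.
  - by move=> x _; exact: local_osc_ge0.
  apply: leeD; apply: int_shift => // x Ex; rewrite addrA -[_ + w]addr0.
  by apply: Omv => //; rewrite normr0.
apply: ge0_le_integral => //.
- by move=> x _; rewrite -EFinM lee_fin mulr_ge0 ?exprn_ge0.
- by apply/measurable_EFinP; apply: measurable_funM => //; exact: measurable_funTS.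
- exact: emeasurable_funD.
move=> x Ex; rewrite [(x + (c + w))%R]addrA.
have h1 := cube_le_local_osc (y := x + c) mV r0 wr (fun v => @Omv x v Ex).
have h2 := cube_le_local_osc (a := 0) (y := x + c + w) (r := r) mV r0.
rewrite normr0 add0r addr0 in h2.
have rhor : rho <= r by rewrite (le_trans _ wr)// lerDr.
have {}h2 := h2 rhor (fun v => @Omv x v Ex).
apply: le_trans (leeD h1 h2).
have mVp a : measurable_fun setT (fun v => V (a + v)).
  by under eq_fun do rewrite addrC; exact: measurable_shift_osc.
have mdV a b : measurable_fun (cube rho) (fun v => (`|V a - V (b + v)|)%:E).
  apply/measurable_EFinP; apply: measurable_funTS.
  apply: (measurableT_comp (@normr_measurable _ _)).
  by apply: measurable_funB; [exact: measurable_cst|exact: mVp].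
rewrite -ge0_integralD//.
rewrite muleC -cubeE// -integral_cst//.
apply: ge0_le_integral => //.
- by move=> v _; rewrite lee_fin.
- exact: emeasurable_funD.
move=> v _; rewrite -EFinD lee_fin [X in _ <= _ + X]distrC.
by rewrite (le_trans _ (ler_normD _ _))// addrA subrK.
Qed.

End Poincare.

Section Oscillation.
Context {R : realType} {n : nat}.
Variable Om : set 'rV[R]_n.
Hypothesis oOm : open Om.
Local Notation L := (@lebesgue_rV R n).
Implicit Types (r rho : R) (V : 'rV[R]_n -> R) (A B E : set 'rV[R]_n) (x y z w v c : 'rV[R]_n).

Let mdV V a b E : measurable_fun setT V -> 
  measurable_fun E (fun x => (`|V (x + a) - V (x + b)|)%:E).
Proof.
move=> mV; apply/measurable_EFinP; apply: measurable_funTS.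
apply: (measurableT_comp (@normr_measurable _ _)).
by apply: measurable_funB; exact: measurable_shift_osc.
Qed.

Let mdV0 V b E : measurable_fun setT V ->
  measurable_fun E (fun x => (`|V x - V (x + b)|)%:E).
Proof. by move=> mV; have := @mdV V 0 b E mV; under eq_fun do rewrite addr0. Qed.

Lemma local_oscillation_ge0 V r : (0 <= local_oscillation Om V r)%E.
Proof. by apply: integral_ge0 => y _; exact: local_osc_ge0. Qed.

(** [step_oscillation] is telescoped along k equal steps. Room of radius [rho] is required around
    every point of the chain except the first. *)
Lemma chain_oscillation V r rho E w k : measurable_fun setT V -> 0 <= rho ->
  measurable E -> `|w| + rho <= r ->
  (forall x, E x -> Om x) ->
  (forall x v j, E x -> (j < k)%N -> `|v| <= rho -> Om (x + w *+ j.+1 + v)) ->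
  ((rho ^+ n)%:E * \int[L]_(x in E) (`|V x - V (x + w *+ k)%R|)%:E
   <= (2 * k%:R)%:E * local_oscillation Om V r)%E.
Proof.
move=> mV r0 mE wr OmE.
elim: k => [|k IHk] Omv.
  rewrite (eq_integral (cst 0%E)); last first.
    by move=> x _; rewrite mulr0n addr0 subrr normr0.
  by rewrite integral0 mule0 mulr0 mul0e.
have {}IHk := IHk (fun x v j Ex jk => Omv x v j Ex (ltnW jk)).
have step : ((rho ^+ n)%:E * \int[L]_(x in E)
    (`|V (x + w *+ k)%R - V (x + w *+ k.+1)%R|)%:E
    <= 2%:E * local_oscillation Om V r)%E.
  rewrite (eq_integral (fun x => (`|V (x + w *+ k)%R - V (x + w *+ k + w)%R|)%:E)).
    apply: step_oscillation => //.
      move=> x Ex; case: k IHk Omv => [|k] IHk Omv.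
        by rewrite mulr0n addr0; exact: OmE.
      by rewrite -[(x + _)%R]addr0; apply: Omv; rewrite ?normr0.
    by move=> x v Ex vr; rewrite -[(x + _ + w)%R]addrA -mulrSr; exact: Omv.
  by move=> x _; rewrite -[(x + _ + w)%R]addrA -mulrSr.
have -> : (2 * k.+1%:R)%:E = ((2 * k%:R)%:E + 2%:E :> \bar R)%E.
  by rewrite -EFinD -natr1; congr EFin; ring.
rewrite ge0_muleDl; last 2 first.
- by rewrite lee_fin mulr_ge0.
- by rewrite lee_fin.
apply: le_trans (leeD IHk step).
rewrite -ge0_muleDr; last 2 first.
- by apply: integral_ge0 => x _; rewrite lee_fin.
- by apply: integral_ge0 => x _; rewrite lee_fin.
apply: lee_wpmul2l; first by rewrite lee_fin exprn_ge0.
rewrite -(ge0_integralD _ mE _ (@mdV0 V _ E mV) _ (@mdV V _ _ E mV)); last 2 first.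
- by move=> x _; rewrite lee_fin.
- by move=> x _; rewrite lee_fin.
apply: (ge0_le_integral _ mE _ (@mdV0 V _ E mV)).
- by move=> x _; rewrite lee_fin.
- by apply: emeasurable_funD; [exact: mdV0|exact: mdV].
move=> x _; rewrite -EFinD lee_fin.
by rewrite (le_trans _ (ler_normD _ _))// addrA subrK.
Qed.

Definition inner_osc V B x := (\int[L]_(z in B) (`|V x - V z|)%:E)%E.

Lemma oscillationE V A B :
  oscillation V A B = (\int[L]_(x in A) inner_osc V B x)%E.
Proof. by []. Qed.

Lemma measurable_inner_osc V A B : measurable_fun setT V -> measurable A ->
  measurable B -> measurable_fun A (inner_osc V B).
Proof.
move=> mV mA mB.
have := tonelli_inner_measurable L mA mB (measurable_diff mV).
by apply => x y _ _; rewrite normr_ge0.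
Qed.

Lemma inner_osc_ge0 V B x : (0 <= inner_osc V B x)%E.
Proof. by apply: integral_ge0 => z _; rewrite lee_fin. Qed.

Lemma oscillation_ge0 V A B : (0 <= oscillation V A B)%E.
Proof. by apply: integral_ge0 => z _; exact: inner_osc_ge0. Qed.

Let mdiff1 V B x : measurable_fun setT V ->
  measurable_fun B (fun z => (`|V x - V z|)%:E).
Proof.
move=> mV; apply/measurable_EFinP; apply: measurable_funTS.
exact: (measurable_fun_pair2 x (measurable_diff mV)).
Qed.


Lemma oscillationC V A B : measurable_fun setT V -> measurable A ->
  measurable B -> oscillation V A B = oscillation V B A.
Proof.
move=> mV mA mB; rewrite /oscillation.
rewrite (tonelli_in_swap L L mA mB (measurable_diff mV)); last first.
  by move=> x y _ _; rewrite normr_ge0.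
by apply: eq_integral => z _; apply: eq_integral => x _; rewrite distrC.
Qed.

Lemma oscillationS V A B A' B' : measurable_fun setT V -> measurable A ->
  measurable B -> measurable A' -> measurable B' -> A `<=` A' -> B `<=` B' ->
  (oscillation V A B <= oscillation V A' B')%E.
Proof.
move=> mV mA mB mA' mB' AA BB.
apply: (@le_trans _ _ (oscillation V A' B)); rewrite !oscillationE.
  apply: ge0_subset_integral; [exact: mA|exact: mA'| | |exact: AA].
    exact: measurable_inner_osc.
  by move=> x _; exact: inner_osc_ge0.
apply: ge0_le_integral; first exact: mA'.
- by move=> x _; exact: inner_osc_ge0.
- exact: measurable_inner_osc.
- exact: measurable_inner_osc.
move=> x _; apply: ge0_subset_integral; [exact: mB|exact: mB'| | |exact: BB].
  exact: mdiff1.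
by move=> z _; rewrite lee_fin.
Qed.

(** The triangle inequality through y is integrated over y in [B]. Written with products, it needs
    no finiteness or positivity of the volumes. *)
Lemma oscillation_trans V A B C : measurable_fun setT V -> measurable A ->
  measurable B -> measurable C ->
  (L B * oscillation V A C
   <= L C * oscillation V A B + L A * oscillation V C B)%E.
Proof.
move=> mV mA mB mC; rewrite !oscillationE.
have ma A' : measurable A' -> measurable_fun A' (inner_osc V B).
  by move=> mA'; exact: measurable_inner_osc.
have a0 x : (0 <= inner_osc V B x)%E by exact: inner_osc_ge0.
have h x z : (L B * (`|V x - V z|)%:E <= inner_osc V B x + inner_osc V B z)%E.
  rewrite muleC -integral_cst//.
  rewrite -(ge0_integralD _ mB _ (@mdiff1 V _ _ mV) _ (@mdiff1 V _ _ mV)); last 2 first.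
  - by move=> y _; rewrite lee_fin.
  - by move=> y _; rewrite lee_fin.
  apply: ge0_le_integral; first exact: mB.
  - by move=> y _; rewrite lee_fin.
  - exact: measurable_cst.
  - by apply: emeasurable_funD; exact: mdiff1.
  move=> y _; rewrite -EFinD lee_fin (distrC (V z)).
  by rewrite (le_trans _ (ler_normD _ _))// addrA subrK.
rewrite -ge0_integralZl; last 4 first.
- exact: mA.
- exact: measurable_inner_osc.
- by move=> x _; exact: inner_osc_ge0.
- exact: measure_ge0.
pose S := oscillation V C B.
apply: (@le_trans _ _ (\int[L]_(x in A) (L C * inner_osc V B x + S))%E).
  apply: ge0_le_integral; first exact: mA.
  - by move=> x _; rewrite mule_ge0//; exact: inner_osc_ge0.
  - by apply: measurable_funeM; exact: measurable_inner_osc.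
  - by apply: emeasurable_funD; [apply: measurable_funeM; exact: ma|exact: measurable_cst].
  move=> x Ax; rewrite -ge0_integralZl; last 4 first.
  - exact: mC.
  - exact: mdiff1.
  - by move=> z _; rewrite lee_fin.
  - exact: measure_ge0.
  rewrite muleC -integral_cst//.
  rewrite -(ge0_integralD _ mC _ (measurable_cst _) _ (ma _ mC)); last 2 first.
  - by move=> z _; exact: a0.
  - by move=> z _; exact: a0.
  apply: ge0_le_integral; first exact: mC.
  - by move=> z _; rewrite mule_ge0//; exact: measure_ge0.
  - by apply: measurable_funeM; exact: mdiff1.
  - by apply: emeasurable_funD; [exact: measurable_cst|exact: ma].
  by move=> z _; exact: h.
rewrite (ge0_integralD _ mA _ (measurable_funeM _ (ma _ mA)) _ (measurable_cst _)); last 2 first.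
- by move=> x _; rewrite mule_ge0//; exact: measure_ge0.
- by move=> x _; exact: oscillation_ge0.
rewrite ge0_integralZl; last 4 first.
- exact: mA.
- exact: ma.
- by move=> x _; exact: a0.
- exact: measure_ge0.
by rewrite integral_cst// [(S * _)%E]muleC.
Qed.

(** In the exponent n + 1, n undoes the volume of the r-neighbourhood in the local oscillation and 1
    counts the steps of a chain. The constants serve all V and all small r. *)
Definition comparable_osc A B := exists C r0 : R, [/\ 0 < C, 0 < r0 &
  forall r V, 0 < r < r0 -> measurable_fun setT V ->
  (oscillation V A B <= (C * r^-1 ^+ n.+1)%:E * local_oscillation Om V r)%E].

Lemma comparable_oscC A B : measurable A -> measurable B ->
  comparable_osc A B -> comparable_osc B A.
Proof.
move=> mA mB [C [r0 [C0 r00 h]]]; exists C, r0; split; [exact: C0|exact: r00|move=> r V r1 mV].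
by rewrite oscillationC//; exact: h.
Qed.

Lemma comparable_oscS A B A' B' : measurable A ->
  measurable B -> measurable A' -> measurable B' -> A `<=` A' -> B `<=` B' ->
  comparable_osc A' B' -> comparable_osc A B.
Proof.
move=> mA mB mA' mB' AA BB [C [r0 [C0 r00 h]]]; exists C, r0; split; [exact: C0|exact: r00|move=> r V r1 mV].
by apply: le_trans (h r V r1 mV); exact: oscillationS.
Qed.

Lemma comparable_osc_trans A B C : measurable A -> measurable B ->
  measurable C -> (L A < +oo)%E -> (L C < +oo)%E -> (0 < L B < +oo)%E ->
  comparable_osc A B -> comparable_osc C B -> comparable_osc A C.
Proof.
move=> mA mB mC Aoo Coo /andP[B0 Boo] [C1 [r1 [C10 r10 h1]]] [C2 [r2 [C20 r20 h2]]].
pose la := fine (L A); pose lb := fine (L B); pose lc := fine (L C).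
have Lfin D : (L D < +oo)%E -> L D = (fine (L D))%:E.
  by move=> Doo; rewrite fineK// ge0_fin_numE.
have lb0 : 0 < lb by apply: fine_gt0; rewrite B0.
have la0 : 0 <= la by exact: fine_ge0.
have lc0 : 0 <= lc by exact: fine_ge0.
exists (lb^-1 * (lc * C1 + la * C2 + 1)), (Num.min r1 r2); split.
- by rewrite mulr_gt0 ?invr_gt0// ltr_wpDl// addr_ge0// mulr_ge0// ltW.
- by rewrite lt_min r10.
move=> r V /andP[r0]; rewrite lt_min => /andP[rr1 rr2] mV.
have {}h1 := h1 r V (introT andP (conj r0 rr1)) mV.
have {}h2 := h2 r V (introT andP (conj r0 rr2)) mV.
have h := oscillation_trans mV mA mB mC.
have := local_oscillation_ge0 V r.
move: (local_oscillation Om V r) h1 h2 => N h1 h2 N0.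
move: (oscillation V A C) (oscillation V A B) (oscillation V C B) h h1 h2.
move=> sac sab scb h h1 h2.
set p := r^-1 ^+ n.+1 in h1 h2 *.
have p0 : 0 < p by rewrite exprn_gt0// invr_gt0.
rewrite -(@lee_pmul2l _ (lb%:E))// ?lte_fin//.
rewrite muleA -EFinM !mulrA mulfV ?gt_eqF// mul1r.
rewrite /lb -Lfin//; apply: (le_trans h).
rewrite (Lfin _ Aoo) (Lfin _ Coo) -/la -/lc.
apply: (@le_trans _ _ (lc%:E * ((C1 * p)%:E * N) + la%:E * ((C2 * p)%:E * N))%E).
  by apply: leeD; apply: lee_wpmul2l; rewrite ?lee_fin.
rewrite !muleA -!EFinM -ge0_muleDl; last 2 first.
- by rewrite lee_fin mulr_ge0// mulr_ge0// ltW.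
- by rewrite lee_fin mulr_ge0// mulr_ge0// ltW.
apply: lee_wpmul2r => //.
by rewrite -EFinD lee_fin !mulrA -mulrDl ler_wpM2r ?ltW// ltrDl.
Qed.

Lemma oscillationUl V A A' B : measurable_fun setT V -> measurable A ->
  measurable A' -> measurable B ->
  (oscillation V (A `|` A') B <= oscillation V A B + oscillation V A' B)%E.
Proof.
move=> mV mA mA' mB.
have -> : A `|` A' = A `|` (A' `\` A).
  apply/seteqP; split=> [x [Ax|Ax']|x [Ax|[Ax' _]]]; [by left| |by left|by right].
  by have [Ax|nAx] := pselect (A x); [left|right].
have mD : measurable (A' `\` A) by exact: measurableD.
rewrite !oscillationE ge0_integral_setU; first last.
- by apply/disj_setPS => x [] + [].
- by move=> x _; exact: inner_osc_ge0.
- by apply: measurable_inner_osc => //; exact: measurableU.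
- exact: mD.
- exact: mA.
rewrite -!oscillationE.
by apply: leeD; [exact: lexx|apply: oscillationS => // x []].
Qed.

Lemma comparable_oscUl A A' B : measurable A -> measurable A' -> measurable B ->
  comparable_osc A B -> comparable_osc A' B -> comparable_osc (A `|` A') B.
Proof.
move=> mA mB mC [C1 [r1 [C10 r10 h1]]] [C2 [r2 [C20 r20 h2]]].
exists (C1 + C2), (Num.min r1 r2); split; first exact: addr_gt0.
  by rewrite lt_min r10.
move=> r V /andP[r0]; rewrite lt_min => /andP[rr1 rr2] mV.
have {}h1 := h1 r V (introT andP (conj r0 rr1)) mV.
have {}h2 := h2 r V (introT andP (conj r0 rr2)) mV.
have p0 : 0 < r^-1 ^+ n.+1 by rewrite exprn_gt0// invr_gt0.
apply: (le_trans (oscillationUl mV mA mB mC)); apply: (le_trans (leeD h1 h2)).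
rewrite -ge0_muleDl; [|by rewrite lee_fin mulr_ge0// ltW..].
by rewrite -EFinD mulrDl.
Qed.

Lemma comparable_osc_bigUl (I : eqType) (s : seq I) (F : I -> set 'rV[R]_n) B :
  measurable B -> (forall i, measurable (F i)) ->
  (forall i, i \in s -> comparable_osc (F i) B) ->
  comparable_osc (\big[setU/set0]_(i <- s) F i) B.
Proof.
move=> mB mF; elim: s => [|i s IH] h.
  rewrite big_nil; exists 1, 1; split=> // r V /andP[r0 _] mV.
  rewrite /oscillation integral_set0 mule_ge0//; last exact: local_oscillation_ge0.
  by rewrite lee_fin mul1r exprn_ge0// invr_ge0 ltW.
rewrite big_cons; apply: comparable_oscUl => //.
- exact: bigsetU_measurable.
- by apply: h; rewrite mem_head.
- by apply: IH => j js; apply: h; rewrite in_cons js orbT.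
Qed.

End Oscillation.

(** * The inequality on interior balls and near boundary points *)

Section LocalPoincare.
Context {R : realType} {n : nat}.
Variable Om : set 'rV[R]_n.
Hypothesis oOm : open Om.
Local Notation L := (@lebesgue_rV R n).
Implicit Types (r rho : R) (V : 'rV[R]_n -> R) (A B E : set 'rV[R]_n) (x y z w v c : 'rV[R]_n).

Lemma ball_rVE (x0 : 'rV[R]_n) rho : ball x0 rho = [set y | `|x0 - y| < rho].
Proof. by rewrite -ball_normE. Qed.

Lemma measurable_ball_rV x0 rho : 0 < rho -> measurable (ball x0 rho : set 'rV[R]_n).
Proof. by move=> rho0; apply: open_measurable_rV; exact: ball_open. Qed.

Lemma lebesgue_rV_ball_lt (x0 : 'rV[R]_n) rho : 0 < rho ->
  (L (ball x0 rho) <= ((3 * rho) ^+ n)%:E)%E.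
Proof.
move=> r0; apply: (lebesgue_rV_ball_le (x0 := x0)) => //.
  exact: measurable_ball_rV.
by move=> x; rewrite ball_rVE /= distrC => /ltW.
Qed.

Lemma ball_rV_convex x0 rho x w (t : R) : ball x0 rho x -> ball x0 rho (x + w) ->
  0 <= t <= 1 -> ball x0 rho (x + t *: w).
Proof.
rewrite !ball_rVE /= => h1 h2 /andP[t0 t1].
have -> : x0 - (x + t *: w) = (1 - t) *: (x0 - x) + t *: (x0 - (x + w)).
  by apply/rowP => i; rewrite !mxE; ring.
rewrite (le_lt_trans (ler_normD _ _))// !normrZ ger0_norm ?subr_ge0// ger0_norm//.
have [->|t10] := eqVneq t 0.
  by rewrite subr0 mul1r mul0r addr0.
have {t0}t10 : 0 < t by rewrite lt_neqAle eq_sym t10.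
have : (1 - t) * `|x0 - x| <= (1 - t) * rho by rewrite ler_wpM2l ?subr_ge0// ltW.
have : t * `|x0 - (x + w)| < t * rho by rewrite ltr_pM2l.
by lra.
Qed.

Lemma step_count (l r : R) : 0 < r <= l ->
  exists2 k : nat, (0 < k)%N & l / r < k%:R <= 2 * l / r.
Proof.
move=> /andP[r0 rl]; exists (Num.truncn (l / r)).+1 => //.
have l0 : 0 < l by exact: lt_le_trans rl.
rewrite truncnS_gt -natr1; apply: (@le_trans _ _ (l / r + 1)).
  by rewrite lerD2r truncn_le// divr_ge0 ?ltW.
rewrite -mulrA mulr_natl mulr2n lerD2l.
by rewrite ler_pdivlMr// mul1r.
Qed.

(** With z = x + w, each fixed w is cut into k equal steps. By convexity the chain stays in the
    ball, and the room left in the triple ball absorbs perturbations of size r/2. Integrating over w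
    then reaches all pairs. *)
Lemma interior_comparable x0 rho : 0 < rho -> ball x0 (3 * rho) `<=` Om ->
  comparable_osc Om (ball x0 rho) (ball x0 rho).
Proof.
move=> rho0 sub; pose G : set 'rV[R]_n := ball x0 rho.
have mG : measurable G by exact: measurable_ball_rV.
have rho20 : 0 < 2 * rho by rewrite mulr_gt0.
pose W : set 'rV[R]_n := ball 0 (2 * rho).
have mW : measurable W by exact: measurable_ball_rV.
(* A chain has k <= 8 rho / r steps and costs 2k; the averaging radius r/2 gives 2^n r^-n; (6 rho)^n
   bounds the volume of the set [W] of displacements. *)
exists (16 * rho * 2 ^+ n * (6 * rho) ^+ n), rho; split; [|exact: rho0|].
  by rewrite !mulr_gt0 ?exprn_gt0 ?mulr_gt0.
move=> r V /andP[r0 rrho] mV.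
have [k k0 /andP[kgt kle]] : exists2 k : nat, (0 < k)%N &
    4 * rho / r < k%:R <= 2 * (4 * rho) / r.
  by apply: step_count; rewrite r0/= (le_trans (ltW rrho))// ler_peMl ?ler1n// ltW.
have k0' : 0 < k%:R :> R by rewrite ltr0n.
have := local_oscillation_ge0 Om V r.
set N := local_oscillation Om V r => N0.
pose F (p : 'rV[R]_n * 'rV[R]_n) : R := \1_G (p.1 + p.2) * `|V p.1 - V (p.1 + p.2)|.
have madd : measurable_fun setT (fun p : 'rV[R]_n * 'rV[R]_n => p.1 + p.2).
  exact: measurable_rV_add.
have mF : measurable_fun setT F.
  apply: measurable_funM.
    by apply: (measurableT_comp _ madd); exact: measurable_indic.
  apply: (measurableT_comp (@normr_measurable _ _)).
  by apply: measurable_funB; [exact: measurableT_comp|exact: (measurableT_comp mV madd)].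
have F0 p : 0 <= F p by rewrite mulr_ge0.
have bnd w : W w -> (\int[L]_(x in G) (F (x, w))%:E <=
   (16 * rho * 2 ^+ n * r^-1 ^+ n.+1)%:E * N)%E.
  move=> Ww.
  have w2 : `|w| < 2 * rho by move: Ww; rewrite /W ball_rVE /= sub0r normrN.
  pose E := G `&` [set x | G (x + w)].
  have mE : measurable E.
    apply: measurableI => //; rewrite -[X in measurable X]setTI.
    exact: (@measurable_shift _ _ w).
  have kw : (k%:R^-1 *: w) *+ k = w.
    by rewrite -scaler_nat scalerA mulfV ?gt_eqF// scale1r.
  have rr2 : 0 <= r / 2 by rewrite divr_ge0// ltW.
  have h1 : `|k%:R^-1 *: w| + r / 2 <= r.
    rewrite normrZ ger0_norm; last by rewrite invr_ge0 ltW.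
    rewrite -lerBrDr (_ : r - r / 2 = r / 2); last by field.
    rewrite mulrC ler_pdivrMr// (le_trans (ltW w2))//.
    move: kgt; rewrite ltr_pdivrMr// (_ : r / 2 * k%:R = k%:R * r / 2); last by ring.
    by move: (k%:R * r) => kr; lra.
  have h2 x : E x -> Om x.
    move=> [Gx _]; apply: sub; move: Gx; rewrite /G !ball_rVE /= => /lt_le_trans; apply.
    by rewrite ler_peMl ?ler1n// ltW.
  have h3 x v j : E x -> (j < k)%N -> `|v| <= r / 2 ->
      Om (x + (k%:R^-1 *: w) *+ j.+1 + v).
    move=> [Gx Gxw] jk vr; apply: sub; rewrite ball_rVE /=.
    rewrite -scaler_nat scalerA.
    have : G (x + (j.+1%:R * k%:R^-1) *: w).
      apply: ball_rV_convex => //; rewrite mulr_ge0 ?invr_ge0//=.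
      by rewrite ler_pdivrMr// mul1r ler_nat.
    rewrite /G ball_rVE /=; set y := x + _ => Gy.
    rewrite opprD addrA (le_lt_trans (ler_normB _ _))//.
    by move: Gy vr rrho; lra.
  have := chain_oscillation oOm mV rr2 mE h1 h2 h3; rewrite kw -/N => h.
  have rn0 : 0 < (r / 2) ^+ n by rewrite exprn_gt0// divr_gt0.
  have EF : (\int[L]_(x in G) (F (x, w))%:E
      = \int[L]_(x in E) (`|V x - V (x + w)%R|)%:E)%E.
    rewrite integral_mkcond [RHS]integral_mkcond; apply: eq_integral => x _.
    have -> : ((fun x => (`|V x - V (x + w)%R|)%:E) \_ E) x
        = if (x \in G) && ((x + w)%R \in G) then (`|V x - V (x + w)%R|)%:E else 0%E.
      rewrite patchE; congr (if _ then _ else _).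
      by apply/idP/andP; rewrite !inE => -[].
    rewrite patchE; case: ifP => //= _; rewrite /F /= indicE.
    by case: ifP; rewrite ?mul1r ?mul0r.
  rewrite EF -(@lee_pmul2l _ (((r / 2) ^+ n)%:E))// ?lte_fin//.
  apply: (le_trans h); rewrite muleA -EFinM; apply: lee_wpmul2r => //.
  rewrite lee_fin exprMn.
  have -> : r ^+ n * 2^-1 ^+ n * (16 * rho * 2 ^+ n * r^-1 ^+ n.+1) = 2 * (2 * (4 * rho) / r).
    rewrite exprS.
    have e1 : r ^+ n * r^-1 ^+ n = 1 by rewrite -exprMn mulfV ?gt_eqF// expr1n.
    have e2 : 2^-1 ^+ n * 2 ^+ n = 1 :> R by rewrite -exprMn mulVf ?expr1n// pnatr_eq0.
    transitivity ((r ^+ n * r^-1 ^+ n) * (2^-1 ^+ n * 2 ^+ n) * (16 * rho / r)); first by ring.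
    by rewrite e1 e2; ring.
  by rewrite ler_pM2l.
apply: (@le_trans _ _ (\int[L]_(w in W) \int[L]_(x in G) (F (x, w))%:E)%E).
  rewrite -(tonelli_in_swap L L mG mW mF); last by move=> x w _ _; exact: F0.
  apply: ge0_le_integral; first exact: mG.
  - by move=> x _; exact: inner_osc_ge0.
  - exact: measurable_inner_osc.
  - by apply: (tonelli_inner_measurable L mG mW mF).
  move=> x Gx.
  pose H z := ((\1_G z * `|V x - V z|)%:E : \bar R).
  have mH : measurable_fun setT H.
    apply/measurable_EFinP; apply: measurable_funM; first exact: measurable_indic.
    exact: (measurable_fun_pair2 x (measurable_diff mV)).
  have -> : (\int[L]_(z in G) (`|V x - V z|)%:E = \int[L]_z H z)%E.
    rewrite integral_mkcond; apply: eq_integral => z _.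
    by rewrite patchE /H indicE; case: ifP; rewrite ?mul1r ?mul0r.
  rewrite -(ge0_lebesgue_rV_integral_shift x mH); last first.
    by move=> z; rewrite lee_fin mulr_ge0.
  rewrite [leRHS]integral_mkcond; apply: ge0_le_integral; first exact: measurableT.
  - by move=> z _; rewrite lee_fin mulr_ge0.
  - exact: (measurableT_comp mH (@measurable_shift _ _ x)).
  - apply/(measurable_restrictT _ _).1; [exact: mW|apply/measurable_EFinP].
    by apply: measurable_funTS; exact: (measurable_fun_pair2 x mF).
  move=> w _; rewrite patchE /H [w + x]addrC; case: ifPn => // wW.
  rewrite indicE (_ : _ \in G = false) ?mul0r//.
  apply/negbTE; apply: contra wW; rewrite !inE /G /W !ball_rVE /= sub0r normrN => h.
  move: Gx; rewrite /G ball_rVE /= distrC => h'.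
  have -> : w = - ((x0 - (x + w)) + (x - x0)) by apply/rowP => i; rewrite !mxE; ring.
  by rewrite normrN (le_lt_trans (ler_normD _ _))//; lra.
apply: (@le_trans _ _ (\int[L]_(w in W) ((16 * rho * 2 ^+ n * r^-1 ^+ n.+1)%:E * N))%E).
  apply: ge0_le_integral; first exact: mW.
  - by move=> w _; apply: integral_ge0 => x _; rewrite lee_fin.
  - have mF' : measurable_fun setT (fun p => F (p.2, p.1)).
      by apply: (measurableT_comp mF); exact: measurable_swap.
    by have := tonelli_inner_measurable L mW mG mF'; apply.
  - exact: measurable_cst.
  - exact: bnd.
rewrite integral_cst//.
set K := 16 * rho * 2 ^+ n * r^-1 ^+ n.+1.
have -> : 16 * rho * 2 ^+ n * (6 * rho) ^+ n * r^-1 ^+ n.+1 = K * (6 * rho) ^+ n.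
  by rewrite /K; ring.
have K0 : 0 <= K by rewrite !mulr_ge0 ?exprn_ge0 ?invr_ge0// ltW.
rewrite (EFinM K) -!muleA [(((6 * rho) ^+ n)%:E * N)%E]muleC.
apply: lee_wpmul2l; first by rewrite lee_fin.
apply: lee_wpmul2l; first exact: N0.
by rewrite (_ : 6 * rho = 3 * (2 * rho)); [exact: lebesgue_rV_ball_lt|ring].
Qed.

(* A vertical strip of translates carries the estimate from the boundary to
   an interior ball. *)
Lemma boundary_comparable x0 (e : 'rV[R]_n) (h c delta : R) :
  closure Om x0 -> `|e| <= 1 -> 0 < h -> 0 < c <= 1 -> 0 < delta ->
  (forall x (t : R) v, Om x -> `|x0 - x| < delta -> 0 < t <= h ->
     `|v| <= c * t -> Om (x + t *: e + v)) ->
  exists2 rho, 0 < rho & comparable_osc Om (Om `&` ball x0 rho) (Om `&` ball x0 rho).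
Proof.
move=> clx0 e1 h0 /andP[c0 c1] delta0 cone.
(* The triple ball around x0 + h e must lie in [Om]: its points are x + h e + v with x in [Om] near
   x0 and |v| <= rho + 3 rho, which must not exceed c h. *)
pose rho := Num.min delta (c * h / 4).
have rho0 : 0 < rho by rewrite lt_min delta0 divr_gt0// mulr_gt0.
have rhod : rho <= delta by rewrite ge_min lexx.
have rhoc : rho <= c * h / 4 by rewrite ge_min lexx orbT.
exists rho => //.
pose G : set 'rV[R]_n := Om `&` ball x0 rho.
have mOm : measurable Om by exact: open_measurable_rV.
have mG : measurable G by apply: measurableI => //; exact: measurable_ball_rV.
pose B : set 'rV[R]_n := ball (x0 + h *: e) rho.
have mB : measurable B by exact: measurable_ball_rV.
have Gh x : G x -> B (x + h *: e).
  by move=> [_]; rewrite /B !ball_rVE /= opprD addrACA subrr addr0.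
have subB : ball (x0 + h *: e) (3 * rho) `<=` Om.
  move=> y; rewrite ball_rVE /= => yb.
  have [x [Omx]] := clx0 _ (nbhsx_ballx x0 rho rho0).
  rewrite ball_rVE /= => xb.
  have -> : y = x + h *: e + ((x0 - x) - (x0 + h *: e - y)).
    by apply/rowP => i; rewrite !mxE; ring.
  apply: cone; [exact: Omx|exact: lt_le_trans xb _|by apply/andP; split|].
  by rewrite (le_trans (ler_normB _ _))//; lra.
have [C1 [r1 [C10 r10 hB]]] := interior_comparable rho0 subB.
have lG : (L G <= ((3 * rho) ^+ n)%:E)%E.
  apply: (le_trans _ (lebesgue_rV_ball_lt x0 rho0)).
  by apply: le_measure; rewrite ?inE; [exact: mG|exact: measurable_ball_rV|move=> x []].
pose r0 := Num.min r1 (2 * h).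
have [C3 C30 hchain] : exists2 C3, 0 < C3 & forall r V, 0 < r < r0 ->
    measurable_fun setT V ->
    (\int[L]_(x in G) (`|V x - V (x + h *: e)%R|)%:E
      <= (C3 * r^-1 ^+ n.+1)%:E * local_oscillation Om V r)%E.
  (* The height h is climbed in k <= 4h/r steps of length tau = h/k. The cone leaves room c tau
     around each point reached, and tau >= r/4 turns (c tau)^-n into (4/c)^n r^-n. *)
  exists (8 * h * (4 / c) ^+ n).
    by rewrite !mulr_gt0// exprn_gt0// divr_gt0.
  move=> r V /andP[r_0]; rewrite lt_min => /andP[rr1 rh] mV.
  have [k k0 /andP[kgt kle]] : exists2 k : nat, (0 < k)%N &
      2 * h / r < k%:R <= 2 * (2 * h) / r.
    by apply: step_count; rewrite r_0 ltW.
  have k0' : 0 < k%:R :> R by rewrite ltr0n.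
  pose tau := h / k%:R.
  have tau0 : 0 < tau by rewrite divr_gt0.
  have tr : 2 * tau <= r.
    by rewrite /tau mulrA ler_pdivrMr// [r * _]mulrC -ler_pdivrMr// ltW.
  have rt : r <= 4 * tau.
    rewrite /tau mulrA ler_pdivlMr// [r * _]mulrC -ler_pdivlMr//.
    by rewrite (_ : 4 * h = 2 * (2 * h)); last by ring.
  have te : (tau *: e) *+ k = h *: e.
    by rewrite -scaler_nat scalerA /tau mulrCA mulfV ?gt_eqF// mulr1.
  have ct0 : 0 < c * tau by rewrite mulr_gt0.
  have h1 : `|tau *: e| + c * tau <= r.
    rewrite normrZ gtr0_norm// (le_trans _ tr)// (_ : 2 * tau = tau * 1 + 1 * tau); last by ring.
    by apply: lerD; rewrite ?ler_pM2l ?ler_pM2r.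
  have h2 x : G x -> Om x by move=> [].
  have h3 x v j : G x -> (j < k)%N -> `|v| <= c * tau -> Om (x + (tau *: e) *+ j.+1 + v).
    move=> [Omx xb] jk vc; rewrite -scaler_nat scalerA; apply: cone => //.
    - by move: xb; rewrite ball_rVE /= => /lt_le_trans; apply.
    - rewrite mulr_gt0//= /tau mulrCA ger_pMr// ler_pdivrMr// mul1r ler_nat//.
    - by rewrite (le_trans vc)// ler_pM2l// ler_peMl ?(ltW tau0)// ler1n.
  have := chain_oscillation oOm mV (ltW ct0) mG h1 h2 h3; rewrite te => hc.
  have ctn : 0 < (c * tau) ^+ n by rewrite exprn_gt0.
  rewrite -(@lee_pmul2l _ (((c * tau) ^+ n)%:E))// ?lte_fin//.
  apply: (le_trans hc); rewrite muleA -EFinM; apply: lee_wpmul2r.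
    exact: local_oscillation_ge0.
  rewrite lee_fin (@le_trans _ _ (2 * (2 * (2 * h) / r)))// ?ler_pM2l//.
  have -> : (c * tau) ^+ n * (8 * h * (4 / c) ^+ n * r^-1 ^+ n.+1)
      = (4 * tau / r) ^+ n * (2 * (2 * (2 * h) / r)).
    have -> : 4 * tau / r = (c * tau) * (4 / c) * r^-1 by field; rewrite !gt_eqF.
    by rewrite !exprMn exprS; ring.
  rewrite ler_peMl//; first by rewrite mulr_ge0// divr_ge0 ?(ltW r_0)// !mulr_ge0// ltW.
  rewrite exprn_ege1//.
  by rewrite ler_pdivlMr// mul1r.
(* V x - V z is compared through x + h e and z + h e: two vertical differences, each integrated
   against the volume of [G], and one oscillation over the interior ball [B]. *)
exists (2 * ((3 * rho) ^+ n * C3) + C1), r0; split.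
- by rewrite addr_gt0// !mulr_gt0// exprn_gt0// mulr_gt0.
- by rewrite lt_min r10 mulr_gt0.
move=> r V rr mV; have {}hchain := hchain r V rr mV.
have {}hB : (oscillation V B B <= (C1 * r^-1 ^+ n.+1)%:E * local_oscillation Om V r)%E.
  by apply: hB => //; move: rr; rewrite lt_min => /and3P[-> ->].
have r_0 : 0 < r by case/andP: rr.
have := local_oscillation_ge0 Om V r.
move: (local_oscillation Om V r) hchain hB => N hchain hB N0.
rewrite -/G.
pose a x := ((`|V x - V (x + h *: e)%R|)%:E : \bar R).
have mVh : measurable_fun setT (fun x => V (x + h *: e)) by exact: measurable_shift_osc.
have ma : measurable_fun setT a.
  apply/measurable_EFinP; apply: (measurableT_comp (@normr_measurable _ _)).
  exact: measurable_funB.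
have a0 x : (0 <= a x)%E by rewrite lee_fin.
pose b x := inner_osc (fun x => V (x + h *: e)) G x.
have mb : measurable_fun G b by exact: measurable_inner_osc.
have b0 x : (0 <= b x)%E by exact: inner_osc_ge0.
have maG : measurable_fun G a by exact: measurable_funTS.
have LG0 : (0 <= L G)%E by exact: measure_ge0.
have IaG0 : (0 <= \int[L]_(z in G) a z)%E by exact: integral_ge0.
have inner x : G x -> (inner_osc V G x <= L G * a x + (b x + \int[L]_(z in G) a z))%E.
  move=> Gx; rewrite muleC -integral_cst//.
  have mbx : measurable_fun G (fun z => (`|V (x + h *: e)%R - V (z + h *: e)%R|)%:E).
    apply/measurable_EFinP; apply: measurable_funTS.
    exact: (measurable_fun_pair2 x (measurable_diff mVh)).
  rewrite -(ge0_integralD _ mG _ mbx _ maG); last 2 first.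
  - by move=> z _; rewrite lee_fin.
  - by move=> z _; exact: a0.
  rewrite -(ge0_integralD _ mG _ (measurable_cst _) _ _); last 3 first.
  - by move=> z _; exact: a0.
  - by move=> z _; rewrite adde_ge0// lee_fin.
  - exact: emeasurable_funD.
  apply: ge0_le_integral; first exact: mG.
  - by move=> z _; rewrite lee_fin.
  - apply/measurable_EFinP; apply: measurable_funTS.
    exact: (measurable_fun_pair2 x (measurable_diff mV)).
  - by apply: emeasurable_funD; [exact: measurable_cst|exact: emeasurable_funD].
  move=> z _; rewrite /a -!EFinD lee_fin (distrC (V z)).
  have -> : V x - V z = (V x - V (x + h *: e)) +
     ((V (x + h *: e) - V (z + h *: e)) + (V (z + h *: e) - V z)) by ring.
  by rewrite (le_trans (ler_normD _ _))// lerD2l ler_normD.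
have IbB : (\int[L]_(x in G) b x <= oscillation V B B)%E.
  have shiftle (F : 'rV[R]_n -> \bar R) : measurable_fun B F ->
      (forall x, 0 <= F x)%E ->
      (\int[L]_(x in G) F (x + h *: e)%R <= \int[L]_(x in B) F x)%E.
    move=> mF F0; rewrite [leRHS]integral_mkcond.
    have mFB : measurable_fun setT (F \_ B) by apply/(measurable_restrictT _ _).1.
    have FB0 x : (0 <= (F \_ B) x)%E by rewrite patchE; case: ifP => _; [exact: F0|exact: lexx].
    rewrite -(ge0_lebesgue_rV_integral_shift (h *: e) mFB FB0).
    rewrite [leLHS]integral_mkcond.
    apply: ge0_le_integral; first exact: measurableT.
    - by move=> x _; rewrite patchE; case: ifP => _; [exact: F0|exact: lexx].
    - have -> : (fun x => F (x + h *: e)%R) \_ G = (fun x => (F \_ B) (x + h *: e)%R) \_ G.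
        apply/funext => x; rewrite !patchE; case: ifPn => //; rewrite inE => Gx.
        by rewrite mem_set//; exact: Gh.
      apply/(measurable_restrictT _ _).1; first exact: mG.
      apply: measurable_funTS.
      exact: (measurableT_comp mFB (@measurable_shift _ _ (h *: e))).
    - exact: (measurableT_comp mFB (@measurable_shift _ _ (h *: e))).
    move=> x _; rewrite [leLHS]patchE; case: ifPn => [|_]; last exact: FB0.
    by rewrite inE => Gx; rewrite patchE mem_set//; exact: Gh.
  rewrite oscillationE.
  apply: (@le_trans _ _ (\int[L]_(x in G) inner_osc V B (x + h *: e)%R)%E); last first.
    apply: shiftle; first exact: measurable_inner_osc.
    by move=> x; exact: inner_osc_ge0.
  apply: ge0_le_integral; first exact: mG.
  - by move=> x _; exact: b0.
  - exact: mb.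
  - apply: measurable_funTS.
    have mi : measurable_fun setT (inner_osc V B) by exact: measurable_inner_osc.
    exact: (measurableT_comp mi (@measurable_shift _ _ (h *: e))).
  move=> x Gx.
  apply: (shiftle (fun z => (`|V (x + h *: e)%R - V z|)%:E)).
    apply/measurable_EFinP; apply: measurable_funTS.
    exact: (measurable_fun_pair2 (x + h *: e) (measurable_diff mV)).
  by move=> z; rewrite lee_fin.
rewrite oscillationE.
apply: (@le_trans _ _ (\int[L]_(x in G) (L G * a x + (b x + \int[L]_(z in G) a z)))%E).
  apply: ge0_le_integral; first exact: mG.
  - by move=> x _; exact: inner_osc_ge0.
  - exact: measurable_inner_osc.
  - apply: emeasurable_funD; first exact: measurable_funeM.
    by apply: emeasurable_funD; [exact: mb|exact: measurable_cst].
  exact: inner.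
rewrite (ge0_integralD _ mG _ (measurable_funeM _ maG) _ _); last 3 first.
- by move=> x _; rewrite mule_ge0.
- by move=> x _; rewrite adde_ge0.
- by apply: emeasurable_funD; [exact: mb|exact: measurable_cst].
rewrite (ge0_integralD _ mG _ mb _ (measurable_cst _)); last 2 first.
- by move=> x _; exact: b0.
- by move=> x _; exact: IaG0.
rewrite ge0_integralZl; last 4 first.
- exact: mG.
- exact: maG.
- by move=> x _; exact: a0.
- exact: LG0.
rewrite integral_cst//.
have hI : (L G * \int[L]_(z in G) a z <= ((3 * rho) ^+ n * C3 * r^-1 ^+ n.+1)%:E * N)%E.
  apply: (@le_trans _ _ (((3 * rho) ^+ n)%:E * ((C3 * r^-1 ^+ n.+1)%:E * N))%E).
    by apply: lee_pmul.
  by rewrite muleA -EFinM mulrA.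
rewrite [(_ * L G)%E]muleC.
apply: (@le_trans _ _ ((((3 * rho) ^+ n * C3 * r^-1 ^+ n.+1)%:E * N) +
   (((C1 * r^-1 ^+ n.+1)%:E * N) + ((3 * rho) ^+ n * C3 * r^-1 ^+ n.+1)%:E * N))%E).
  by apply: leeD; [exact: hI|apply: leeD; [exact: le_trans IbB hB|exact: hI]].
have p0 : 0 <= r^-1 ^+ n.+1 by rewrite exprn_ge0// invr_ge0 ltW.
have q0 : 0 <= (3 * rho) ^+ n * C3 by rewrite mulr_ge0 ?exprn_ge0 ?mulr_ge0 // ltW.
have q1 : 0 <= (3 * rho) ^+ n * C3 * r^-1 ^+ n.+1 by rewrite mulr_ge0.
have q2 : 0 <= C1 * r^-1 ^+ n.+1 by rewrite mulr_ge0// ltW.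
rewrite -ge0_muleDl; [|by rewrite lee_fin..].
rewrite -ge0_muleDl; [|by rewrite lee_fin ?addr_ge0..].
rewrite -!EFinD; apply: lee_wpmul2r; first exact: N0.
by rewrite lee_fin -!mulrDl ler_wpM2r//; lra.
Qed.

End LocalPoincare.

(** * Mean value and directional derivatives *)

Section Calculus.
Context {R : realType} {n : nat}.
Implicit Types (f : 'rV[R]_n -> R) (x y z u v w : 'rV[R]_n).
Local Notation "''e_' i" := (delta_mx 0 i : 'rV[R]_n) (at level 8, format "''e_' i").

Lemma is_derive_line f z w (s : R) : derivable f (z + s *: w) w ->
  is_derive s 1 (fun t : R => f (z + t *: w)) ('D_w f (z + s *: w)).
Proof.
move=> dw.
have E : (fun h : R => h^-1 *: (((fun t : R => f (z + t *: w)) \o shift s) (h *: 1)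
       - f (z + s *: w)))
    = (fun h : R => h^-1 *: ((f \o shift (z + s *: w)) (h *: w) - f (z + s *: w))).
  apply/funext => h; rewrite /=; congr (_ *: (f _ - _)).
  by apply/rowP => i; rewrite !mxE /GRing.scale/=; ring.
by split; rewrite /derivable /derive E.
Qed.

Lemma line_mvt f z w (h : R) :
  (forall s, `|s| <= `|h| -> derivable f (z + s *: w) w) ->
  exists2 s, `|s| <= `|h| & f (z + h *: w) - f z = h * 'D_w f (z + s *: w).
Proof.
move=> df; pose F (t : R) := f (z + t *: w).
have dF s : `|s| <= `|h| -> is_derive s (1 : R) F ('D_w f (z + s *: w)).
  by move=> sh; apply: is_derive_line; exact: df.
have cF a b : (forall s, a <= s <= b -> `|s| <= `|h|) ->
    {within `[a, b], continuous F}.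
  move=> ab; apply: derivable_within_continuous => s; rewrite in_itv/= => /ab sh.
  by have [] := dF s sh.
have [h0|h0] := leP 0 h.
  have [||c] := @MVT_segment R F (fun s => 'D_w f (z + s *: w)) 0 h h0.
  - move=> s; rewrite in_itv/= => /andP[s0 sh]; apply: dF.
    by rewrite !ger0_norm// ltW.
  - by apply: cF => s /andP[s0 sh]; rewrite !ger0_norm.
  rewrite in_itv/= => /andP[c0 ch]; rewrite /F scale0r addr0 subr0 => ->.
  by exists c; [rewrite !ger0_norm|rewrite mulrC].
have [||c] := @MVT_segment R F (fun s => 'D_w f (z + s *: w)) h 0 (ltW h0).
- move=> s; rewrite in_itv/= => /andP[s0 sh]; apply: dF.
  by rewrite !ltr0_norm ?lerN2// ltW.
- by apply: cF => s /andP[s0 sh]; rewrite !ler0_norm ?lerN2// ltW.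
rewrite in_itv/= => /andP[c0 ch]; rewrite /F scale0r addr0 sub0r mulrN mulrC => E.
exists c; first by rewrite !ler0_norm ?lerN2// ltW.
by rewrite -[LHS]opprB E opprK.
Qed.

(** The coordinates are changed one at a time. The path stays in the sup-norm ball around x, so
    partial derivatives there suffice; each coordinate has its own intermediate point. *)
Lemma box_mvt f x y :
  (forall u i, `|u - x| <= `|y - x| -> derivable f u 'e_i) ->
  exists2 xi : 'I_n -> 'rV[R]_n, (forall i, `|xi i - x| <= `|y - x|) &
    f y - f x = \sum_i (y 0 i - x 0 i) * 'D_('e_i) f (xi i).
Proof.
move=> df.
pose z (k : nat) := \row_i (if (i < k)%N then y 0 i else x 0 i) : 'rV[R]_n.
have zS (i : 'I_n) : z i.+1 = z i + (y 0 i - x 0 i) *: 'e_i.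
  apply/rowP => j; rewrite !mxE /= ?eqxx /=.
  have [->|ji] := eqVneq j i; first by rewrite ltnS leqnn ltnn mulr1; ring.
  rewrite mulr0 addr0 ltnS leq_eqVlt.
  by rewrite (_ : (j : nat) == i = false)//; exact/negbTE.
have xi_ex (i : 'I_n) : exists u, `|u - x| <= `|y - x| /\
    f (z i.+1) - f (z i) = (y 0 i - x 0 i) * 'D_('e_i) f u.
  have inbox s : `|s| <= `|y 0 i - x 0 i| -> `|(z i + s *: 'e_i) - x| <= `|y - x|.
    move=> sh; apply/rV_norm_leP => // j; rewrite !mxE /=.
    have := rV_coord_le_norm (y - x) => yx.
    have [->|ji] /= := eqVneq j i.
      rewrite ltnn mulr1 addrAC subrr add0r; apply: (le_trans sh).
      by have := yx i; rewrite !mxE.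
    rewrite mulr0 addr0; case: ifP => _; last by rewrite subrr normr0.
    by have := yx j; rewrite !mxE.
  have [|s sh E] := @line_mvt f (z i) 'e_i (y 0 i - x 0 i).
    by move=> s sh; apply: df; exact: inbox.
  by exists (z i + s *: 'e_i); split; [exact: inbox|rewrite zS].
have [xi xiP] := choice xi_ex.
exists xi; first by move=> i; have [] := xiP i.
under eq_bigr => i _ do rewrite -(proj2 (xiP i)).
rewrite -(big_mkord xpredT (fun i => f (z i.+1) - f (z i))) telescope_sumr//.
congr (f _ - f _); apply/rowP => j; rewrite !mxE ?ltn_ord//.
Qed.

(** Partial derivatives near x that are continuous at x give every directional derivative: the
    points supplied by [box_mvt] tend to x. *)
Lemma is_derive_partials f x v (rho : R) : 0 < rho ->
  (forall u i, `|u - x| < rho -> derivable f u 'e_i) ->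
  (forall i, {for x, continuous (fun u => 'D_('e_i) f u)}) ->
  is_derive x v f (\sum_i v 0 i * 'D_('e_i) f x).
Proof.
move=> rho0 df cf; set l := \sum_i _.
suff H : (fun h : R => h^-1 *: ((f \o shift x) (h *: v) - f x)) @ 0^' --> l.
  by split; [apply/cvg_ex; exists l|exact: cvg_lim H].
apply/cvgrPdist_le => e e0.
pose M := \sum_i `|v 0 i| + 1.
have M0 : 0 < M by rewrite ltr_wpDl// sumr_ge0.
have : \forall u \near x, forall i, `|'D_('e_i) f x - 'D_('e_i) f u| <= e / M.
  apply: (@filter_forall _ _ _ (nbhs x) (nbhs_filter x)) => i; have /cvgrPdist_le/(_ (e / M)) := cf i.
  by apply; rewrite divr_gt0.
move=> /nbhs_ballP[d /= d0 dP].
have m0 : 0 < Num.min d rho by rewrite lt_min d0.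
near=> h.
have h0 : h != 0 by near: h; exact: nbhs_dnbhs_neq.
have hv : `|h *: v| < Num.min d rho.
  near: h.
  have : (fun h : R => h *: v) @ 0^' --> (0 : R) *: v.
    apply: cvg_within_filter; apply: cvgZr_tmp; exact: cvg_id.
  rewrite scale0r => /cvgr0Pnorm_lt; apply; exact: m0.
move: hv; rewrite lt_min => /andP[hd hrho].
have [|xi xiP E] := @box_mvt f x (h *: v + x).
  move=> u i; rewrite addrK => uh; apply: df; exact: le_lt_trans hrho.
rewrite /= E.
have -> : h^-1 *: (\sum_i ((h *: v + x) 0 i - x 0 i) * 'D_('e_i) f (xi i))
    = \sum_i v 0 i * 'D_('e_i) f (xi i).
  rewrite /GRing.scale/= mulr_sumr; apply: eq_bigr => i _.
  by rewrite !mxE addrK !mulrA mulVf// mul1r.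
rewrite /l -sumrB (le_trans (ler_norm_sum _ _ _))//.
apply: (@le_trans _ _ (\sum_i `|v 0 i| * (e / M))).
  apply: ler_sum => i _; rewrite -mulrBr normrM ler_wpM2l//.
  apply: dP; rewrite -ball_normE /= distrC.
  by have := xiP i; rewrite addrK => /le_lt_trans; apply.
rewrite -mulr_suml mulrA ler_pdivrMr// mulrC ler_pM2l//.
by rewrite lerDl.
Unshelve. all: by end_near.
Qed.

End Calculus.

(** * Cones at boundary points *)

Section Cone.
Context {R : realType} {d : nat}.
Variables (alpha : R) (Om : set 'rV[R]_d.+1).
Hypotheses (oOm : open Om) (bOm : Ck_holder_boundary 2 alpha Om).
Local Notation "''e_' i" := (delta_mx 0 i : 'rV[R]_d.+1) (at level 8, format "''e_' i").

Lemma open_boundaryE : boundary Om = closure Om `\` Om.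
Proof. by rewrite /boundary; move/interior_id: oOm => ->. Qed.

(** The part of [S] in [Om] is relatively open, and relatively closed because a limit point outside
    [Om] would be a boundary point. *)
Lemma connected_avoid_boundary (S : set 'rV[R]_d.+1) : connected S ->
  S `&` Om !=set0 -> (forall x, S x -> ~ boundary Om x) -> S `<=` Om.
Proof.
move=> cS S0 Sb.
have : S `&` Om = S.
  apply: cS => //; first by exists Om.
  exists (closure Om); first exact: closed_closure.
  apply/seteqP; split=> x [Sx h]; split=> //; first exact: subset_closure.
  by apply: contrapT => nOm; apply: (Sb x Sx); rewrite open_boundaryE.
by move=> <- x [].
Qed.

(** The inverse chart moves by at most K|h| when its argument moves by h along the last axis, while
    the last component of [p] then changes by exactly h. With zero gradient at x0 it would change by
    at most |h|/2. *)
Lemma chart_gradient (x0 : 'rV[R]_d.+1) (B D : set 'rV[R]_d.+1)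
    (p q : 'rV[R]_d.+1 -> 'rV[R]_d.+1) :
  open B -> B x0 -> open D -> set_bij B D p -> (forall x, B x -> q (p x) = x) ->
  (forall i, Ck_holder 2 alpha B (fun x => p x 0 i)) ->
  (forall i, Ck_holder 2 alpha D (fun y => q y 0 i)) ->
  exists i, 'D_('e_i) (fun x => p x 0 ord_max) x0 != 0.
Proof.
move=> oB Bx0 oD [pBD pinj psurj] qp Cp Cq.
pose b x := p x 0 ord_max.
apply/not_existsP => grad0.
have {}grad0 i : 'D_('e_i) b x0 = 0 by apply/eqP/negPn/negP; exact: grad0.
have pq y : D y -> p (q y) = y.
  by move=> /psurj [x Bx <-]; rewrite qp.
pose y0 := p x0.
have Dy0 : D y0 by exact: pBD.
have qy0 : q y0 = x0 by exact: qp.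
have dq i : derivable (fun y => q y 0 i) y0 'e_ord_max.
  by have [[dq _] _] := Cq i; exact: (dq [::]).
pose l i := 'D_('e_ord_max) (fun y => q y 0 i) y0.
pose K := \sum_i (`|l i| + 1).
have K0 : 0 < K.
  by rewrite /K big_ord_recl ltr_pwDl// ?ltr_wpDl// sumr_ge0// => i _; rewrite addr_ge0.
have Kle i : `|l i| + 1 <= K.
  by rewrite /K (bigD1 i)//= lerDl sumr_ge0// => j _; rewrite addr_ge0.
have cb i : {for x0, continuous (fun u => 'D_('e_i) b u)}.
  by have [[_ cp] _] := Cp ord_max; exact: (cp [:: i]).
have db u i : B u -> derivable b u 'e_i.
  by move=> Bu; have [[dp _] _] := Cp ord_max; exact: (dp [::]).
(* With this bound on the partials, d+1 coordinates each moving by at most K|h| contribute |h|/2 in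
   total. *)
have eta0 : 0 < (2 * (d.+1%:R * K))^-1 by rewrite invr_gt0 !mulr_gt0 ?ltr0n.
have : \forall u \near x0, B u /\ forall i, `|'D_('e_i) b u| <= (2 * (d.+1%:R * K))^-1.
  apply: filterI; first by move: oB; rewrite openE => /(_ _ Bx0).
  apply: (@filter_forall _ _ _ (nbhs x0) (nbhs_filter x0)) => i.
  have /cvgrPdist_le/(_ _ eta0) := cb i; rewrite grad0; apply: filterS => u.
  by rewrite sub0r normrN.
move=> /nbhs_ballP[rho /= rho0 rhoP].
have : \forall h \near (0 : R)^', h != 0 /\ (D (h *: 'e_ord_max + y0) /\ (`|h| < rho / K /\
    forall i, `|q (h *: 'e_ord_max + y0) 0 i - q y0 0 i| <= K * `|h|)).
  have nz : \forall h \near (0 : R)^', h != 0 by exact: nbhs_dnbhs_neq.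
  apply: filterI; first exact: nz.
  apply: filterI.
    have : (fun h : R => h *: 'e_ord_max + y0) @ 0^' --> (0 : R) *: 'e_ord_max + y0.
      apply: cvg_within_filter; apply: cvgD; last exact: cvg_cst.
      by apply: cvgZr_tmp; exact: cvg_id.
    rewrite scale0r add0r; apply.
    by move: oD; rewrite openE => /(_ _ Dy0).
  have ltK : \forall h \near (0 : R)^', `|h| < rho / K.
    by apply: dnbhs0_lt; rewrite divr_gt0.
  apply: filterI; first exact: ltK.
  suff HF i : \forall h \near (0 : R)^', `|q (h *: 'e_ord_max + y0) 0 i - q y0 0 i| <= K * `|h|.
    by apply: (@filter_forall _ _ _ (dnbhs (0 : R)) _) => i; exact: HF.
  have /cvgrPdist_le/(_ _ ltr01) : (fun h : R => h^-1 *: (((fun y => q y 0 i) \o shift y0)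
      (h *: 'e_ord_max) - q y0 0 i)) @ 0^' --> l i by exact: dq.
  move=> H; near=> h.
  have h0 : h != 0 by near: h; exact: nbhs_dnbhs_neq.
  have : `|l i - h^-1 *: (q (h *: 'e_ord_max + y0) 0 i - q y0 0 i)| <= 1.
    by near: h; exact: H.
  set Q := (_ - q y0 0 i) => hQ.
  have : `|h^-1 *: Q| <= K.
    apply: (le_trans _ (Kle i)); rewrite -lerBlDl.
    by rewrite (le_trans _ hQ)// distrC lerB_dist.
  by rewrite /GRing.scale/= normrM normfV mulrC ler_pdivrMr// normr_gt0.
move=> /filter_ex [h [h0 [Dh [hrho hK]]]].
set y := h *: _ + _ in Dh hK.
have xr : `|q y - x0| <= K * `|h|.
  apply/rV_norm_leP; first by rewrite mulr_ge0// ltW.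
  by move=> i; rewrite -qy0 !mxE; exact: hK.
have xrho : `|q y - x0| < rho.
  by apply: (le_lt_trans xr); rewrite mulrC -ltr_pdivlMr.
have inb u : `|u - x0| <= `|q y - x0| -> ball x0 rho u.
  by rewrite ball_rVE /= distrC => /le_lt_trans; apply.
have [|xi xiP E] := @box_mvt _ _ b x0 (q y).
  by move=> u i /inb /rhoP[Bu _]; exact: db.
have bh : b (q y) - b x0 = h.
  by rewrite /b pq// -/y0 /y !mxE !eqxx mulr1 addrK.
have : `|h| <= `|h| / 2.
  rewrite -{1}bh E (le_trans (ler_norm_sum _ _ _))//.
  apply: (@le_trans _ _ (\sum_(i < d.+1) (K * `|h|) * (2 * (d.+1%:R * K))^-1)).
    apply: ler_sum => i _; rewrite normrM ler_pM//.
      by have := rV_coord_le_norm (q y - x0) i; rewrite !mxE => /le_trans; apply.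
    by have [_] := rhoP _ (inb _ (xiP i)); exact.
  rewrite sumr_const card_ord -[_ *+ _]mulr_natl le_eqVlt; apply/orP; left; apply/eqP.
  by field; rewrite ?gt_eqF// pnatr_eq0.
rewrite ler_pdivlMr// mulr_natr mulr2n gerDl leNgt normr_gt0.
by rewrite h0.
Unshelve. all: by end_near.
Qed.

(** The direction is the axis along which the straightening function [b] has nonzero derivative,
    with the sign making [b] increase. Since [b] is positive on [Om] and zero on the boundary near
    x0, a segment along which [b] stays positive cannot meet the boundary, hence stays in [Om]. *)
Lemma boundary_cone (x0 : 'rV[R]_d.+1) : boundary Om x0 ->
  exists (e : 'rV[R]_d.+1) (h c delta : R),
  [/\ `|e| <= 1, 0 < h, 0 < c <= 1, 0 < delta &
  (forall x (t : R) v, Om x -> `|x0 - x| < delta -> 0 < t <= h ->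
     `|v| <= c * t -> Om (x + t *: e + v))].
Proof.
move=> bx0; have [B [D [p [q [[oB Bx0 oD pbij qp] Cp Cq pOm pb]]]]] := bOm bx0.
have [i gi] := chart_gradient oB Bx0 oD pbij qp Cp Cq.
pose b x := p x 0 ord_max; rewrite -/b in gi.
pose a := `|'D_('e_i) b x0|.
have a0 : 0 < a by rewrite normr_gt0.
pose s := Num.sg ('D_('e_i) b x0).
pose M := \sum_j `|'D_('e_j) b x0| + a.
have MP j : `|'D_('e_j) b x0| + a <= M.
  by rewrite lerD2r (bigD1 j)//= lerDl sumr_ge0.
have M0 : 0 < M by rewrite (lt_le_trans _ (MP i))// ltr_wpDl.
have cb j : {for x0, continuous (fun u => 'D_('e_j) b u)}.
  by have [[_ cp] _] := Cp ord_max; exact: (cp [:: j]).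
have db u j : B u -> derivable b u 'e_j.
  by move=> Bu; have [[dp _] _] := Cp ord_max; exact: (dp [::]).
have a40 : 0 < a / 4 by rewrite divr_gt0.
have : \forall u \near x0, B u /\ forall j, `|'D_('e_j) b x0 - 'D_('e_j) b u| <= a / 4.
  apply: filterI; first by move: oB; rewrite openE => /(_ _ Bx0).
  apply: (@filter_forall _ _ _ (nbhs x0) (nbhs_filter x0)) => j.
  by have /cvgrPdist_le/(_ _ a40) := cb j.
move=> /nbhs_ballP[rho /= rho0 rhoP].
(* The transversal displacement v has d+1 coordinates and meets partials of size at most M; this c
   limits its effect on [b] to a t / 4, against a gain of 3 a t / 4 along the axis. *)
pose c := Num.min 1 (a / (4 * (d.+1%:R * M))).
have c0 : 0 < c by rewrite lt_min ltr01 divr_gt0// !mulr_gt0// ltr0n.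
have c1 : c <= 1 by rewrite ge_min lexx.
have cM : c * (d.+1%:R * M) <= a / 4.
  rewrite (@le_trans _ _ (a / (4 * (d.+1%:R * M)) * (d.+1%:R * M)))//.
    by rewrite ler_pM2r ?mulr_gt0 ?ltr0n// ge_min lexx orbT.
  have : 0 < d.+1%:R * M by rewrite mulr_gt0 ?ltr0n.
  move: (d.+1%:R * M) => N N0.
  by rewrite invfM mulrA divfK ?gt_eqF.
have sE : s * 'D_('e_i) b x0 = a by rewrite /s /a -normrEsg.
have s1 : `|s| = 1 by rewrite normr_sg -normr_gt0 -/a a0.
(* The point x is within rho/4 of x0 and the displacement is at most 2t <= rho/2, so everything
   happens inside the ball of radius rho. *)
exists (s *: 'e_i), (rho / 4), c, (rho / 4); split.
- apply/rV_norm_leP => // j; rewrite !mxE eqxx/= normrM s1 mul1r.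
  by case: eqP => _; rewrite ?normr1 ?normr0.
- by rewrite divr_gt0.
- by rewrite c0.
- by rewrite divr_gt0.
move=> x t v Omx xd /andP[t0 th] vc.
have near_ray (t' : R) v' : 0 < t' <= t -> `|v'| <= c * t' ->
    B (x + t' *: (s *: 'e_i) + v') /\ 0 < b (x + t' *: (s *: 'e_i) + v').
  move=> /andP[t'0 t't] v'c.
  pose w := t' *: (s *: 'e_i) + v'; rewrite -addrA -/w.
  have v't : `|v'| <= t' by rewrite (le_trans v'c)// ger_pMl.
  have wn : `|w| <= 2 * t'.
    rewrite (le_trans (ler_normD _ _))// mulr_natl mulr2n lerD//.
    apply/rV_norm_leP; first exact: ltW.
    move=> j; rewrite !mxE eqxx/= normrM gtr0_norm// normrM s1 mul1r.
    by case: eqP => _; rewrite ?normr1 ?normr0 ?mulr1 ?mulr0// ltW.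
  have inb u : `|u - x| <= `|w| -> ball x0 rho u.
    rewrite ball_rVE /= => uw; rewrite -(subrK x x0) -addrA.
    rewrite (le_lt_trans (ler_normD _ _))// distrC [`|x - u|]distrC.
    move: xd; rewrite distrC => xd; move: uw wn t't th xd.
    by move: `|u - x| `|w| `|x - x0| => u1 w1 x1; lra.
  have [|xi xiP E] := @box_mvt _ _ b x (x + w).
    by move=> u j; rewrite addrAC subrr add0r => /inb /rhoP[Bu _]; exact: db.
  rewrite addrAC subrr add0r in xiP.
  have Bxw : B (x + w).
    by have [] := rhoP (x + w); first by apply: inb; rewrite addrAC subrr add0r.
  have Bx : B x.
    by have [] := rhoP x; first by apply: inb; rewrite subrr normr0.
  split=> //.
  have bx : 0 < b x by exact: pOm.
  have Dxi j : `|'D_('e_j) b x0 - 'D_('e_j) b (xi j)| <= a / 4.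
    by have [_] := rhoP _ (inb _ (xiP j)); exact.
  have E' : b (x + w) - b x = t' * (s * 'D_('e_i) b (xi i))
      + \sum_j v' 0 j * 'D_('e_j) b (xi j).
    rewrite E (bigD1 i)//= [in RHS](bigD1 i)//= !mxE !eqxx/= !mulr1 [RHS]addrA.
    congr (_ + _); first by ring.
    apply: eq_bigr => j ji; rewrite !mxE eqxx/= (negbTE ji) !mulr0 add0r.
    by rewrite addrAC subrr add0r.
  have part1 : a * (3 / 4) <= s * 'D_('e_i) b (xi i).
    have -> : s * 'D_('e_i) b (xi i) = a - s * ('D_('e_i) b x0 - 'D_('e_i) b (xi i)).
      by rewrite mulrBr sE opprB addrC subrK.
    have : s * ('D_('e_i) b x0 - 'D_('e_i) b (xi i)) <= a / 4.
      by rewrite (le_trans (ler_norm _))// normrM s1 mul1r.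
    by move: (s * _) => z; lra.
  have part2 : - (\sum_j v' 0 j * 'D_('e_j) b (xi j)) <= t' * (a / 4).
    rewrite (le_trans (ler_norm _))// normrN (le_trans (ler_norm_sum _ _ _))//.
    apply: (@le_trans _ _ (\sum_(j < d.+1) (c * t') * M)).
      apply: ler_sum => j _; rewrite normrM ler_pM//.
        exact: le_trans (rV_coord_le_norm _ _) v'c.
      rewrite -(subKr ('D_('e_j) b x0) ('D_('e_j) b (xi j))).
      rewrite (le_trans (ler_normB _ _))// (le_trans _ (MP j))// lerD2l.
      by rewrite (le_trans (Dxi j))// ger_pMr// invf_le1 ?ler1n.
    rewrite sumr_const card_ord -[_ *+ _]mulr_natl.
    rewrite (_ : d.+1%:R * (c * t' * M) = t' * (c * (d.+1%:R * M))); last by ring.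
    by rewrite ler_pM2l.
  rewrite -(subrK (b x) (b (x + w))) E'.
  have : t' * (a * (3 / 4)) <= t' * (s * 'D_('e_i) b (xi i)) by rewrite ler_pM2l.
  have : 0 < t' * a by rewrite mulr_gt0.
  move: part2 bx; move: (\sum_j _) (s * _) (b x) => S1 S2 bx.
  have -> : t' * (a / 4) = t' * a / 4 by ring.
  have -> : t' * (a * (3 / 4)) = t' * a * (3 / 4) by ring.
  by move: (t' * a) (t' * S2) => z1 z2; lra.
(* Scaling t and v together keeps the ratio |v|/t, so [near_ray] applies at every point of the
   segment except its start, which is in [Om] by assumption. *)
pose w := t *: (s *: 'e_i) + v.
pose gam (tau : R) := x + tau *: w.
have cgam : continuous gam.
  move=> tau; apply: cvgD; first exact: cvg_cst.
  by apply: cvgZr_tmp; exact: cvg_id.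
have -> : x + t *: (s *: 'e_i) + v = gam 1 by rewrite /gam scale1r /w addrA.
have cS : connected (gam @` `[0, 1]).
  apply: connected_continuous_connected; first exact: segment_connected.
  exact: continuous_subspaceT.
have g0 : gam 0 = x by rewrite /gam scale0r addr0.
apply: (connected_avoid_boundary cS); last first.
- by exists 1 => //; rewrite /= in_itv /= ler01 lexx.
- move=> _ [tau + <-]; rewrite /= in_itv/= => /andP[tau0 tau1].
  have [tau00|tau00] := eqVneq tau 0.
    by rewrite tau00 g0 open_boundaryE => -[].
  have {tau00}taup : 0 < tau by rewrite lt_neqAle eq_sym tau00.
  have [||Bg bg] := near_ray (tau * t) (tau *: v).
  - by rewrite mulr_gt0//= ger_pMl.
  - by rewrite normrZ gtr0_norm// mulrCA ler_pM2l.
  have E : gam tau = x + (tau * t) *: (s *: 'e_i) + tau *: v.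
    by rewrite /gam /w scalerDr addrA scalerA.
  rewrite -E in Bg bg => bdg; move: bg; rewrite /b (pb _ Bg bdg).
  by rewrite ltxx.
- exists x; split=> //; exists 0; rewrite /= ?in_itv /= ?lexx ?ler01 ?g0//.
Qed.

End Cone.

(** * From local to global comparison by connectedness and compactness *)

Section GlobalPoincare.
Context {R : realType} {d : nat}.
Variables (alpha : R) (Om : set 'rV[R]_d.+1).
Hypotheses (oOm : open Om) (bndOm : bounded_set Om) (cOm : connected Om)
  (bOm : Ck_holder_boundary 2 alpha Om).
Local Notation L := (@lebesgue_rV R d.+1).
Implicit Types (x y z : 'rV[R]_d.+1) (A B G : set 'rV[R]_d.+1).

Lemma bounded_setP (A : set 'rV[R]_d.+1) : bounded_set A ->
  exists2 M : R, 0 < M & forall x, A x -> `|x| <= M.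
Proof.
move=> [M [Mreal HM]]; exists (Num.max M 0 + 1).
  by rewrite ltr_wpDl// le_max lexx orbT.
move=> x Ax; apply: (HM (Num.max M 0 + 1)) => //.
by rewrite ltr_pwDr// le_max lexx.
Qed.

Lemma closure_compact_rV A : bounded_set A -> compact (closure A).
Proof.
move=> /bounded_setP[M M0 AM]; apply: bounded_closed_compact; last exact: closed_closure.
exists (M + 1); split; first by rewrite num_real.
move=> N MN x clx; have [y [Ay]] := clx _ (nbhsx_ballx x 1 ltr01).
rewrite ball_rVE /= => xy; rewrite (le_trans _ (ltW MN))//.
by rewrite -(subrK y x) addrC (le_trans (ler_normD _ _))// lerD ?AM// ltW.
Qed.

Lemma lebesgue_rV_bounded A : measurable A -> bounded_set A -> (L A < +oo)%E.
Proof.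
move=> mA /bounded_setP[M M0 AM].
apply: (@le_lt_trans _ _ (((3 * M) ^+ d.+1)%:E)); last exact: ltry.
by apply: (lebesgue_rV_ball_le (x0 := 0)) => // x Ax; rewrite subr0; exact: AM.
Qed.

Lemma lebesgue_rV_open_gt0 A : open A -> A !=set0 -> (0 < L A)%E.
Proof.
move=> oA [x Ax]; move: (oA); rewrite openE => /(_ _ Ax) /nbhs_ballP[r /= r0 sub].
have r20 : 0 < r / 2 by rewrite divr_gt0.
apply: (@lt_le_trans _ _ (((r / 2) ^+ d.+1)%:E)); first by rewrite lte_fin exprn_gt0.
rewrite -(lebesgue_rV_cube x (ltW r20)); apply: le_measure; rewrite ?inE.
- exact: measurable_cube.
- exact: open_measurable_rV.
move=> y h; apply: sub; rewrite ball_rVE /=.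
apply: (@le_lt_trans _ _ (r / 2)); last by lra.
apply/rV_norm_leP; first exact: ltW.
by move=> i; have := h i; rewrite !mxE ler_norml => /andP[h1 h2]; apply/andP; split; lra.
Qed.

Let fin A : open A -> A `<=` Om -> (L A < +oo)%E.
Proof.
move=> oA AOm; apply: lebesgue_rV_bounded; first exact: open_measurable_rV.
have [M M0 HM] := bounded_setP bndOm.
exists M; split; first by rewrite num_real.
by move=> N MN x /AOm /HM /le_trans; apply; exact: ltW.
Qed.

Lemma closure_comparable x : closure Om x ->
  exists2 rho, 0 < rho & comparable_osc Om (Om `&` ball x rho) (Om `&` ball x rho).
Proof.
move=> clx; have [Omx|nOmx] := pselect (Om x).
  move: (oOm); rewrite openE => /(_ _ Omx) /nbhs_ballP[r /= r0 sub].
  have r30 : 0 < r / 3 by rewrite divr_gt0.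
  exists (r / 3) => //.
  have mB := measurable_ball_rV x r30.
  have mOB : measurable (Om `&` ball x (r / 3)).
    by apply: measurableI => //; exact: open_measurable_rV.
  apply: (comparable_oscS mOB mOB mB mB); [by move=> y []|by move=> y []|].
  by apply: interior_comparable => //; rewrite mulrC divfK.
have [e [h [c [delta [e1 h0 c1 d0 cone]]]]] : exists (e : 'rV[R]_d.+1) (h c delta : R),
  [/\ `|e| <= 1, 0 < h, 0 < c <= 1, 0 < delta &
  (forall x' (t : R) v, Om x' -> `|x - x'| < delta -> 0 < t <= h ->
     `|v| <= c * t -> Om (x' + t *: e + v))].
  by apply: (boundary_cone oOm bOm); rewrite open_boundaryE.
exact: (boundary_comparable oOm clx e1 h0 c1 d0 cone).
Qed.

(** Comparability is a relation between sets; asking for open neighbourhoods makes it a relation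
    between points that is stable under small moves. *)
Definition linked x y := exists A B, [/\ open A /\ A `<=` Om, open B /\ B `<=` Om,
  A x, B y & comparable_osc Om A B].

(** The overlap of [B] and [G] is open and nonempty, so it has positive volume and can serve as the
    intermediate set of [comparable_osc_trans]. *)
Let step A B G : open A -> A `<=` Om -> open B -> B `<=` Om -> open G -> G `<=` Om ->
  B `&` G !=set0 -> comparable_osc Om A B -> comparable_osc Om G G ->
  comparable_osc Om A G.
Proof.
move=> oA sA oB sB oG sG BG cAB cGG.
have mA := open_measurable_rV oA; have mB := open_measurable_rV oB.
have mG := open_measurable_rV oG.
have oBG : open (B `&` G) by exact: openI.
have mBG := open_measurable_rV oBG.
apply: (comparable_osc_trans mA mBG mG).
- exact: fin.
- exact: fin.
- by rewrite lebesgue_rV_open_gt0//= fin// => x [/sB].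
- by apply: (comparable_oscS mA mBG mA mB) => // x [].
- by apply: (comparable_oscS mG mBG mG mG) => // x [].
Qed.

(** The points linked to x form a nonempty, relatively open and relatively closed subset of the
    connected set [Om]. *)
Lemma linkedT x y : Om x -> Om y -> linked x y.
Proof.
move=> Omx Omy.
have nb z : Om z -> exists G, [/\ open G, G `<=` Om, G z & comparable_osc Om G G].
  move=> Omz; have [rho rho0 h] := closure_comparable (subset_closure Omz).
  exists (Om `&` ball z rho); split=> //.
  - by apply: openI => //; exact: ball_open.
  - exact: (conj Omz (ballxx z rho0)).
have link z w G : linked x z -> open G -> G `<=` Om -> G z -> G w ->
    comparable_osc Om G G -> linked x w.
  move=> [A [B [[oA sA] [oB sB] Ax Bz cAB]]] oG sG Gz Gw cGG.
  exists A, G; split; [by split|by split|exact: Ax|exact: Gw|].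
  by apply: (step oA sA oB sB oG sG _ cAB cGG); exists z.
suff : [set z | Om z /\ linked x z] = Om by move=> E; move: Omy; rewrite -{1}E => -[].
apply: cOm.
- exists x; split=> //; have [G [oG sG Gx cGG]] := nb x Omx.
  by exists G, G; split.
- exists [set z | Om z /\ linked x z]; last first.
    by apply/seteqP; split=> [z [? ?]|z [_]]; [split|].
  rewrite openE => z [Omz lz]; have [G [oG sG Gz cGG]] := nb z Omz.
  apply: (@filterS _ _ _ G); last by move: oG; rewrite openE; exact.
  by move=> w Gw; split; [exact: sG|exact: (link z w G)].
- exists (closure [set z | Om z /\ linked x z]); first exact: closed_closure.
  apply/seteqP; split=> [z [Omz lz]|z [Omz clz]].
    by split=> //; apply: subset_closure.
  split=> //; have [G [oG sG Gz cGG]] := nb z Omz.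
  have Gnb : nbhs z G by move: oG; rewrite openE; exact.
  have [w [[_ lw] Gw]] := clz _ Gnb.
  exact: (link w z G).
Qed.

(** Finitely many balls, some centred on the boundary, cover the compact closure. Any two of their
    traces on [Om] are comparable through a pair of linked points, and finite unions preserve
    comparability. *)
Theorem poincare : comparable_osc Om Om Om.
Proof.
have mOm := open_measurable_rV oOm.
have rho_ex x : exists rho : R, 0 < rho /\ (closure Om x ->
    comparable_osc Om (Om `&` ball x rho) (Om `&` ball x rho)).
  have [clx|nclx] := pselect (closure Om x); last by exists 1.
  by have [rho rho0 h] := closure_comparable clx; exists rho.
have [rho rhoP] := choice rho_ex.
pose F x := Om `&` ball x (rho x).
have rho0 x : 0 < rho x by have [] := rhoP x.
have oF x : open (F x) by apply: openI => //; exact: ball_open.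
have mF x : measurable (F x) by exact: open_measurable_rV.
have sF x : F x `<=` Om by move=> ? [].
have FF x : closure Om x -> comparable_osc Om (F x) (F x) by have [] := rhoP x.
have F0 x : closure Om x -> F x !=set0.
  by move=> /(_ _ (nbhsx_ballx x (rho x) (rho0 x))).
have FG x y : closure Om x -> closure Om y -> comparable_osc Om (F x) (F y).
  move=> clx cly; have [x' Fx'] := F0 x clx; have [y' Fy'] := F0 y cly.
  have [A [B [[oA sA] [oB sB] Ax By cAB]]] := linkedT (sF _ _ Fx') (sF _ _ Fy').
  have mA := open_measurable_rV oA; have mB := open_measurable_rV oB.
  have cAF : comparable_osc Om A (F y).
    by apply: (step oA sA oB sB (oF y) (@sF y) _ cAB (FF y cly)); exists y'.
  have cFA : comparable_osc Om (F y) A by exact: comparable_oscC.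
  have cFF : comparable_osc Om (F y) (F x).
    by apply: (step (oF y) (@sF y) oA sA (oF x) (@sF x) _ cFA (FF x clx)); exists x'.
  exact: comparable_oscC.
have := closure_compact_rV bndOm; rewrite compact_cover => /(_ _ (closure Om) (fun x => ball x (rho x))).
move=> [|x clx|D DOm Dcov].
- by move=> x _; exact: ball_open.
- by exists x => //; exact: ballxx.
pose s := finmap.enum_fset D.
have sOm x : x \in s -> closure Om x by move=> xs; have := DOm x xs; rewrite inE.
have E : Om = \big[setU/set0]_(x <- s) F x.
  apply/seteqP; split=> [x Omx|x].
    have [y /= yD yx] := Dcov _ (subset_closure Omx).
    by rewrite -bigcup_seq; exists y.
  by rewrite -bigcup_seq => -[y _ []].
have cOF y : closure Om y -> comparable_osc Om Om (F y).
  by move=> cly; rewrite {2}E; apply: comparable_osc_bigUl => // x /sOm clx; exact: FG.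
rewrite {2}E; apply: comparable_osc_bigUl => // x /sOm clx.
by apply: comparable_oscC => //; exact: cOF.
Qed.

End GlobalPoincare.

(** * Cell decompositions *)

Section Cells.
Context {R : realType}.

Lemma geometric_sum_le (th : R) k : 0 <= th < 1 ->
  \sum_(0 <= i < k) th ^+ i <= (1 - th)^-1.
Proof.
move=> /andP[th0 th1]; have h : 0 < 1 - th by rewrite subr_gt0.
rewrite -[leRHS]mul1r ler_pdivlMr// mulrC big_mkord.
have -> : (1 - th) * \sum_(i < k) th ^+ i = 1 - th ^+ k.
  by have := subrX1 th k; rewrite -[th ^+ k - 1]opprB -[th - 1]opprB mulNr => /oppr_inj.
by rewrite gerBl exprn_ge0.
Qed.

Lemma two_sided_geometric_sum_le (th : R) (N k : nat) : 0 <= th < 1 ->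
  \sum_(j < N) th ^+ `|k - j|%N <= 2 / (1 - th).
Proof.
move=> th01; have th0 : 0 <= th by case/andP: th01.
wlog kN : N / (k <= N)%N => [H|].
  apply: (le_trans _ (H (N + k)%N (leq_addl _ _))).
  rewrite -(big_mkord xpredT (fun j => th ^+ `|k - j|%N)).
  rewrite -(big_mkord xpredT (fun j => th ^+ `|k - j|%N)).
  rewrite [leRHS](@big_cat_nat _ _ _ N)//= ?leq_addr// lerDl.
  by apply: sumr_ge0 => j _; rewrite exprn_ge0.
rewrite mulr_natl mulr2n -(big_mkord xpredT (fun j => th ^+ `|k - j|%N)).
rewrite (@big_cat_nat _ _ _ k)//=; apply: lerD.
  rewrite big_nat_rev/= add0n (le_trans _ (geometric_sum_le k.+1 th01))//.
  rewrite big_nat_recl//= expr0 ler_wpDl//; rewrite !big_nat; apply: ler_sum => j /= jk.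
  by rewrite distnEl ?leq_subr// subKn.
rewrite (le_trans _ (geometric_sum_le (N - k) th01))//.
rewrite -{1}[k]add0n big_addn; apply: ler_sum => j _.
by rewrite distnEr ?leq_addl// addnK.
Qed.

Lemma natr_distn (k l : nat) : `|k - l|%N%:R = `|k%:R - l%:R| :> R.
Proof.
have [kl|/ltnW lk] := leqP k l.
  by rewrite distnEr// natrB// distrC ger0_norm// subr_ge0 ler_nat.
by rewrite distnEl// natrB// ger0_norm// subr_ge0 ler_nat.
Qed.

(* [g] dominates the exponential kernel from cell to cell, and is summable
   uniformly in the mesh size [r]. *)
Definition mesh_bounds (d : nat) (M G CN : R) := forall r : R, 0 < r <= 1 ->
  exists (K : finType) (a : K -> 'rV[R]_d.+1) (g : K -> K -> R),
  let A k := [set x : 'rV[R]_d.+1 | forall i, a k 0 i <= x 0 i < a k 0 i + r] in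
  [/\ (forall x, `|x| <= M -> exists k, A k x),
      (forall k l x, A k x -> A l x -> k = l),
      (forall k l x z, A k x -> A l z -> expR (- (`|x - z| / r)) <= g k l),
      (forall k l, 0 <= g k l /\ g k l = g l k) &
      (forall k, \sum_l g k l <= G) /\ #|K|%:R * r ^+ d.+1 <= CN].

(** If x and z lie in cells k and l, then |x - z|/r is at least the largest |k i - l i| minus 1,
    hence at least their mean minus 1. This explains the factor e and the ratio [th] = exp(-1/n):
    the bound is a product over coordinates, and its sum factors into geometric series. Cells number
    (N+1)^n, and (N+1) r <= 2M + 1 because r <= 1. *)
Lemma exists_mesh (d : nat) (M : R) : 0 < M ->
  exists G CN : R, [/\ 0 < G, 0 < CN & mesh_bounds d M G CN].
Proof.
move=> M0; pose n1 : R := d.+1%:R; have n10 : 0 < n1 by rewrite ltr0n.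
pose th := expR (- n1^-1).
have th01 : 0 <= th < 1 by rewrite expR_ge0/= expR_lt1 oppr_lt0 invr_gt0.
have h0 : 0 < 2 / (1 - th) by rewrite divr_gt0// subr_gt0; case/andP: th01.
exists (expR 1 * (2 / (1 - th)) ^+ d.+1), ((2 * M + 1) ^+ d.+1); split.
- by rewrite mulr_gt0 ?expR_gt0// exprn_gt0.
- by rewrite exprn_gt0// addr_gt0// mulr_gt0.
move=> r /andP[r0 r1]; pose N := Num.truncn (2 * M / r).
exists {ffun 'I_d.+1 -> 'I_N.+1}.
exists (fun k : {ffun 'I_d.+1 -> 'I_N.+1} => \row_i (- M + (k i)%:R * r)).
exists (fun k l : {ffun 'I_d.+1 -> 'I_N.+1} => expR 1 * \prod_i th ^+ `|k i - l i|%N).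
move=> A; have AP k x i : A k x -> (k i)%:R <= (x 0 i + M) / r < (k i)%:R + 1.
  move=> /(_ i); rewrite !mxE => /andP[h1 h2].
  by rewrite ler_pdivlMr// ltr_pdivrMr// mulrDl mul1r; apply/andP; split; lra.
split.
- move=> x xM.
  have xi i : 0 <= (x 0 i + M) / r <= 2 * M / r.
    have := le_trans (rV_coord_le_norm x i) xM; rewrite ler_norml => /andP[h1 h2].
    by rewrite divr_ge0 ?(ltW r0) ?ler_pM2r ?invr_gt0//; lra.
  have ji i : (Num.truncn ((x 0%R i + M) / r) < N.+1)%N.
    have /andP[x0 xN] := xi i.
    by rewrite -(ltr_nat R) (le_lt_trans _ (truncnS_gt (2 * M / r)))// (le_trans _ xN)// truncn_le.
  exists [ffun i => Ordinal (ji i)] => i; rewrite !mxE ffunE /=.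
  have /andP[x0 _] := xi i; have := truncn_itv x0.
  set T := Num.truncn _; rewrite -natr1 => /andP[].
  rewrite ler_pdivlMr// ltr_pdivrMr// mulrDl mul1r => h1 h2.
  by apply/andP; split; lra.
- move=> k l x kx lx; apply/ffunP => i; apply/val_inj/eqP => /=.
  have /andP[h1 h2] := AP _ _ i kx; have /andP[h3 h4] := AP _ _ i lx.
  rewrite eqn_leq; apply/andP; split; rewrite -ltnS -(ltr_nat R) -natr1.
    exact: le_lt_trans h1 h4.
  exact: le_lt_trans h3 h2.
- move=> k l x z kx lz.
  under eq_bigr do rewrite /th -expRM_natl.
  rewrite -expR_sum -expRD ler_expR.
  have H : \sum_(i < d.+1) `|k i - l i|%N%:R <= \sum_(i < d.+1) (`|x - z| / r + 1).
    apply: ler_sum => i _; rewrite natr_distn.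
    have /andP[h1 h2] := AP _ _ i kx; have /andP[h3 h4] := AP _ _ i lz.
    have : `|(x 0 i + M) / r - (z 0 i + M) / r| <= `|x - z| / r.
      rewrite -mulrBl normrM (gtr0_norm (x := r^-1)) ?invr_gt0//.
      rewrite ler_pM2r ?invr_gt0//; have := rV_coord_le_norm (x - z) i; rewrite !mxE.
      by rewrite opprD addrACA subrr addr0.
    move: h1 h2 h3 h4; move: ((x 0 i + M) / r) ((z 0 i + M) / r) (`|x - z| / r) => a b c.
    by rewrite !ler_norml => h1 h2 h3 h4 /andP[h5 h6]; apply/andP; split; lra.
  rewrite sumr_const card_ord -[X in _ <= X]mulr_natl -/n1 in H.
  have -> : \sum_(i < d.+1) `|k i - l i|%N%:R * - n1^-1 = - ((\sum_(i < d.+1) `|k i - l i|%N%:R) / n1).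
    by rewrite -mulr_suml mulrN.
  have : (\sum_(i < d.+1) `|k i - l i|%N%:R) / n1 <= `|x - z| / r + 1.
    by rewrite ler_pdivrMr// mulrC.
  by move: (`|x - z| / r) (_ / n1) => u v; lra.
- move=> k l; split.
    by rewrite mulr_ge0 ?expR_ge0// prodr_ge0// => i _; rewrite exprn_ge0 ?expR_ge0.
  by congr (_ * _); apply: eq_bigr => i _; rewrite distnC.
split.
  move=> k; rewrite -mulr_sumr ler_pM2l ?expR_gt0//.
  rewrite -(bigA_distr_bigA (fun i (j : 'I_N.+1) => th ^+ `|k i - j|%N)).
  rewrite -[in leRHS](card_ord d.+1) -prodr_const; apply: ler_prod => i _.
  rewrite two_sided_geometric_sum_le// andbT sumr_ge0// => j _.
  by rewrite exprn_ge0 ?expR_ge0.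
rewrite card_ffun !card_ord natrX -exprMn lerXn2r ?nnegrE//.
- by rewrite mulr_ge0// ltW.
- by rewrite addr_ge0// mulr_ge0// ltW.
rewrite -natr1 mulrDl mul1r lerD//.
rewrite -ler_pdivlMr// truncn_le// divr_ge0// ?mulr_ge0// ltW//.
Qed.

End Cells.

Section Schur.
Context {R : realType} {K : finType} (g : K -> K -> R) (G : R) (Q : K -> R).
Hypotheses (g0 : forall k l, 0 <= g k l) (gC : forall k l, g k l = g l k)
  (gG : forall k, \sum_l g k l <= G).

(** Schur's test: Q k Q l is at most the mean of the squares, and row sums of the symmetric [g] are
    at most [G]. *)
Lemma schur_form : \sum_k \sum_l g k l * (Q k * Q l) <= G * \sum_k Q k ^+ 2.
Proof.
have S k l : g k l * (Q k * Q l) <= g k l * (Q k ^+ 2 / 2) + g l k * (Q l ^+ 2 / 2).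
  rewrite (gC l k) -mulrDr ler_wpM2l// -subr_ge0.
  have -> : Q k ^+ 2 / 2 + Q l ^+ 2 / 2 - Q k * Q l = (Q k - Q l) ^+ 2 / 2 by field.
  by rewrite divr_ge0// sqr_ge0.
apply: (@le_trans _ _ (\sum_k \sum_l (g k l * (Q k ^+ 2 / 2) + g l k * (Q l ^+ 2 / 2)))).
  by apply: ler_sum => k _; apply: ler_sum.
under eq_bigr do rewrite big_split/=.
rewrite big_split/= [X in _ + X]exchange_big/= -mulr2n -[leLHS]mulr_natl.
rewrite [leRHS]mulr_sumr [leLHS]mulr_sumr; apply: ler_sum => k _.
rewrite -mulr_suml (_ : 2 * _ = (\sum_l g k l) * Q k ^+ 2); last by field.
by rewrite ler_wpM2r// sqr_ge0.
Qed.

Lemma schur_square : \sum_k (\sum_l g k l * Q l) ^+ 2 <= G ^+ 2 * \sum_k Q k ^+ 2.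
Proof.
have G0 (k : K) : 0 <= G by rewrite (le_trans _ (gG k))// sumr_ge0.
have S k : (\sum_l g k l * Q l) ^+ 2 <= G * \sum_l g k l * Q l ^+ 2.
  pose a := \sum_l g k l; pose b := \sum_l g k l * Q l; pose c := \sum_l g k l * Q l ^+ 2.
  have a0 : 0 <= a by rewrite sumr_ge0.
  have c0 : 0 <= c by rewrite sumr_ge0// => l _; rewrite mulr_ge0// sqr_ge0.
  apply: (@le_trans _ _ (a * c)); last by rewrite ler_wpM2r// gG.
  (* Weighted Cauchy-Schwarz in discriminant form; the case a = 0, in which the whole row vanishes,
     is treated separately. *)
  have H (t : R) : 0 <= a * t ^+ 2 - 2 * b * t + c.
    have -> : a * t ^+ 2 - 2 * b * t + c = \sum_l g k l * (t - Q l) ^+ 2.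
      rewrite /a /b /c mulr_suml -mulrA mulr_suml mulr_sumr -sumrB -big_split/=.
      by apply: eq_bigr => l _; ring.
    by apply: sumr_ge0 => l _; rewrite mulr_ge0// sqr_ge0.
  have [a00|aN0] := eqVneq a 0.
    rewrite -/b; suff -> : b = 0 by rewrite expr0n/= mulr_ge0.
    apply: big1 => l _; suff -> : g k l = 0 by rewrite mul0r.
    apply/eqP; move/eqP: a00; rewrite /a psumr_eq0// => /allP/(_ l).
    by rewrite mem_index_enum => /(_ isT).
  have ap : 0 < a by rewrite lt_neqAle eq_sym aN0.
  have := H (b / a); have -> : a * (b / a) ^+ 2 - 2 * b * (b / a) + c = (a * c - b ^+ 2) / a.
    by field.
  by rewrite pmulr_lge0 ?invr_gt0// subr_ge0.
apply: (@le_trans _ _ (\sum_k G * \sum_l g k l * Q l ^+ 2)); first exact: ler_sum.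
rewrite -mulr_sumr [G ^+ 2]expr2 -[leRHS]mulrA.
have [k0 _|noK] := pickP (@predT K); last by rewrite !big_pred0 ?mulr0.
apply: ler_wpM2l; first exact: (G0 k0).
rewrite exchange_big/= mulr_sumr; apply: ler_sum => l _.
rewrite -mulr_suml ler_wpM2r ?sqr_ge0//.
by under eq_bigr do rewrite gC; exact: gG.
Qed.

End Schur.

(** * Consequences of a bound on the energy near the diagonal *)

Section Kernel.
Context {R : realType} {d : nat}.
Variables (mu : probability 'rV[R]_d.+1 R) (X : set 'rV[R]_d.+1) (M Lam : R).
Hypotheses (mX : measurable X) (M0 : 0 < M) (XM : forall x, X x -> `|x| <= M)
  (Lam0 : 0 <= Lam)
  (muL : forall (a : 'rV[R]_d.+1) (r : R), 0 < r ->
    (mu [set x : 'rV[R]_d.+1 | forall i, (a 0 i <= x 0 i < a 0 i + r)%R]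
     <= (Lam * r ^+ d.+1)%:E)%E).
Local Notation n := d.+1.
Implicit Types (F H : 'rV[R]_d.+1 * 'rV[R]_d.+1 -> R) (x z : 'rV[R]_d.+1).

Definition dint (F : 'rV[R]_n * 'rV[R]_n -> R) : \bar R :=
  (\int[mu \x mu]_(w in X `*` X) (F w)%:E)%E.

Lemma dint_prod (u v : 'rV[R]_n -> R) : measurable_fun setT u ->
  measurable_fun setT v -> (forall x, 0 <= u x) -> (forall x, 0 <= v x) ->
  dint (fun w => u w.1 * v w.2)
  = ((\int[mu]_(x in X) (u x)%:E) * (\int[mu]_(x in X) (v x)%:E))%E.
Proof.
move=> mu_ mv u0 v0; rewrite /dint.
have mF : measurable_fun setT (fun w : 'rV[R]_n * 'rV[R]_n => u w.1 * v w.2).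
  by apply: measurable_funM; exact: measurableT_comp.
rewrite (tonelli_in mu mu mX mX mF); last by move=> x z _ _; rewrite mulr_ge0.
have mE (h : 'rV[R]_n -> R) : measurable_fun setT h -> measurable_fun X (EFin \o h).
  by move=> mh; apply/measurable_EFinP; exact: measurable_funTS.
transitivity (\int[mu]_(x in X) ((\int[mu]_(z in X) (v z)%:E) * (u x)%:E))%E.
  apply: eq_integral => x _ /=; rewrite muleC -ge0_integralZl.
  - by apply: eq_integral => z _; rewrite EFinM.
  - exact: mX.
  - exact: mE.
  - by move=> z _; rewrite lee_fin.
  - by rewrite lee_fin.
rewrite ge0_integralZl; first by rewrite muleC.
- exact: mX.
- exact: mE.
- by move=> z _; rewrite lee_fin.
- by apply: integral_ge0 => z _; rewrite lee_fin.
Qed.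

Lemma dint_le F H : measurable_fun setT F -> measurable_fun setT H ->
  (forall x z, X x -> X z -> 0 <= F (x, z) <= H (x, z)) -> (dint F <= dint H)%E.
Proof.
move=> mF mH FH; apply: ge0_le_integral; first exact: measurableX.
- by move=> -[x z] [/= Xx Xz]; rewrite lee_fin; have /andP[] := FH x z Xx Xz.
- by apply/measurable_EFinP; exact: measurable_funTS.
- by apply/measurable_EFinP; exact: measurable_funTS.
- by move=> -[x z] [/= Xx Xz]; rewrite lee_fin; have /andP[] := FH x z Xx Xz.
Qed.

Lemma dintD F H : measurable_fun setT F -> measurable_fun setT H ->
  (forall x z, X x -> X z -> 0 <= F (x, z)) ->
  (forall x z, X x -> X z -> 0 <= H (x, z)) ->
  dint (fun w => F w + H w) = (dint F + dint H)%E.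
Proof.
move=> mF mH F0 H0; rewrite /dint -ge0_integralD.
- by [].
- exact: measurableX.
- by move=> -[x z] [/= Xx Xz]; rewrite lee_fin F0.
- by apply/measurable_EFinP; exact: measurable_funTS.
- by move=> -[x z] [/= Xx Xz]; rewrite lee_fin H0.
- by apply/measurable_EFinP; exact: measurable_funTS.
Qed.

Lemma dintZ F (c : R) : measurable_fun setT F -> 0 <= c ->
  (forall x z, X x -> X z -> 0 <= F (x, z)) ->
  dint (fun w => c * F w) = (c%:E * dint F)%E.
Proof.
move=> mF c0 F0; rewrite /dint -ge0_integralZl.
- by [].
- exact: measurableX.
- by apply/measurable_EFinP; exact: measurable_funTS.
- by move=> -[x z] [/= Xx Xz]; rewrite lee_fin F0.
- by rewrite lee_fin.
Qed.

Lemma dint_sum (I : finType) (F : I -> 'rV[R]_n * 'rV[R]_n -> R) :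
  (forall i, measurable_fun setT (F i)) -> (forall i w, 0 <= F i w) ->
  dint (fun w => \sum_i F i w) = (\sum_i dint (F i))%E.
Proof.
move=> mF F0; rewrite /dint; under eq_integral do rewrite -sumEFin.
rewrite ge0_integral_sum.
- by [].
- exact: measurableX.
- by move=> i; apply/measurable_EFinP; exact: measurable_funTS.
- by move=> i w _; rewrite lee_fin.
Qed.

Definition expker (r : R) (w : 'rV[R]_n * 'rV[R]_n) : R :=
  expR (- (`|w.1 - w.2| / r)).

Lemma measurable_expker r : measurable_fun setT (expker r).
Proof.
apply: (measurableT_comp (@measurable_expR R)).
apply: (measurableT_comp (@oppr_measurable R _)).
apply: measurable_funM; last exact: measurable_cst.
by apply: (measurableT_comp measurable_rV_norm); exact: measurable_rV_sub.
Qed.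

Definition nearby (r : R) (w : 'rV[R]_n * 'rV[R]_n) : R := (`|w.1 - w.2| <= r)%R%:R.

(** Information at distance at most r yields the mass of [om], its energy for the exponential
    kernel, and an L^2 bound on anything dominated by the potential of [om]. It is applied to om =
    1, for the mass of the Gaussian, and to the weight of the symmetrized kernel. *)
Definition kernel_bounded (G CN : R) : Prop :=
  forall (r a : R) (om : 'rV[R]_n -> R), 0 < r <= 1 -> 0 <= a ->
  measurable_fun setT om -> (forall x, 0 <= om x) ->
  (dint (fun w => nearby r w * (om w.1 * om w.2))%R <= (a * r ^+ n)%:E)%E ->
  [/\ (\int[mu]_(x in X) (om x)%:E <= (a + CN)%:E)%E,
     (dint (fun w => expker r w * (om w.1 * om w.2))%R <= (G * a * r ^+ n)%:E)%E &
     forall (c : R) (Y : set 'rV[R]_n) (h : 'rV[R]_n -> R), 0 <= c ->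
       measurable Y -> Y `<=` X -> measurable_fun setT h -> (forall x, 0 <= h x) ->
       (forall x, Y x -> ((h x)%:E
         <= c%:E * \int[mu]_(z in X) (expker r (x, z) * om z)%R%:E)%E) ->
       (\int[mu]_(x in Y) (h x ^+ 2)%:E
         <= (Lam * G ^+ 2 * a * c ^+ 2 * (r ^+ n) ^+ 2)%:E)%E].

(** All three bounds follow from the masses Q k of [om] on the cells. Points of one cell are within
    r of each other, so the hypothesis bounds the sum of Q k^2 by a r^n; the two forms of Schur's
    test do the rest. *)
Lemma kernel_bounds (G CN : R) : 0 < G -> mesh_bounds d M G CN -> kernel_bounded G CN.
Proof.
move=> G0 cells r a om /andP[r0 r1] a0 mom om0 hnear.
have [K [c0 [g [covA disA gker g0C [gG cardK]]]]] := cells r (introT andP (conj r0 r1)).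
pose A k := [set x : 'rV[R]_n | forall i, c0 k 0 i <= x 0 i < c0 k 0 i + r].
have {}covA : forall x, `|x| <= M -> exists k, A k x by exact: covA.
have {}disA : forall k l x, A k x -> A l x -> k = l by exact: disA.
have {}gker : forall k l x z, A k x -> A l z -> expR (- (`|x - z| / r)) <= g k l.
  by exact: gker.
have g0 k l : 0 <= g k l by have [] := g0C k l.
have gC k l : g k l = g l k by have [] := g0C k l.
have rn0 : 0 < r ^+ n by rewrite exprn_gt0.
have mA k : measurable (A k) by exact: measurable_cube.
pose u k (x : 'rV[R]_n) : R := \1_(A k) x * om x.
have mu_ k : measurable_fun setT (u k).
  by apply: measurable_funM => //; exact: measurable_indic.
have u0 k x : 0 <= u k x by rewrite mulr_ge0.
have uE k x : A k x -> u k x = om x by move=> Akx; rewrite /u indicE mem_set// mul1r.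
have uN k x : ~ A k x -> u k x = 0 by move=> nA; rewrite /u indicE memNset// mul0r.
pose q k := (\int[mu]_(x in X) (u k x)%:E)%E.
have q0 k : (0 <= q k)%E by apply: integral_ge0 => x _; rewrite lee_fin.
have mnear : measurable_fun setT (nearby r) by exact: measurable_near.
have mom2 : measurable_fun setT (fun w : 'rV[R]_n * 'rV[R]_n => om w.1 * om w.2).
  by apply: measurable_funM; exact: measurableT_comp.
have muu k l : measurable_fun setT (fun w : 'rV[R]_n * 'rV[R]_n => u k w.1 * u l w.2).
  by apply: measurable_funM; exact: measurableT_comp.
have qq k l : (q k * q l = dint (fun w => u k w.1 * u l w.2)%R)%E by rewrite dint_prod.
have sumq : (\sum_k q k * q k <= (a * r ^+ n)%:E)%E.
  apply: (le_trans _ hnear); under eq_bigr do rewrite qq.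
  rewrite -(dint_sum (F := fun k w => u k w.1 * u k w.2))//; last first.
    by move=> k w; rewrite mulr_ge0.
  apply: dint_le.
  - by apply: measurable_sum => k.
  - exact: measurable_funM.
  move=> x z Xx Xz /=; rewrite sumr_ge0/=; last by move=> k _; rewrite mulr_ge0.
  have [k Akx] := covA x (XM Xx).
  rewrite (bigD1 k)//= big1 ?addr0; last first.
    move=> l lk; rewrite (uN l x) ?mul0r// => Alx.
    by move: lk; rewrite (disA l k x Alx Akx) eqxx.
  have [Akz|nAkz] := pselect (A k z); last first.
    by rewrite (uN k z)// mulr0 mulr_ge0 ?mulr_ge0// ler0n.
  rewrite !uE// /nearby /= (_ : `|x - z| <= r) ?mul1r//.
  apply/rV_norm_leP; first exact: ltW.
  move=> i; rewrite !mxE ler_norml; have /andP[h1 h2] := Akx i; have /andP[h3 h4] := Akz i.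
  by apply/andP; split; lra.
(* Integrability of [om] is not assumed; finiteness comes from the bound on the squares. *)
have qfin k : q k \is a fin_num.
  have : (q k * q k <= (a * r ^+ n)%:E)%E.
    by apply: (le_trans _ sumq); rewrite (bigD1 k)//= leeDl// sume_ge0// => l _; rewrite mule_ge0.
  by case: (q k) (q0 k) => [s _ _|_|//]; rewrite ?fin_numE// mulyy.
pose Q k := fine (q k).
have qE k : q k = (Q k)%:E by rewrite fineK.
have Q0 k : 0 <= Q k by rewrite fine_ge0.
have sumQ : \sum_k Q k ^+ 2 <= a * r ^+ n.
  move: sumq; under eq_bigr do rewrite qE -EFinM.
  by rewrite sumEFin lee_fin; under eq_bigr do rewrite -expr2.
have ker0 w : 0 <= expker r w by rewrite expR_ge0.
split.
- apply: (@le_trans _ _ (\sum_k q k)%E).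
    rewrite /q -(@ge0_integral_sum _ _ _ mu X mX _ (fun k x => (u k x)%:E)); last 2 first.
    - by move=> k; apply/measurable_EFinP; exact: measurable_funTS.
    - by move=> k x _; rewrite lee_fin.
    apply: ge0_le_integral; first exact: mX.
    - by move=> x _; rewrite lee_fin.
    - by apply/measurable_EFinP; exact: measurable_funTS.
    - by apply: emeasurable_sum => k; apply/measurable_EFinP; exact: measurable_funTS.
    move=> x Xx; have [k Akx] := covA x (XM Xx).
    by rewrite sumEFin lee_fin (bigD1 k)//= uE// lerDl sumr_ge0.
  under eq_bigr do rewrite qE; rewrite sumEFin lee_fin.
  (* The arithmetic-geometric mean inequality with weight r^n: the squares sum to a r^n and the
     number of cells times r^n is at most CN. *)
  apply: (@le_trans _ _ (\sum_k (Q k ^+ 2 / r ^+ n + r ^+ n))).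
    apply: ler_sum => k _.
    have : 0 <= (Q k - r ^+ n) ^+ 2 / r ^+ n by rewrite divr_ge0 ?sqr_ge0// ltW.
    have -> : (Q k - r ^+ n) ^+ 2 / r ^+ n = Q k ^+ 2 / r ^+ n + r ^+ n - 2 * Q k.
      by field; rewrite gt_eqF.
    by have := Q0 k; move: (Q k ^+ 2 / _) => v; lra.
  rewrite big_split/= -mulr_suml sumr_const -[_ *+ _]mulr_natl.
  by rewrite lerD// ler_pdivrMr.
- apply: (@le_trans _ _ (\sum_k \sum_l (g k l)%:E * (q k * q l))%E).
    have mG k l : measurable_fun setT (fun w : 'rV[R]_n * 'rV[R]_n => g k l * (u k w.1 * u l w.2)).
      by apply: measurable_funM => //; exact: measurable_cst.
    have -> : (\sum_k \sum_l (g k l)%:E * (q k * q l))%E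
        = dint (fun w => \sum_k \sum_l g k l * (u k w.1 * u l w.2)).
      rewrite (dint_sum (F := fun k w => \sum_l g k l * (u k w.1 * u l w.2))).
      - apply: eq_bigr => k _.
        rewrite (dint_sum (F := fun l w => g k l * (u k w.1 * u l w.2))).
        + apply: eq_bigr => l _; rewrite qq -dintZ//.
          by move=> x z _ _; rewrite mulr_ge0.
        + exact: mG.
        + by move=> l w; rewrite mulr_ge0// mulr_ge0.
      - by move=> k; apply: measurable_sum => l.
      - by move=> k w; apply: sumr_ge0 => l _; rewrite mulr_ge0// mulr_ge0.
    apply: dint_le.
    - by apply: measurable_funM => //; exact: measurable_expker.
    - by apply: measurable_sum => k; apply: measurable_sum => l.
    move=> x z Xx Xz /=; rewrite mulr_ge0 ?mulr_ge0//=.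
    have [k Akx] := covA x (XM Xx); have [l Alz] := covA z (XM Xz).
    rewrite (bigD1 k)//= (bigD1 l)//= !uE//.
    rewrite -addrA ler_wpDr ?ler_wpM2r ?mulr_ge0//; last exact: gker.
    rewrite addr_ge0 ?sumr_ge0// => *; first by rewrite mulr_ge0// mulr_ge0.
    by rewrite sumr_ge0// => *; rewrite mulr_ge0// mulr_ge0.
  under eq_bigr => k _ do under eq_bigr => l _ do rewrite !qE -!EFinM.
  under eq_bigr do rewrite sumEFin.
  rewrite sumEFin lee_fin (le_trans (schur_form Q g0 gC gG))//.
  by rewrite -mulrA ler_pM2l.
move=> c Y h cc0 mY YX mh h0 hY.
(* On cell k the potential of [om] is at most S k, and the cell has measure at most Lam r^n;
   [schur_square] then sums the S k^2. *)
pose S k := \sum_l g k l * Q l.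
have S0 k : 0 <= S k by rewrite sumr_ge0// => l _; rewrite mulr_ge0.
have kerS k x : X x -> A k x ->
    (\int[mu]_(z in X) (expker r (x, z) * om z)%R%:E <= (S k)%:E)%E.
  move=> Xx Akx.
  have -> : (S k)%:E = (\int[mu]_(z in X) (\sum_l g k l * u l z)%:E)%E.
    under eq_integral do rewrite -sumEFin.
    rewrite (@ge0_integral_sum _ _ _ mu X mX _ (fun l z => (g k l * u l z)%:E)).
    - rewrite /S -sumEFin; apply: eq_bigr => l _.
      rewrite EFinM -qE /q -ge0_integralZl.
      + by apply: eq_integral => z _; rewrite EFinM.
      + exact: mX.
      + by apply/measurable_EFinP; exact: measurable_funTS.
      + by move=> z _; rewrite lee_fin.
      + by rewrite lee_fin.
    - move=> l; apply/measurable_EFinP; apply: measurable_funTS.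
      by apply: measurable_funM => //; exact: measurable_cst.
    - by move=> l z _; rewrite lee_fin mulr_ge0.
  apply: ge0_le_integral; first exact: mX.
  - by move=> z _; rewrite lee_fin mulr_ge0.
  - apply/measurable_EFinP; apply: measurable_funTS; apply: measurable_funM => //.
    exact: (measurable_fun_pair2 x (measurable_expker r)).
  - apply/measurable_EFinP; apply: measurable_funTS; apply: measurable_sum => l.
    by apply: measurable_funM => //; exact: measurable_cst.
  move=> z Xz; rewrite lee_fin; have [l Alz] := covA z (XM Xz).
  rewrite (bigD1 l)//= uE// ler_wpDr ?ler_wpM2r//; last exact: gker.
  by rewrite sumr_ge0// => j _; rewrite mulr_ge0.
pose B := \sum_k Lam * r ^+ n * (c ^+ 2 * S k ^+ 2).
have cS0 k : 0 <= c ^+ 2 * S k ^+ 2 by rewrite mulr_ge0// sqr_ge0.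
apply: (@le_trans _ _ B%:E).
  apply: (@le_trans _ _ (\int[mu]_(x in Y) \sum_k ((c ^+ 2 * S k ^+ 2) * \1_(A k) x)%:E)%E).
    apply: ge0_le_integral; first exact: mY.
    - by move=> x _; rewrite lee_fin sqr_ge0.
    - apply/measurable_EFinP; apply: measurable_funTS.
      exact: measurable_funX.
    - apply: emeasurable_sum => k; apply/measurable_EFinP; apply: measurable_funTS.
      by apply: measurable_funM; [exact: measurable_cst|exact: measurable_indic].
    move=> x Yx; have Xx := YX x Yx; have [k Akx] := covA x (XM Xx).
    rewrite sumEFin lee_fin (bigD1 k)//= indicE mem_set// mulr1.
    rewrite ler_wpDr//; first by rewrite sumr_ge0// => l _; rewrite mulr_ge0.
    rewrite -exprMn lerXn2r ?nnegrE ?invr_ge0 ?mulr_ge0//.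
    rewrite -lee_fin EFinM; apply: (le_trans (hY x Yx)).
    by apply: lee_wpmul2l; [rewrite lee_fin|exact: kerS].
  rewrite (@ge0_integral_sum _ _ _ mu Y mY _ (fun k x => ((c ^+ 2 * S k ^+ 2) * \1_(A k) x)%:E)); last 2 first.
  - move=> k; apply/measurable_EFinP; apply: measurable_funTS.
    by apply: measurable_funM; [exact: measurable_cst|exact: measurable_indic].
  - by move=> k x _; rewrite lee_fin mulr_ge0.
  rewrite /B -sumEFin; apply: lee_sum => k _.
  under eq_integral do rewrite EFinM.
  rewrite ge0_integralZl; last 4 first.
  - exact: mY.
  - by apply/measurable_EFinP; exact: measurable_indic.
  - by move=> x _; rewrite lee_fin.
  - by rewrite lee_fin.
  rewrite integral_indic// muleC [leRHS]EFinM; apply: lee_wpmul2r; first by rewrite lee_fin.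
  apply: (le_trans _ (muL _ r0)); apply: le_measure; rewrite ?inE.
  - exact: measurableI.
  - exact: measurable_cube.
  - exact: subIsetl.
rewrite lee_fin /B -mulr_sumr -mulr_sumr.
have := schur_square Q g0 gC gG; rewrite -/S => hS.
have {}hS : \sum_k S k ^+ 2 <= G ^+ 2 * (a * r ^+ n).
  by rewrite (le_trans hS)// ler_wpM2l// sqr_ge0.
rewrite (_ : Lam * G ^+ 2 * a * c ^+ 2 * (r ^+ n) ^+ 2
  = Lam * r ^+ n * (c ^+ 2 * (G ^+ 2 * (a * r ^+ n)))); last by ring.
apply: ler_wpM2l; first by rewrite mulr_ge0// ltW.
by apply: ler_wpM2l => //; rewrite sqr_ge0.
Qed.

End Kernel.

(** * Elementary exponential inequalities *)

Section ExpInequalities.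
Context {R : realType}.
Implicit Types (t a k y m eta : R).

Lemma expR_gaussian_le k y : 0 < k -> expR (- (k * y ^+ 2)) <= expR (4 * k)^-1 * expR (- y).
Proof.
move=> k0; rewrite -expRD ler_expR -subr_ge0.
have -> : (4 * k)^-1 - y - - (k * y ^+ 2) = k * (y - (2 * k)^-1) ^+ 2.
  by field; rewrite gt_eqF.
by rewrite mulr_ge0 ?sqr_ge0// ltW.
Qed.

Lemma cube_le_expR y : 0 <= y -> y ^+ 3 <= 27 * expR y.
Proof.
move=> y0; have -> : expR y = expR (y / 3) ^+ 3 by rewrite -expRM_natl mulrC divfK.
have -> : 27 = 3 ^+ 3 :> R by rewrite -natrX.
rewrite -exprMn lerXn2r ?nnegrE ?mulr_ge0 ?expR_ge0//.
have := expR_ge1Dx (y / 3); lra.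
Qed.

(** Half of the Gaussian absorbs the power, the other half gives the exponential decay. *)
Lemma pow6_gaussian_le k y : 0 < k -> 
  y ^+ 6 * expR (- (k * y ^+ 2)) <= 27 * (2 / k) ^+ 3 * expR (2 * k)^-1 * expR (- y).
Proof.
move=> k0; have k20 : 0 < k / 2 by rewrite divr_gt0.
have h1 : y ^+ 6 <= 27 * (2 / k) ^+ 3 * expR (k / 2 * y ^+ 2).
  have -> : y ^+ 6 = (2 / k) ^+ 3 * (k / 2 * y ^+ 2) ^+ 3.
    rewrite -exprMn (_ : 2 / k * (k / 2 * y ^+ 2) = y ^+ 2) -?exprM//.
    by field; rewrite gt_eqF.
  rewrite [leRHS](_ : _ = (2 / k) ^+ 3 * (27 * expR (k / 2 * y ^+ 2))); last by ring.
  apply: ler_wpM2l; first by rewrite exprn_ge0// divr_ge0// ltW.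
  apply: cube_le_expR.
  by rewrite mulr_ge0 ?sqr_ge0// ltW.
apply: (@le_trans _ _ (27 * (2 / k) ^+ 3 * expR (k / 2 * y ^+ 2) * expR (- (k * y ^+ 2)))).
  by rewrite ler_wpM2r ?expR_ge0.
have P0 : 0 < 27 * (2 / k) ^+ 3 by rewrite mulr_gt0// exprn_gt0// divr_gt0.
move: (27 * (2 / k) ^+ 3) P0 => P P0; rewrite -!mulrA ler_pM2l//.
rewrite -expRD (_ : _ + _ = - (k / 2 * y ^+ 2)); last by field.
rewrite (le_trans (expR_gaussian_le y k20))// le_eqVlt; apply/orP; left; apply/eqP.
by congr (expR _^-1 * _); field.
Qed.

(** This is 2 sinh(t/2). If t is the logarithm of the ratio of two positive numbers with geometric
    mean m, their difference is m [sh t], so [sh t * t] is the density of a symmetrized relative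
    entropy. *)
Definition sh t := expR (t / 2) - expR (- (t / 2)).

Lemma shN t : sh (- t) = - sh t.
Proof. by rewrite /sh mulNr opprK opprB. Qed.

Lemma sh_ge t : 0 <= t -> t / 2 <= sh t.
Proof.
move=> t0; have := expR_ge1Dx (t / 2).
have : expR (- (t / 2)) <= 1 by rewrite expR_le1 oppr_le0 divr_ge0.
by rewrite /sh; lra.
Qed.

Lemma sh_mul_norm t : sh t * t = sh `|t| * `|t|.
Proof.
have [t0|t0] := leP 0 t; first by rewrite ger0_norm.
by rewrite ltr0_norm// shN mulrNN.
Qed.

Lemma sh_mul_ge0 t : 0 <= sh t * t.
Proof.
rewrite sh_mul_norm mulr_ge0// (le_trans _ (sh_ge (normr_ge0 t)))// divr_ge0//.
Qed.

Lemma sqr_le_sh_mul t : t ^+ 2 <= 2 * (sh t * t).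
Proof.
rewrite sh_mul_norm -real_normK ?num_real// expr2 mulrA ler_wpM2r//.
by have := sh_ge (normr_ge0 t); lra.
Qed.

Lemma sh_le t : 0 <= t -> sh t <= t * expR (t / 2).
Proof.
move=> t0; have := expR_ge1Dx (- t) => h.
have -> : sh t = expR (t / 2) * (1 - expR (- t)).
  rewrite /sh mulrBr mulr1 -expRD (_ : t / 2 + - t = - (t / 2))//; last by field.
by rewrite mulrC ler_wpM2r ?expR_ge0//; lra.
Qed.
Lemma sh_norm t : `|sh t| = sh `|t|.
Proof.
have sh0 u : 0 <= u -> 0 <= sh u.
  by move=> u0; rewrite (le_trans _ (sh_ge u0))// divr_ge0.
have [t0|t0] := leP 0 t; first by rewrite !ger0_norm// sh0.
by rewrite [`|t|]ltr0_norm// -normrN -shN ger0_norm// sh0// oppr_ge0 ltW.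
Qed.

(* The Young-type absorption that replaces the tilt [a] by [t]: either [t]
   dominates [a], or everything is controlled by [a]. *)
Lemma sh_absorb eta t a : 0 < eta <= 1 ->
  sh t * a <= (1 + eta)^-1 * (sh t * t)
    + 2 * (a ^+ 2 * expR ((1 + eta) * `|a| / 2)).
Proof.
move=> /andP[eta0 eta1]; have e1 : 0 < 1 + eta by rewrite ltr_wpDr// ltW.
have [at_|ta] := leP ((1 + eta) * `|a|) `|t|.
  apply: ler_wpDr; first by rewrite mulr_ge0// mulr_ge0 ?sqr_ge0 ?expR_ge0.
  rewrite (le_trans (ler_norm _))// normrM sh_norm sh_mul_norm mulrCA.
  apply: ler_wpM2l; first by rewrite -sh_norm.
  by rewrite mulrC ler_pdivlMr// mulrC.
apply: ler_wpDl; first by rewrite mulr_ge0 ?invr_ge0 ?sh_mul_ge0// ltW.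
rewrite (le_trans (ler_norm _))// normrM sh_norm.
have h1 : sh `|t| <= (2 * `|a|) * expR ((1 + eta) * `|a| / 2).
  rewrite (le_trans (sh_le (normr_ge0 t)))// ler_pM ?expR_ge0//.
    rewrite (le_trans (ltW ta))// ler_wpM2r//; lra.
  by rewrite ler_expR ler_pM2r// ltW.
apply: (@le_trans _ _ (2 * `|a| * expR ((1 + eta) * `|a| / 2) * `|a|)).
  by rewrite ler_wpM2r.
by rewrite le_eqVlt; apply/orP; left; apply/eqP; rewrite -(real_normK (num_real a)); ring.
Qed.

(** For t >= 1/3 the term 3 [sh t] t already exceeds [sh t]; for smaller t everything is bounded by
    a number. It lets dissipation control the ratio of the arithmetic to the geometric mean. *)
Lemma ch_le_sh t : expR (t / 2) + expR (- (t / 2)) <= 3 + 3 * (sh t * t).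
Proof.
wlog t0 : t / 0 <= t => [H|].
  have [/H//|/ltW t0] := leP 0 t.
  by have := H (- t); rewrite oppr_ge0 shN mulrNN mulNr opprK addrC; apply.
have h1 : expR (- (t / 2)) <= 1 by rewrite expR_le1 oppr_le0 divr_ge0.
have hs : 0 <= sh t by rewrite (le_trans _ (sh_ge t0))// divr_ge0.
suff : sh t <= 1 + 3 * (sh t * t) by move: (sh t * t) h1; rewrite /sh => u; lra.
have [t3|t3] := leP 3^-1 t.
  rewrite ler_wpDl// mulrCA ler_peMr//; lra.
rewrite ler_wpDr//; first by rewrite mulr_ge0// sh_mul_ge0.
have h2 : expR (t / 2) <= 6 / 5.
  have := expR_ge1Dx (- (t / 2)) => h.
  have : expR (t / 2) * expR (- (t / 2)) = 1 by rewrite -expRD subrr expR0.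
  have := expR_ge0 (t / 2); move: (expR (t / 2)) (expR (- (t / 2))) h => u v h u0 uv.
  have : u * (5 / 6) <= u * v by rewrite ler_wpM2l//; lra.
  by rewrite uv; lra.
rewrite (le_trans (sh_le t0))// (@le_trans _ _ (3^-1 * (6 / 5)))//; last by lra.
by rewrite ler_pM ?expR_ge0// ltW.
Qed.

End ExpInequalities.

(** * Estimates for kernels with two equal marginals *)

Ltac meas1 := first
  [ match goal with H : ?P |- ?P => exact H end
  | match goal with H : measurable_fun setT ?h |- measurable_fun setT (fun w => ?h (@?k w)) =>
      apply: (measurableT_comp H) end
  | exact: measurable_fst | exact: measurable_snd
  | exact: measurable_cst | exact: measurable_id
  | apply: measurable_funD | apply: measurable_funB | apply: measurable_funM | apply: measurable_funX
  | apply: (measurableT_comp (@measurable_expR _))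
  | apply: (measurableT_comp (@normr_measurable _ _))
  | apply: (measurableT_comp (@oppr_measurable _ _)) ].
Ltac meas := repeat meas1.

Section Core.
Context {R : realType} {d : nat}.
Variables (mu : probability 'rV[R]_d.+1 R) (X : set 'rV[R]_d.+1) (M Lam : R).
Hypotheses (mX : measurable X) (muX : mu X = 1%E) (Lam0 : 0 <= Lam)
  (muL : forall (a : 'rV[R]_d.+1) (r : R), 0 < r ->
    (mu [set x : 'rV[R]_d.+1 | forall i, (a 0 i <= x 0 i < a 0 i + r)%R]
     <= (Lam * r ^+ d.+1)%:E)%E).
Local Notation n := d.+1.
Implicit Types (F H : 'rV[R]_d.+1 * 'rV[R]_d.+1 -> R) (x z : 'rV[R]_d.+1) (h : 'rV[R]_n -> R).
Variables (Dd : 'rV[R]_n -> 'rV[R]_n -> R) (kap K G CN : R).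
Hypotheses (mD : measurable_fun setT (fun w : 'rV[R]_n * 'rV[R]_n => Dd w.1 w.2))
  (kap0 : 0 < kap) (kapK : kap <= K)
  (Dlow : forall x z, X x -> X z -> kap * `|x - z| ^+ 2 <= Dd x z)
  (Dup : forall x z, X x -> X z -> Dd x z <= K * `|x - z| ^+ 2)
  (Dasym : forall x z, X x -> X z -> `|Dd x z - Dd z x| <= K * `|x - z| ^+ 3)
  (Dlip1 : forall x x' z, X x -> X x' -> X z -> Dd x z - Dd x' z <= K * `|x - x'|)
  (Dlip2 : forall x z z', X x -> X z -> X z' -> Dd x z - Dd x z' <= K * `|z - z'|)
  (G0 : 0 < G) (CN0 : 0 < CN) (KB : kernel_bounded mu X Lam G CN).

Definition wgt (r : R) (U W : 'rV[R]_n -> R) (w : 'rV[R]_n * 'rV[R]_n) : R :=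
  expR (- (Dd w.1 w.2 / r ^+ 2) - U w.1 - W w.2).

Variables (r : R) (U W : 'rV[R]_n -> R).
Hypotheses (r01 : 0 < r < 1) (mU : measurable_fun setT U) (mW : measurable_fun setT W)
  (iU : (\int[mu]_(x in X) `|U x|%:E < +oo)%E)
  (iW : (\int[mu]_(x in X) `|W x|%:E < +oo)%E)
  (hp1 : forall x, X x -> (\int[mu]_(z in X) (wgt r U W (x, z))%:E = 1)%E)
  (hp2 : forall z, X z -> (\int[mu]_(x in X) (wgt r U W (x, z))%:E = 1)%E).

Let r0 : 0 < r. Proof. by case/andP: r01. Qed.
Let rn0 : 0 < r ^+ n. Proof. by rewrite exprn_gt0. Qed.
Let K0 : 0 < K. Proof. exact: lt_le_trans kapK. Qed.
Let ell : R := ln r^-1.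
Let V x := U x - W x.
Let p := wgt r U W.
Let pt (w : 'rV[R]_n * 'rV[R]_n) := p (w.2, w.1).
Let E h : \bar R := (\int[mu]_(x in X) (h x)%:E)%E.
Local Notation J := (dint mu X).

Let ell0 : 0 <= ell.
Proof. by rewrite /ell ln_ge0// invf_ge1// ltW//; case/andP: r01. Qed.

Let expell : expR (n%:R * ell) = (r ^+ n)^-1.
Proof. by rewrite expRM_natl /ell lnK ?posrE ?invr_gt0// exprVn. Qed.

Let mp : measurable_fun setT p.
Proof. by rewrite /p /wgt; meas. Qed.

Let mDT : measurable_fun setT (fun w : 'rV[R]_n * 'rV[R]_n => Dd w.2 w.1).
Proof. exact: (measurableT_comp mD (@measurable_swap _ _ _ _)). Qed.

Let mpt : measurable_fun setT pt.
Proof. by rewrite /pt /p /wgt /=; meas. Qed.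

Let p0 w : 0 <= p w. Proof. exact: expR_ge0. Qed.
Let pt0 w : 0 <= pt w. Proof. exact: expR_ge0. Qed.

Let mV : measurable_fun setT V. Proof. by rewrite /V; meas. Qed.

Let mEX h : measurable_fun setT h -> measurable_fun X (EFin \o h).
Proof. by move=> mh; apply/measurable_EFinP; exact: measurable_funTS. Qed.

Let inner1 F h : measurable_fun setT F -> measurable_fun setT h ->
  (forall w, 0 <= F w) -> (forall x, 0 <= h x) ->
  J (fun w => F w * h w.1)
  = (\int[mu]_(x in X) ((h x)%:E * \int[mu]_(z in X) (F (x, z))%:E))%E.
Proof.
move=> mF mh F0 h0; have mFh : measurable_fun setT (fun w => F w * h w.1) by meas.
rewrite /dint (tonelli_in mu mu mX mX mFh); last by move=> x z _ _; rewrite mulr_ge0.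
apply: eq_integral => x _; rewrite -ge0_integralZl.
- by apply: eq_integral => z _ /=; rewrite EFinM muleC.
- exact: mX.
- by apply: mEX; exact: (measurable_fun_pair2 x mF).
- by move=> z _; rewrite lee_fin.
- by rewrite lee_fin.
Qed.

Let inner2 F h : measurable_fun setT F -> measurable_fun setT h ->
  (forall w, 0 <= F w) -> (forall x, 0 <= h x) ->
  J (fun w => F w * h w.2)
  = (\int[mu]_(z in X) ((h z)%:E * \int[mu]_(x in X) (F (x, z))%:E))%E.
Proof.
move=> mF mh F0 h0; have mFh : measurable_fun setT (fun w => F w * h w.2) by meas.
rewrite /dint (tonelli_in mu mu mX mX mFh); last by move=> x z _ _; rewrite mulr_ge0.
rewrite (tonelli_in_swap mu mu mX mX mFh); last by move=> x z _ _; rewrite mulr_ge0.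
apply: eq_integral => z _; rewrite -ge0_integralZl.
- by apply: eq_integral => x _ /=; rewrite EFinM muleC.
- exact: mX.
- by apply: mEX; exact: (measurable_fun_pair1 z mF).
- by move=> x _; rewrite lee_fin.
- by rewrite lee_fin.
Qed.

Let marg_aux (F : 'rV[R]_n -> \bar R) h : (forall x, X x -> F x = 1%E) ->
  (\int[mu]_(x in X) ((h x)%:E * F x) = E h)%E.
Proof. by move=> F1; apply: eq_integral => x; rewrite inE => Xx; rewrite F1// mule1. Qed.

Let marg1 h : measurable_fun setT h -> (forall x, 0 <= h x) -> J (fun w => p w * h w.1) = E h.
Proof. by move=> mh h0; rewrite inner1//; exact: marg_aux. Qed.
Let marg2 h : measurable_fun setT h -> (forall x, 0 <= h x) -> J (fun w => p w * h w.2) = E h.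
Proof. by move=> mh h0; rewrite inner2//; exact: marg_aux. Qed.
Let margt1 h : measurable_fun setT h -> (forall x, 0 <= h x) -> J (fun w => pt w * h w.1) = E h.
Proof. by move=> mh h0; rewrite inner1//; exact: marg_aux. Qed.
Let margt2 h : measurable_fun setT h -> (forall x, 0 <= h x) -> J (fun w => pt w * h w.2) = E h.
Proof. by move=> mh h0; rewrite inner2//; exact: marg_aux. Qed.

Let Ecst (c : R) : E (cst c) = c%:E.
Proof. by rewrite /E (_ : (fun _ => _) = cst c%:E)// integral_cst// [X in (_ * X)%E](_ : _ = 1%E) ?mule1. Qed.

Let ED h1 h2 : measurable_fun setT h1 -> measurable_fun setT h2 ->
  (forall x, 0 <= h1 x) -> (forall x, 0 <= h2 x) ->
  E (fun x => h1 x + h2 x) = (E h1 + E h2)%E.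
Proof.
move=> m1 m2 h10 h20; rewrite /E -ge0_integralD.
- by [].
- exact: mX.
- by move=> x _; rewrite lee_fin.
- exact: mEX.
- by move=> x _; rewrite lee_fin.
- exact: mEX.
Qed.

Let EZ (c : R) h : measurable_fun setT h -> 0 <= c -> (forall x, 0 <= h x) ->
  E (fun x => c * h x) = (c%:E * E h)%E.
Proof.
move=> mh c0 h0; rewrite /E -ge0_integralZl.
- by [].
- exact: mX.
- exact: mEX.
- by move=> x _; rewrite lee_fin.
- by rewrite lee_fin.
Qed.

Let Ele h1 h2 : measurable_fun setT h1 -> measurable_fun setT h2 ->
  (forall x, X x -> 0 <= h1 x <= h2 x) -> (E h1 <= E h2)%E.
Proof.
move=> m1 m2 h12; apply: ge0_le_integral; first exact: mX.
- by move=> x /h12 /andP[h0 _]; rewrite lee_fin.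
- exact: mEX.
- exact: mEX.
- by move=> x /h12 /andP[_ h0]; rewrite lee_fin.
Qed.

Let near_inner x : (\int[mu]_(z in X) (nearby r (x, z))%:E <= (Lam * (3 * r) ^+ n)%:E)%E.
Proof.
have r30 : 0 < 3 * r by rewrite mulr_gt0.
apply: (le_trans _ (muL (x - const_mx r) r30)).
set A := [set _ | _].
have mA : measurable A by exact: measurable_cube.
apply: (@le_trans _ _ (\int[mu]_(z in X) (\1_A z)%:E)%E).
  apply: ge0_le_integral; first exact: mX.
  - by move=> z _; rewrite lee_fin ler0n.
  - by apply: mEX; exact: (measurable_fun_pair2 x (measurable_near r)).
  - by apply: mEX; exact: measurable_indic.
  move=> z _; rewrite lee_fin /nearby /= indicE ler_nat.
  case: (boolP (`|x - z| <= r)) => // xz; rewrite mem_set// => i; rewrite !mxE.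
  have := le_trans (rV_coord_le_norm (x - z) i) xz.
  by rewrite !mxE ler_norml => /andP[h1 h2]; apply/andP; split; lra.
rewrite integral_indic//; apply: le_measure; rewrite ?inE//; exact: measurableI.
Qed.

Let mnear : measurable_fun setT (nearby r : 'rV[R]_n * 'rV[R]_n -> R).
Proof. exact: measurable_near. Qed.

Let nearC x z : nearby r (x, z) = nearby r (z, x) :> R.
Proof. by rewrite /nearby /= distrC. Qed.

Let near0 (w : 'rV[R]_n * 'rV[R]_n) : 0 <= nearby r w. Proof. exact: ler0n. Qed.

Let near_dint h : measurable_fun setT h -> (forall x, 0 <= h x) ->
  (J (fun w => nearby r w * (h w.1 + h w.2))%R <= (2 * Lam * (3 * r) ^+ n)%:E * E h)%E.
Proof.
move=> mh h0.
have L0 : 0 <= Lam * (3 * r) ^+ n by rewrite mulr_ge0// exprn_ge0// mulr_ge0// ltW.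
have E0 : (0 <= E h)%E by apply: integral_ge0 => x _; rewrite lee_fin.
have aux (F : 'rV[R]_n -> \bar R) : measurable_fun X F -> (forall x, 0 <= F x)%E ->
    (forall x, F x <= (Lam * (3 * r) ^+ n)%:E)%E ->
    (\int[mu]_(x in X) ((h x)%:E * F x) <= (Lam * (3 * r) ^+ n)%:E * E h)%E.
  move=> mF F0 FL; rewrite /E -ge0_integralZl; last 4 first.
  - exact: mX.
  - exact: mEX.
  - by move=> x _; rewrite lee_fin.
  - by rewrite lee_fin.
  apply: ge0_le_integral; first exact: mX.
  - by move=> x _; rewrite mule_ge0// lee_fin.
  - by apply: emeasurable_funM => //; exact: mEX.
  - by apply: measurable_funeM; exact: mEX.
  by move=> x _; rewrite muleC; apply: lee_wpmul2r; rewrite ?lee_fin.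
under eq_fun do rewrite mulrDr.
rewrite dintD//; last 4 first.
- by meas.
- by meas.
- by move=> x z _ _; rewrite mulr_ge0.
- by move=> x z _ _; rewrite mulr_ge0.
rewrite inner1// inner2// -mulrA mulr_natl mulr2n EFinD ge0_muleDl ?lee_fin//.
apply: leeD; apply: aux.
- by apply: (tonelli_inner_measurable mu mX mX mnear).
- by move=> x; apply: integral_ge0 => z _; rewrite lee_fin.
- exact: near_inner.
- have mn' : measurable_fun setT (fun w : 'rV[R]_n * 'rV[R]_n => nearby r (w.2, w.1) : R).
    exact: (measurableT_comp mnear (@measurable_swap _ _ _ _)).
  by have := tonelli_inner_measurable mu mX mX mn'; apply.
- by move=> x; apply: integral_ge0 => z _; rewrite lee_fin.
- by move=> z; under eq_integral do rewrite nearC; exact: near_inner.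
Qed.

Let Efin h : measurable_fun setT h -> (forall x, 0 <= h x) -> (E h < +oo)%E ->
  E h = (fine (E h))%:E.
Proof.
move=> mh h0 hoo; rewrite fineK// ge0_fin_numE//.
by apply: integral_ge0 => x _; rewrite lee_fin.
Qed.

(** Integrals of [U], [W] and [V] are handled through their positive and negative parts, so that
    every inequality below compares integrals of nonnegative functions, whose finite values cancel
    at the end. *)
Let parts h : measurable_fun setT h -> (E (fun x => `|h x|%R) < +oo)%E ->
  exists (hp hn : 'rV[R]_n -> R) (ep en : R),
  [/\ measurable_fun setT hp /\ measurable_fun setT hn,
      (forall x, 0 <= hp x) /\ (forall x, 0 <= hn x),
      (forall x, h x = hp x - hn x), (forall x, `|h x| = hp x + hn x) &
      E hp = ep%:E /\ E hn = en%:E].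
Proof.
move=> mh hoo; pose hp x := (`|h x| + h x) / 2; pose hn x := (`|h x| - h x) / 2.
have mhp : measurable_fun setT hp by rewrite /hp; meas.
have mhn : measurable_fun setT hn by rewrite /hn; meas.
have mn_ : measurable_fun setT (fun x => `|h x|) by meas.
have hp0 x : 0 <= hp x.
  by rewrite /hp divr_ge0//; have := lerNnormlW (lexx `|h x|); lra.
have hn0 x : 0 <= hn x by rewrite /hn divr_ge0// subr_ge0 ler_norm.
exists hp, hn, (fine (E hp)), (fine (E hn)); split=> //.
- by move=> x; rewrite /hp /hn; field.
- by move=> x; rewrite /hp /hn; field.
split; apply: Efin => //; apply: (le_lt_trans _ hoo); apply: Ele => // x _.
  by rewrite hp0/= /hp; have := ler_norm (h x); lra.
by rewrite hn0/= /hn; have := lerNnormlW (lexx `|h x|); lra.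
Qed.

Let c1 := expR (4 * kap)^-1.
Let c10 : 0 < c1. Proof. exact: expR_gt0. Qed.

Let scaled w : `|w.1 - w.2 : 'rV[R]_n| ^+ 2 / r ^+ 2 = (`|w.1 - w.2| / r) ^+ 2.
Proof. by rewrite exprMn exprVn. Qed.

Let rr0 : 0 < r ^+ 2. Proof. by rewrite exprn_gt0. Qed.

Let Dscaled_low w : X w.1 -> X w.2 ->
  kap * (`|w.1 - w.2| / r) ^+ 2 <= Dd w.1 w.2 / r ^+ 2.
Proof.
by move=> X1 X2; rewrite -scaled mulrA ler_pM2r ?invr_gt0//; exact: Dlow.
Qed.

Let Dscaled_up w : X w.1 -> X w.2 ->
  Dd w.1 w.2 / r ^+ 2 <= K * (`|w.1 - w.2| / r) ^+ 2.
Proof.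
by move=> X1 X2; rewrite -scaled mulrA ler_pM2r ?invr_gt0//; exact: Dup.
Qed.

Let expD_le w : X w.1 -> X w.2 ->
  expR (- (Dd w.1 w.2 / r ^+ 2)) <= c1 * expker r w.
Proof.
move=> X1 X2; rewrite /expker; apply: (le_trans _ (expR_gaussian_le _ kap0)).
by rewrite ler_expR lerN2; exact: Dscaled_low.
Qed.

Let Cq := c1 * (G * (Lam * 3 ^+ n)).

Let mexpker : measurable_fun setT (expker r : 'rV[R]_n * 'rV[R]_n -> R).
Proof. exact: measurable_expker. Qed.

Let ker0 (w : 'rV[R]_n * 'rV[R]_n) : 0 <= expker r w. Proof. exact: expR_ge0. Qed.

Let r01' : 0 < r <= 1. Proof. by rewrite r0 ltW//; case/andP: r01. Qed.

(** [kernel_bounded] with om = 1: the pairs at distance at most r have measure at most Lam (3r)^n,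
    and the Gaussian is at most [c1] times the exponential kernel. *)
Let gauss_dint : (J (fun w => (r ^+ n)^-1 * expR (- (Dd w.1 w.2 / r ^+ 2)))%R <= Cq%:E)%E.
Proof.
have L0 : 0 <= Lam * 3 ^+ n by rewrite mulr_ge0// exprn_ge0.
have m1 : measurable_fun setT (fun _ : 'rV[R]_n => 1 : R) by exact: measurable_cst.
have [] := KB r01' L0 m1 (fun=> ler01).
  rewrite (_ : (fun _ => _) = fun w => nearby r w * cst 1 w.1); last first.
    by apply/funext => w /=; rewrite mulr1.
  rewrite inner1//.
  apply: (@le_trans _ _ (E (cst (Lam * (3 * r) ^+ n)))).
    apply: ge0_le_integral; first exact: mX.
    - by move=> x _; rewrite mul1e; apply: integral_ge0 => z _; rewrite lee_fin.
    - apply: emeasurable_funM; first by apply/measurable_EFinP; exact: measurable_cst.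
      have := tonelli_inner_measurable mu mX mX mnear; apply=> *; exact: near0.
    - by apply/measurable_EFinP; exact: measurable_cst.
    - by move=> x _; rewrite mul1e; exact: near_inner.
  by rewrite Ecst lee_fin exprMn mulrA.
move=> _ h _.
apply: (@le_trans _ _ (J (fun w => ((r ^+ n)^-1 * c1) * (expker r w * (1 * 1)))%R)).
  apply: dint_le => //; try by meas.
  move=> x z Xx Xz /=; rewrite !mulr1 mulr_ge0 ?expR_ge0 ?invr_ge0 ?(ltW rn0)//=.
  by rewrite -mulrA ler_pM2l ?invr_gt0//; exact: (@expD_le (x, z) Xx Xz).
rewrite (dintZ mu mX); last 3 first.
- by meas.
- by rewrite mulr_ge0 ?invr_ge0// ltW.
- by move=> x z _ _; rewrite !mulr1.
have c0 : 0 <= (r ^+ n)^-1 * c1 by rewrite mulr_ge0 ?invr_ge0// ltW.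
apply: (@le_trans _ _ (((r ^+ n)^-1 * c1)%:E * (G * (Lam * 3 ^+ n) * r ^+ n)%:E)%E).
  by apply: lee_wpmul2l; rewrite ?lee_fin.
rewrite -EFinM lee_fin /Cq le_eqVlt; apply/orP; left; apply/eqP; field.
by rewrite gt_eqF.
Qed.

Let om x := expR (- ((U x + W x + n%:R * ell) / 2)).
(** [mm] is the geometric mean of [p] and [pt], [al] the scaled asymmetry of the divergence, and [t]
    the logarithm of [pt / p]. *)
Let mm (w : 'rV[R]_n * 'rV[R]_n) := (r ^+ n)^-1 * (om w.1 * om w.2) *
  expR (- ((Dd w.1 w.2 / r ^+ 2 + Dd w.2 w.1 / r ^+ 2) / 2)).
Let al (w : 'rV[R]_n * 'rV[R]_n) := Dd w.1 w.2 / r ^+ 2 - Dd w.2 w.1 / r ^+ 2.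
Let t w := al w + (V w.1 - V w.2).

Let mom : measurable_fun setT om. Proof. by rewrite /om; meas. Qed.
Let om0 x : 0 < om x. Proof. exact: expR_gt0. Qed.
Let mmm : measurable_fun setT mm. Proof. by rewrite /mm; meas. Qed.
Let mm0 w : 0 < mm w.
Proof. by rewrite /mm !mulr_gt0 ?expR_gt0 ?invr_gt0. Qed.

Let mmE w : mm w = expR (- ((Dd w.1 w.2 / r ^+ 2 + Dd w.2 w.1 / r ^+ 2) / 2
  + (U w.1 + W w.1 + U w.2 + W w.2) / 2)).
Proof. by rewrite /mm /om -expell -!expRD; congr expR; field; rewrite gt_eqF. Qed.

Let pE w : p w = mm w * expR (- (t w / 2)).
Proof. by rewrite mmE -expRD /p /wgt /t /al /V; congr expR; field; rewrite gt_eqF. Qed.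

Let ptE w : pt w = mm w * expR (t w / 2).
Proof. by rewrite mmE -expRD /pt /p /wgt /t /al /V /=; congr expR; field; rewrite gt_eqF. Qed.

Let ptB w : pt w - p w = mm w * sh (t w).
Proof. by rewrite ptE pE /sh; ring. Qed.

Let two_mm w : 2 * mm w <= p w + pt w.
Proof.
rewrite pE ptE -mulrDr mulrC ler_pM2l//.
have := expR_ge1Dx (t w / 2); have := expR_ge1Dx (- (t w / 2)); lra.
Qed.

Let Cw := expR K + CN.

(** At distance at most r the Gaussian factor of [mm] is at least exp(-K), so r^-n om(x) om(z) is at
    most exp(K) (p + pt)/2, and [p] and [pt] have mass 1. *)
Let near_om : (J (fun w => nearby r w * (om w.1 * om w.2))%R <= (expR K * r ^+ n)%:E)%E.
Proof.
have eK : 0 < r ^+ n * expR K / 2 by rewrite divr_gt0// mulr_gt0// expR_gt0.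
apply: (@le_trans _ _ (J (fun w => (r ^+ n * expR K / 2) * (p w * cst 1 w.1 + pt w * cst 1 w.1))%R)).
  apply: (dint_le mu mX); [by meas|by meas|].
  move=> x z Xx Xz /=; rewrite mulr_ge0 ?mulr_ge0 ?(ltW (om0 _))//=.
  rewrite !mulr1 /nearby /=; case: (boolP (`|x - z| <= r)) => xz; last first.
    by rewrite mul0r mulr_ge0 ?addr_ge0// ltW.
  rewrite mul1r; apply: (@le_trans _ _ (r ^+ n * expR K / 2 * (2 * mm (x, z)))).
    rewrite /mm /=; set e := expR (- _).
    have : expR (- K) <= e.
      rewrite ler_expR lerN2 ler_pdivrMr// mulr_natr mulr2n.
      have y1 : (`|x - z| / r) ^+ 2 <= 1.
        by rewrite exprn_ile1 ?divr_ge0 ?(ltW r0)// ler_pdivrMr// mul1r.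
      have hK : K * (`|x - z| / r) ^+ 2 <= K by rewrite ger_pMr.
      apply: lerD; apply: (le_trans _ hK).
        exact: (Dscaled_up (w := (x, z))).
      by rewrite distrC; exact: (Dscaled_up (w := (z, x))).
    rewrite expRN => eKe.
    have -> : r ^+ n * expR K / 2 * (2 * ((r ^+ n)^-1 * (om x * om z) * e))
        = om x * om z * (expR K * e) by field; rewrite gt_eqF.
    by rewrite ler_peMr ?mulr_ge0 ?(ltW (om0 _))// -ler_pdivrMl ?expR_gt0// mulr1.
  by rewrite ler_pM2l.
have p1 : forall x, 0 <= cst 1 x :> R by move=> x; exact: ler01.
rewrite (dintZ mu mX); last 3 first.
- by meas.
- exact: ltW.
- by move=> x z _ _ /=; rewrite !mulr1 addr_ge0.
rewrite (dintD mu mX); last 4 first.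
- by meas.
- by meas.
- by move=> x z _ _ /=; rewrite mulr1.
- by move=> x z _ _ /=; rewrite mulr1.
have mc : measurable_fun setT (cst 1 : 'rV[R]_n -> R) by exact: measurable_cst.
rewrite (marg1 mc p1) (margt1 mc p1) Ecst.
by rewrite -EFinD -EFinM lee_fin le_eqVlt; apply/orP; left; apply/eqP; field.
Qed.

Let eK0 : 0 <= expR K. Proof. exact: expR_ge0. Qed.

Let kb_om := KB r01' eK0 mom (fun x => ltW (om0 x)) near_om.

Lemma core_sum :
  (E (fun x => `|U x + W x|%R) <= (n%:R * ell + (Cq + 4 * Cw))%:E)%E /\
  ((n%:R * ell - Cq)%:E <= J (fun w => `|U w.1 + W w.2|%R))%E.
Proof.
have [Up [Un [up [un [[mUp mUn] [Up0 Un0] UE _ [Eup Eun]]]]]] := parts mU iU.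
have [Wp [Wn [wp [wn [[mWp mWn] [Wp0 Wn0] WE _ [Ewp Ewn]]]]]] := parts mW iW.
have nell : 0 <= n%:R * ell by rewrite mulr_ge0.
(* The inequality e^s >= 1 + s with s = U(x) + W(z) + n ell is integrated against p; p e^s is the
   normalized Gaussian, of mass at most [Cq]. *)
have entropy : up + wp + n%:R * ell + 1 <= Cq + un + wn.
  pose a x := Up x + (n%:R * ell + 1).
  have a0 x : 0 <= a x by rewrite addr_ge0// addr_ge0.
  have ma : measurable_fun setT a by rewrite /a; meas.
  have Ea : E a = (up + (n%:R * ell + 1))%:E.
    rewrite /a (ED mUp (measurable_cst (n%:R * ell + 1))) ?Eup ?Ecst//.
    by move=> x /=; rewrite addr_ge0.
  have mq : measurable_fun setT (fun w : 'rV[R]_n * 'rV[R]_n =>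
      (r ^+ n)^-1 * expR (- (Dd w.1 w.2 / r ^+ 2))) by meas.
  have q0 (w : 'rV[R]_n * 'rV[R]_n) : 0 <= (r ^+ n)^-1 * expR (- (Dd w.1 w.2 / r ^+ 2)).
    by rewrite mulr_ge0 ?expR_ge0// invr_ge0 ltW.
  have h : (J (fun w => p w * a w.1 + p w * Wp w.2)%R <=
      J (fun w => ((r ^+ n)^-1 * expR (- (Dd w.1 w.2 / r ^+ 2)))
         + (p w * Un w.1 + p w * Wn w.2))%R)%E.
    apply: (dint_le mu mX); [by meas|by meas|].
    move=> x z Xx Xz /=; apply/andP; split.
      by apply: addr_ge0; apply: mulr_ge0; [exact: p0|exact: a0|exact: p0|exact: Wp0].
    rewrite -!mulrDr -lerBlDr -mulrBr.
    have -> : (r ^+ n)^-1 * expR (- (Dd x z / r ^+ 2)) = p (x, z) * expR (U x + W z + n%:R * ell).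
      by rewrite -expell /p /wgt /= -!expRD; congr expR; ring.
    apply: ler_wpM2l; first exact: p0.
    have := expR_ge1Dx (U x + W z + n%:R * ell).
    by rewrite /a {1}UE {1}WE; lra.
  rewrite (dintD mu mX) in h; last 4 first.
  - by meas.
  - by meas.
  - by move=> x z _ _; apply: mulr_ge0; [exact: p0|exact: a0].
  - by move=> x z _ _; apply: mulr_ge0; [exact: p0|exact: Wp0].
  rewrite (marg1 ma a0) (marg2 mWp Wp0) Ea Ewp in h.
  rewrite (dintD mu mX) in h; last 4 first.
  - by meas.
  - by meas.
  - by move=> x z _ _; exact: q0.
  - by move=> x z _ _; apply: addr_ge0; apply: mulr_ge0;
      [exact: p0|exact: Un0|exact: p0|exact: Wn0].
  rewrite (dintD mu mX) in h; last 4 first.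
  - by meas.
  - by meas.
  - by move=> x z _ _; apply: mulr_ge0; [exact: p0|exact: Un0].
  - by move=> x z _ _; apply: mulr_ge0; [exact: p0|exact: Wn0].
  rewrite (marg1 mUn Un0) (marg2 mWn Wn0) Eun Ewn in h.
  have {}h := le_trans h (leeD gauss_dint (lexx (un%:E + wn%:E)%E)).
  by move: h; rewrite -!EFinD lee_fin; lra.
have E0 h1 : (forall x, 0 <= h1 x) -> (0 <= E h1)%E.
  by move=> h0; apply: integral_ge0 => x _; rewrite lee_fin.
split.
  have [Eom _ _] := kb_om.
  (* With s = U + W this reads |s| <= s + 2 n ell + 4 om: when s < 0, use -(s + n ell) <= 2 om. The
     integral of s is at most [Cq] - n ell by [entropy], which leaves a single n ell. *)
  have h : (E (fun x => `|U x + W x| + (Un x + Wn x))%R <=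
     E (fun x => (Up x + Wp x) + (cst (2 * (n%:R * ell)) x + 4 * om x))%R)%E.
    apply: Ele; [by meas|by meas|].
    move=> x _; apply/andP; split.
      by apply: addr_ge0; [exact: normr_ge0|apply: addr_ge0; [exact: Un0|exact: Wn0]].
    have hs : - (U x + W x + n%:R * ell) <= 2 * om x.
      by have := expR_ge1Dx (- ((U x + W x + n%:R * ell) / 2)); rewrite -/(om x); lra.
    have := om0 x; move: hs; rewrite UE WE /=; move: (om x) (n%:R * ell) nell => o nl nl0.
    have [s0|s0] := leP 0 (Up x - Un x + (Wp x - Wn x)).
      by rewrite ger0_norm//; lra.
    by rewrite ltr0_norm//; lra.
  have c4 : (0 <= 4 * Cw) by rewrite mulr_ge0// addr_ge0 ?expR_ge0// ltW.
  have m4 : measurable_fun setT (fun x => 4 * om x) by meas.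
  have p4 x : 0 <= 4 * om x by rewrite mulr_ge0// ltW.
  have pc x : 0 <= cst (2 * (n%:R * ell)) x :> R by rewrite /= mulr_ge0.
  have mc := @measurable_cst _ _ 'rV[R]_n R setT (2 * (n%:R * ell)).
  have ms : measurable_fun setT (fun x => `|U x + W x|) by meas.
  rewrite ED in h; last 4 first.
  - by meas.
  - by meas.
  - by move=> x; apply: addr_ge0; [exact: Up0|exact: Wp0].
  - by move=> x; apply: addr_ge0; [exact: pc|exact: p4].
  rewrite (ED mUp mWp Up0 Wp0) Eup Ewp (ED mc m4 pc p4) Ecst in h.
  rewrite (EZ mom _ (fun x => ltW (om0 x))) in h; last by [].
  rewrite ED in h; last 4 first.
  - by meas.
  - by meas.
  - by move=> x; exact: normr_ge0.
  - by move=> x; apply: addr_ge0; [exact: Un0|exact: Wn0].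
  rewrite (ED mUn mWn Un0 Wn0) Eun Ewn in h.
  have hO : (4%:E * E om <= (4 * Cw)%:E)%E.
    by rewrite EFinM; apply: lee_wpmul2l; rewrite ?lee_fin.
  have {}h := le_trans h (leeD (lexx _) (leeD (lexx _) hO)).
  have := E0 _ (fun x => normr_ge0 (U x + W x)).
  move: (E (fun x => `|U x + W x|)) h => [e| |] //=.
  by rewrite -!EFinD !lee_fin; lra.
have mUW : measurable_fun setT (fun w : 'rV[R]_n * 'rV[R]_n => `|U w.1 + W w.2|) by meas.
have [J1 J2] : (forall h1, measurable_fun setT h1 -> (forall x, 0 <= h1 x) ->
    J (fun w => h1 w.1) = E h1) /\ (forall h1, measurable_fun setT h1 ->
    (forall x, 0 <= h1 x) -> J (fun w => h1 w.2) = E h1).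
  have m1 : measurable_fun setT (cst 1 : 'rV[R]_n -> R) by exact: measurable_cst.
  split=> h1 mh1 h10.
    have := @dint_prod _ _ mu X mX h1 (cst 1) mh1 m1 h10 (fun=> ler01).
    rewrite -/(E (cst 1)) -/(E h1) Ecst mule1 => <-; congr dint.
    by apply/funext => w /=; rewrite mulr1.
  have := @dint_prod _ _ mu X mX (cst 1) h1 m1 mh1 (fun=> ler01) h10.
  rewrite -/(E (cst 1)) -/(E h1) Ecst mul1e => <-; congr dint.
  by apply/funext => w /=; rewrite mul1r.
(* For the lower bound |U + W| >= -(U + W) suffices, since [entropy] bounds the integral of U + W
   from above. *)
have h : (J (fun w => Un w.1 + Wn w.2)%R <=
    J (fun w => `|U w.1 + W w.2| + (Up w.1 + Wp w.2))%R)%E.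
  apply: (dint_le mu mX); [by meas|by meas|].
  move=> x z Xx Xz /=; rewrite addr_ge0//= UE WE.
  have := lerNnormlW (lexx `|Up x - Un x + (Wp z - Wn z)|).
  by move: `|_| => q; lra.
rewrite (dintD mu mX) in h; last 4 first.
- by meas.
- by meas.
- by move=> x z _ _; exact: Un0.
- by move=> x z _ _; exact: Wn0.
rewrite (J1 _ mUn Un0) (J2 _ mWn Wn0) Eun Ewn in h.
rewrite (dintD mu mX) in h; last 4 first.
- by meas.
- by meas.
- by move=> x z _ _; exact: normr_ge0.
- by move=> x z _ _; apply: addr_ge0; [exact: Up0|exact: Wp0].
rewrite (dintD mu mX) in h; last 4 first.
- by meas.
- by meas.
- by move=> x z _ _; exact: Up0.
- by move=> x z _ _; exact: Wp0.
rewrite (J1 _ mUp Up0) (J2 _ mWp Wp0) Eup Ewp in h.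
have : (0 <= J (fun w => `|U w.1 + W w.2|%R))%E.
  by apply: integral_ge0 => w _; rewrite lee_fin.
move: (J (fun w => `|U w.1 + W w.2|)) h => [e| |]; [|by move=> *; rewrite leey|by []].
by rewrite -!EFinD !lee_fin; lra.
Qed.

(** With y = |x - z|/r this makes eta |al| at most kap y^2 / 2, so a tilt exp((1 + eta)|al|/2) uses
    up only part of the Gaussian in [mm] and leaves exp(-(kap/2) y^2). [th] is the share of the
    dissipation that survives the absorption. *)
Let eta := kap / (2 * K).
Let eta01 : 0 < eta <= 1.
Proof.
rewrite /eta divr_gt0 ?mulr_gt0//= ler_pdivrMr ?mulr_gt0// mul1r.
by have := kapK; have := K0; lra.
Qed.
Let eta1 : 0 < 1 + eta. Proof. by case/andP: eta01 => e0 _; rewrite addr_gt0. Qed.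
Let th := 1 - (1 + eta)^-1.
Let th0 : 0 < th.
Proof.
by rewrite subr_gt0 invf_lt1// ltrDl; case/andP: eta01.
Qed.
Let c6 := 27 * (2 / (kap / 2)) ^+ 3 * expR (2 * (kap / 2))^-1.
Let CR := 2 * K ^+ 2 * c6.
(** This equals (pt - p) log(pt / p). *)
Let dis w := mm w * (sh (t w) * t w).

Let dis0 w : 0 <= dis w.
Proof. by rewrite mulr_ge0 ?sh_mul_ge0// ltW. Qed.

Let mdis : measurable_fun setT dis.
Proof. by rewrite /dis /sh; meas. Qed.

Let c60 : 0 < c6.
Proof.
apply: mulr_gt0; last exact: expR_gt0.
by apply: mulr_gt0 => //; apply: exprn_gt0; rewrite !divr_gt0.
Qed.

Let CR0 : 0 < CR.
Proof.
by apply: mulr_gt0; [apply: mulr_gt0 => //; exact: exprn_gt0|exact: c60].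
Qed.

Let al_le w : X w.1 -> X w.2 -> `|al w| <= K * r * (`|w.1 - w.2| / r) ^+ 3.
Proof.
move=> X1 X2; rewrite /al -mulrBl normrM [`|_^-1|]gtr0_norm ?invr_gt0//.
rewrite ler_pdivrMr// (le_trans (Dasym X1 X2))// le_eqVlt; apply/orP; left; apply/eqP.
by field; rewrite gt_eqF.
Qed.

(** Third-order symmetry gives al^2 <= K^2 r^2 y^6. The factor r^2 is the source of the order eps of
    the dissipation; y^6 is absorbed by the Gaussian. *)
Let tilt_le w : X w.1 -> X w.2 ->
  mm w * (2 * (al w ^+ 2 * expR ((1 + eta) * `|al w| / 2)))
  <= CR * r ^+ 2 * ((r ^+ n)^-1 * (expker r w * (om w.1 * om w.2))).
Proof.
move=> X1 X2; set y := `|w.1 - w.2| / r.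
have y0 : 0 <= y by rewrite divr_ge0// ltW.
have hal := al_le X1 X2; rewrite -/y in hal.
have al2 : al w ^+ 2 <= K ^+ 2 * r ^+ 2 * y ^+ 6.
  rewrite -real_normK ?num_real//.
  have -> : K ^+ 2 * r ^+ 2 * y ^+ 6 = (K * r * y ^+ 3) ^+ 2 by ring.
  by rewrite lerXn2r ?nnegrE// mulr_ge0 ?exprn_ge0// mulr_ge0// ltW.
set D1 := Dd w.1 w.2 / r ^+ 2; set D2 := Dd w.2 w.1 / r ^+ 2.
have y2E : (`|w.2 - w.1| / r) ^+ 2 = y ^+ 2 by rewrite distrC.
have l1 : kap * y ^+ 2 <= D1 by exact: Dscaled_low.
have l2 : kap * y ^+ 2 <= D2 by rewrite -y2E; exact: (@Dscaled_low (w.2, w.1)).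
have u1 : D1 <= K * y ^+ 2 by exact: Dscaled_up.
have u2 : D2 <= K * y ^+ 2 by rewrite -y2E; exact: (@Dscaled_up (w.2, w.1)).
have ky : 0 <= kap * y ^+ 2 by rewrite mulr_ge0 ?sqr_ge0// ltW.
have ex : - ((D1 + D2) / 2) + (1 + eta) * `|al w| / 2 <= - (kap / 2 * y ^+ 2).
  have e1 : eta * `|al w| <= kap * y ^+ 2 / 2.
    have : `|al w| <= K * y ^+ 2.
      by rewrite /al -/D1 -/D2 ler_norml; apply/andP; split; lra.
    case/andP: eta01 => e0 _ => h; rewrite (le_trans (ler_wpM2l (ltW e0) h))//.
    rewrite le_eqVlt; apply/orP; left; apply/eqP; rewrite /eta; field.
    by rewrite gt_eqF.
  have e2 : `|al w| <= D1 + D2 - 2 * (kap * y ^+ 2).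
    by rewrite /al -/D1 -/D2 ler_norml; apply/andP; split; lra.
  have -> : (1 + eta) * `|al w| / 2 = `|al w| / 2 + eta * `|al w| / 2 by ring.
  have -> : kap / 2 * y ^+ 2 = kap * y ^+ 2 / 2 by ring.
  by move: (eta * `|al w|) e1 => u; lra.
have kap20 : 0 < kap / 2 by rewrite divr_gt0.
have hg := pow6_gaussian_le y kap20; rewrite -/c6 in hg.
pose q := (r ^+ n)^-1 * (om w.1 * om w.2).
have q0 : 0 <= q by rewrite mulr_ge0 ?invr_ge0 ?mulr_ge0// ltW.
have -> : mm w * (2 * (al w ^+ 2 * expR ((1 + eta) * `|al w| / 2)))
   = 2 * q * (al w ^+ 2 * expR (- ((D1 + D2) / 2) + (1 + eta) * `|al w| / 2)).
  by rewrite expRD /mm -/q -/D1 -/D2; ring.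
have -> : CR * r ^+ 2 * ((r ^+ n)^-1 * (expker r w * (om w.1 * om w.2)))
   = 2 * q * ((K ^+ 2 * r ^+ 2) * (c6 * expR (- y))).
  by rewrite /CR /q /expker -/y; ring.
apply: ler_wpM2l; first by rewrite mulr_ge0.
apply: (@le_trans _ _ (K ^+ 2 * r ^+ 2 * (y ^+ 6 * expR (- (kap / 2 * y ^+ 2))))).
  by rewrite mulrA ler_pM ?sqr_ge0 ?expR_ge0// ler_expR.
by rewrite ler_wpM2l// mulr_ge0 ?sqr_ge0.
Qed.

Let Jsplit h1 h2 h3 h4 e1 e2 e3 e4 :
  [/\ measurable_fun setT h1, measurable_fun setT h2, measurable_fun setT h3
    & measurable_fun setT h4] ->
  [/\ forall x, 0 <= h1 x, forall x, 0 <= h2 x, forall x, 0 <= h3 x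
    & forall x, 0 <= h4 x] ->
  [/\ E h1 = e1%:E, E h2 = e2%:E, E h3 = e3%:E & E h4 = e4%:E] ->
  J (fun w => pt w * h1 w.1 + pt w * h2 w.2 + (p w * h3 w.1 + p w * h4 w.2))%R
  = (e1 + e2 + (e3 + e4))%:E.
Proof.
move=> [m1 m2 m3 m4] [h10 h20 h30 h40] [E1 E2 E3 E4].
have a1 : measurable_fun setT (fun w => pt w * h1 w.1) by meas.
have a2 : measurable_fun setT (fun w => pt w * h2 w.2) by meas.
have a3 : measurable_fun setT (fun w => p w * h3 w.1) by meas.
have a4 : measurable_fun setT (fun w => p w * h4 w.2) by meas.
have n1 x z : X x -> X z -> 0 <= pt (x, z) * h1 (x, z).1.
  by move=> _ _; apply: mulr_ge0; [exact: pt0|exact: h10].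
have n2 x z : X x -> X z -> 0 <= pt (x, z) * h2 (x, z).2.
  by move=> _ _; apply: mulr_ge0; [exact: pt0|exact: h20].
have n3 x z : X x -> X z -> 0 <= p (x, z) * h3 (x, z).1.
  by move=> _ _; apply: mulr_ge0; [exact: p0|exact: h30].
have n4 x z : X x -> X z -> 0 <= p (x, z) * h4 (x, z).2.
  by move=> _ _; apply: mulr_ge0; [exact: p0|exact: h40].
rewrite (dintD mu mX (F := fun w => pt w * h1 w.1 + pt w * h2 w.2)
  (H := fun w => p w * h3 w.1 + p w * h4 w.2)); last 4 first.
- exact: measurable_funD.
- exact: measurable_funD.
- by move=> x z Xx Xz; apply: addr_ge0; [exact: n1|exact: n2].
- by move=> x z Xx Xz; apply: addr_ge0; [exact: n3|exact: n4].
rewrite (dintD mu mX a1 a2 n1 n2) (dintD mu mX a3 a4 n3 n4).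
by rewrite (margt1 m1 h10) (margt2 m2 h20) (marg1 m3 h30) (marg2 m4 h40) E1 E2 E3 E4 !EFinD.
Qed.

Let Ceta := th^-1 * (CR * (G * expR K)).

(* The antisymmetric part of [p] is orthogonal to differences [V x - V z], both
   marginals being equal: this is what bounds the dissipation. *)
Let dissipation : (J dis <= (Ceta * r ^+ 2)%:E)%E.
Proof.
have iV : (E (fun x => `|V x|%R) < +oo)%E.
  apply: (@le_lt_trans _ _ (E (fun x => (`|U x| + `|W x|)%R))).
    by apply: Ele; [meas|meas|move=> x _; rewrite normr_ge0 ler_normB].
  rewrite ED; [|by meas|by meas|by move=> x|by move=> x].
  by rewrite lte_add_pinfty.
have [Vp [Vn [vp [vn [[mVp mVn] [Vp0 Vn0] VE _ [Evp Evn]]]]]] := parts mV iV.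
have mker : measurable_fun setT (fun w : 'rV[R]_n * 'rV[R]_n => expker r w * (om w.1 * om w.2)).
  by meas.
pose c := CR * r ^+ 2 * (r ^+ n)^-1.
have c0 : 0 <= c by apply: mulr_ge0; [apply: mulr_ge0; [exact: ltW|exact: sqr_ge0]|rewrite invr_ge0; exact: ltW].
have k0 (w : 'rV[R]_n * 'rV[R]_n) : 0 <= expker r w * (om w.1 * om w.2).
  by rewrite mulr_ge0 ?expR_ge0// mulr_ge0// ltW.
have br0 (h1 h2 h3 h4 : 'rV[R]_n -> R) : (forall x, 0 <= h1 x) -> (forall x, 0 <= h2 x) ->
    (forall x, 0 <= h3 x) -> (forall x, 0 <= h4 x) -> forall w,
    0 <= pt w * h1 w.1 + pt w * h2 w.2 + (p w * h3 w.1 + p w * h4 w.2).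
  move=> h10 h20 h30 h40 w.
  by apply: addr_ge0; apply: addr_ge0; apply: mulr_ge0.
(* The antisymmetric term is spread over both sides as nonnegative pieces. By [Jsplit] the added
   pieces have the same finite integral on each side, so they cancel. *)
have h : (J (fun w => th * dis w + (pt w * Vn w.1 + pt w * Vp w.2 + (p w * Vp w.1 + p w * Vn w.2)))%R
   <= J (fun w => c * (expker r w * (om w.1 * om w.2)) +
     (pt w * Vp w.1 + pt w * Vn w.2 + (p w * Vn w.1 + p w * Vp w.2)))%R)%E.
  apply: (dint_le mu mX); [by meas|by meas|].
  move=> x z Xx Xz; apply/andP; split.
    apply: addr_ge0; first by apply: mulr_ge0; [exact: ltW|exact: dis0].
    exact: br0.
  set w := (x, z).
  have hR : mm w * (2 * (al w ^+ 2 * expR ((1 + eta) * `|al w| / 2)))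
      <= c * (expker r w * (om w.1 * om w.2)).
    by rewrite (le_trans (@tilt_le w Xx Xz))// /c !mulrA.
  have hA := sh_absorb (t w) (al w) eta01.
  have {}hA : mm w * (sh (t w) * al w) <= (1 + eta)^-1 * dis w
      + mm w * (2 * (al w ^+ 2 * expR ((1 + eta) * `|al w| / 2))).
    rewrite [leRHS](_ : _ = mm w * ((1 + eta)^-1 * (sh (t w) * t w)
      + 2 * (al w ^+ 2 * expR ((1 + eta) * `|al w| / 2)))); last by rewrite /dis; ring.
    by apply: ler_wpM2l => //; exact: ltW.
  (* Since t = al + V(x) - V(z), one factor t of [dis] is split: the first part is absorbed by
     [sh_absorb], the second integrates to zero. *)
  have hB : dis w = mm w * (sh (t w) * al w) + (pt w - p w) * (V w.1 - V w.2).
    by rewrite ptB /dis {2}/t; ring.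
  have hV : (pt w - p w) * (V w.1 - V w.2)
      = (pt w * Vp w.1 + pt w * Vn w.2 + (p w * Vn w.1 + p w * Vp w.2))
      - (pt w * Vn w.1 + pt w * Vp w.2 + (p w * Vp w.1 + p w * Vn w.2)).
    by rewrite !VE; ring.
  have -> : th * dis w = dis w - (1 + eta)^-1 * dis w by rewrite /th; ring.
  move: hA hB hR; rewrite hV.
  move: (mm w * (sh (t w) * al w)) (mm w * (2 * _)) ((1 + eta)^-1 * dis w) (dis w).
  move: (c * _) (pt w * Vp w.1 + _) (pt w * Vn w.1 + _) => q1 q2 q3 q4 q5 q6 q7.
  by lra.
rewrite (dintD mu mX (F := fun w => th * dis w)) in h; last 4 first.
- by meas.
- by meas.
- by move=> x z _ _; apply: mulr_ge0; [exact: ltW|exact: dis0].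
- by move=> x z _ _; exact: br0.
rewrite (Jsplit (And4 mVn mVp mVp mVn) (And4 Vn0 Vp0 Vp0 Vn0) (And4 Evn Evp Evp Evn)) in h.
rewrite (dintD mu mX (F := fun w => c * (expker r w * (om w.1 * om w.2)))) in h; last 4 first.
- by meas.
- by meas.
- by move=> x z _ _; apply: mulr_ge0; [exact: c0|exact: k0].
- by move=> x z _ _; exact: br0.
rewrite (Jsplit (And4 mVp mVn mVn mVp) (And4 Vp0 Vn0 Vn0 Vp0) (And4 Evp Evn Evn Evp)) in h.
rewrite (dintZ mu mX mdis (ltW th0)) in h; last by move=> x z _ _; exact: dis0.
rewrite (dintZ mu mX mker c0) in h; last by move=> x z _ _; exact: k0.
have [_ hker _] := kb_om.
have hc : (c%:E * J (fun w => expker r w * (om w.1 * om w.2))%R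
    <= (CR * (G * expR K) * r ^+ 2)%:E)%E.
  have -> : (CR * (G * expR K) * r ^+ 2)%:E = (c%:E * (G * expR K * r ^+ n)%:E)%E :> \bar R.
    by rewrite -EFinM /c; congr EFin; field; rewrite gt_eqF.
  by apply: lee_wpmul2l; rewrite ?lee_fin.
have {}h := le_trans h (leeD hc (lexx _)).
have : (0 <= J dis)%E by apply: integral_ge0 => w _; rewrite lee_fin.
(* Finiteness of the dissipation is not known beforehand; the value +oo is excluded here because the
   other side is finite. *)
move: (J dis) h => [e| |]; [|by rewrite mulry gtr0_sg// mul1e|by []].
rewrite -EFinM -!EFinD !lee_fin => h _.
rewrite (_ : Ceta * r ^+ 2 = CR * (G * expR K) * r ^+ 2 / th); last by rewrite /Ceta; ring.
rewrite ler_pdivlMr// [e * th]mulrC.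
by move: (CR * (G * expR K) * r ^+ 2) (th * e) h => u v; lra.
Qed.

(** * Bounds on 1/om where little dissipation occurs *)

Let e x := (\int[mu]_(z in X) (dis (x, z))%:E)%E.

Let me : measurable_fun X e.
Proof.
by have := tonelli_inner_measurable mu mX mX mdis; apply=> x z _ _; exact: dis0.
Qed.

Let e0 x : (0 <= e x)%E.
Proof. by apply: integral_ge0 => z _; rewrite lee_fin. Qed.

Let Ee : (\int[mu]_(x in X) e x = J dis)%E.
Proof. by rewrite /dint (tonelli_in mu mu mX mX mdis)// => x z _ _; exact: dis0. Qed.

(* Points at which little dissipation occurs; there [p] is comparable with its
   symmetrization [mm]. *)
Let Y := X `&` e @^-1` [set` `]-oo, (3^-1)%:E]%E].

Let mY : measurable Y.
Proof. by apply: me => //; exact: emeasurable_itv. Qed.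

Let YX : Y `<=` X. Proof. by move=> x []. Qed.

Let YE x : X x -> ~ Y x -> ((3^-1)%:E <= e x)%E.
Proof.
move=> Xx nY; rewrite leNgt; apply/negP => h; apply: nY; split=> //=.
by rewrite in_itv/= ltW.
Qed.

Let Yle x : Y x -> (e x <= (3^-1)%:E)%E.
Proof. by case=> _; rewrite /= in_itv. Qed.

Let b : 'rV[R]_n -> R := \1_(X `\` Y).
Let mXY : measurable (X `\` Y). Proof. exact: measurableD. Qed.
Let mb : measurable_fun setT b. Proof. exact: measurable_indic. Qed.
Let b0 x : 0 <= b x. Proof. by rewrite /b indicE. Qed.

(** Markov's inequality at level 1/3: the exceptional set has measure O(r^2). *)
Let Eb : (E b <= (3 * (Ceta * r ^+ 2))%:E)%E.
Proof.
apply: (@le_trans _ _ (3%:E * J dis)%E); last first.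
  by rewrite EFinM; apply: lee_wpmul2l; [rewrite lee_fin|exact: dissipation].
rewrite -Ee -ge0_integralZl; last 4 first.
- exact: mX.
- exact: me.
- by move=> x _; exact: e0.
- by rewrite lee_fin.
apply: ge0_le_integral; first exact: mX.
- by move=> x _; rewrite lee_fin.
- exact: mEX.
- by apply: measurable_funeM; exact: me.
move=> x Xx; rewrite /b indicE; case: (boolP (x \in X `\` Y)) => [|_].
  rewrite inE => -[_ nY]; apply: (@le_trans _ _ (3%:E * (3^-1)%:E)%E).
    by rewrite -EFinM lee_fin divff.
  by apply: lee_wpmul2l; [rewrite lee_fin|exact: YE].
by apply: mule_ge0; [rewrite lee_fin|exact: e0].
Qed.

Let ho x := expR ((U x + W x + n%:R * ell) / 2).
Let mho : measurable_fun setT ho. Proof. by rewrite /ho; meas. Qed.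
Let ho0 x : 0 <= ho x. Proof. exact: expR_ge0. Qed.
Let hoom x : ho x * om x = 1.
Proof. by rewrite /ho /om -expRD subrr expR0. Qed.

Let mmle w : X w.1 -> X w.2 ->
  mm w <= (r ^+ n)^-1 * c1 * om w.1 * (expker r w * om w.2).
Proof.
move=> X1 X2; rewrite [leRHS](_ : _ = (r ^+ n)^-1 * (om w.1 * om w.2) * (c1 * expker r w)); last by ring.
apply: ler_wpM2l; first by apply: mulr_ge0; [rewrite invr_ge0 ltW|apply: mulr_ge0; exact: ltW].
apply: (le_trans _ (expR_gaussian_le _ kap0)).
rewrite ler_expR lerN2.
have l1 := Dscaled_low X1 X2; have l2 := @Dscaled_low (w.2, w.1) X2 X1.
by rewrite /= distrC in l2; lra.
Qed.

(** At such x, 2 is the integral of p + pt, which [ch_le_sh] bounds by three times the integral of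
    [mm] plus 3 e(x) <= 1. So [mm] has integral at least 1/3, and dividing by om(x) bounds 1/om(x)
    by a potential of [om]. *)
Let Ylow x : Y x -> ((ho x)%:E <= (3 * ((r ^+ n)^-1 * c1))%:E *
  \int[mu]_(z in X) (expker r (x, z) * om z)%R%:E)%E.
Proof.
move=> Yx; have Xx := YX Yx.
pose I := (\int[mu]_(z in X) (expker r (x, z) * om z)%R%:E)%E; rewrite -/I.
pose I1 := (\int[mu]_(z in X) (mm (x, z))%:E)%E.
have mI : measurable_fun setT (fun z => expker r (x, z) * om z).
  by apply: measurable_funM => //; exact: (measurable_fun_pair2 x mexpker).
have mmx : measurable_fun setT (fun z => mm (x, z)) by exact: (measurable_fun_pair2 x mmm).
have mdx : measurable_fun setT (fun z => dis (x, z)) by exact: (measurable_fun_pair2 x mdis).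
have mpx : measurable_fun setT (fun z => p (x, z)) by exact: (measurable_fun_pair2 x mp).
have mptx : measurable_fun setT (fun z => pt (x, z)) by exact: (measurable_fun_pair2 x mpt).
have I10 : (0 <= I1)%E by apply: integral_ge0 => z _; rewrite lee_fin ltW.
have h1 : (1%:E + 1%:E <= 3%:E * I1 + 3%:E * e x)%E.
  have -> : (1%:E + 1%:E = \int[mu]_(z in X) (p (x, z) + pt (x, z))%:E)%E.
    by rewrite -[X in (X + _)%E](hp1 Xx) -(hp2 Xx) -/(E (fun z => p (x, z)))
      -/(E (fun z => pt (x, z))) -ED.
  have -> : (3%:E * I1 + 3%:E * e x
      = \int[mu]_(z in X) (3 * mm (x, z) + 3 * dis (x, z))%:E)%E.
    rewrite -/(E (fun z => 3 * mm (x, z) + 3 * dis (x, z))) ED.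
    - rewrite (EZ mmx)//; last by move=> z; exact: ltW.
      by rewrite (EZ mdx)// => z; exact: dis0.
    - by meas.
    - by meas.
    - by move=> z; apply: mulr_ge0 => //; exact: ltW.
    - by move=> z; apply: mulr_ge0 => //; exact: dis0.
  apply: Ele; [by meas|by meas|].
  move=> z Xz; rewrite addr_ge0//= pE ptE /dis -mulrDr addrC.
  rewrite [leRHS](_ : _ = mm (x, z) * (3 + 3 * (sh (t (x, z)) * t (x, z)))); last by ring.
  by rewrite addrC; apply: ler_wpM2l; [exact: ltW|rewrite [leLHS]addrC; exact: ch_le_sh].
have h2 : (1%:E <= 3%:E * I1)%E.
  have h3 : (3%:E * e x <= 1%:E)%E.
    rewrite (_ : 1%:E = 3%:E * (3^-1)%:E)%E; last by rewrite -EFinM divff.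
    by apply: lee_wpmul2l; [rewrite lee_fin|exact: Yle].
  have := le_trans h1 (leeD (lexx _) h3).
  by rewrite leeD2rE.
have I0 : (0 <= I)%E by apply: integral_ge0 => z _; rewrite lee_fin mulr_ge0 ?expR_ge0.
have c20 : 0 <= (r ^+ n)^-1 * c1 * om x.
  by apply: mulr_ge0; [apply: mulr_ge0; [rewrite invr_ge0|]|]; exact: ltW.
have h4 : (I1 <= ((r ^+ n)^-1 * c1 * om x)%:E * I)%E.
  rewrite /I -ge0_integralZl; last 4 first.
  - exact: mX.
  - exact: mEX.
  - by move=> z _; rewrite lee_fin mulr_ge0 ?expR_ge0.
  - by rewrite lee_fin.
  apply: ge0_le_integral; first exact: mX.
  - by move=> z _; rewrite lee_fin ltW.
  - exact: mEX.
  - by apply: measurable_funeM; exact: mEX.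
  by move=> z Xz; rewrite -EFinM lee_fin; exact: (@mmle (x, z) Xx Xz).
have h5 : (1%:E <= (3 * ((r ^+ n)^-1 * c1 * om x))%:E * I)%E.
  apply: (le_trans h2); rewrite (EFinM 3) -muleA.
  by apply: lee_wpmul2l; [rewrite lee_fin|exact: h4].
have -> : ((3 * ((r ^+ n)^-1 * c1))%:E * I = (ho x)%:E * ((3 * ((r ^+ n)^-1 * c1 * om x))%:E * I))%E.
  rewrite muleA -EFinM; congr (_%:E * _)%E.
  transitivity (3 * ((r ^+ n)^-1 * c1) * (ho x * om x)); last by ring.
  by rewrite hoom mulr1.
by rewrite -{1}[(ho x)%:E]mule1; apply: lee_wpmul2l; [rewrite lee_fin|exact: h5].
Qed.

Let Cg := Lam * G ^+ 2 * expR K * (3 * c1) ^+ 2.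
Let g : 'rV[R]_n -> R := fun x => \1_Y x * ho x ^+ 2.
Let mg : measurable_fun setT g.
Proof. by apply: measurable_funM; [exact: measurable_indic|exact: measurable_funX]. Qed.
Let g0 x : 0 <= g x. Proof. by rewrite /g mulr_ge0 ?sqr_ge0. Qed.

(** The third clause of [kernel_bounded] turns the pointwise bound [Ylow] into an L^2 bound on 1/om;
    the powers of r cancel. *)
Let Eg : (E g <= Cg%:E)%E.
Proof.
have [_ _ kb3] := kb_om.
have c30 : 0 <= 3 * ((r ^+ n)^-1 * c1).
  by apply: mulr_ge0 => //; apply: mulr_ge0; [rewrite invr_ge0|]; exact: ltW.
have := kb3 _ Y ho c30 mY YX mho ho0 Ylow.
have -> : (\int[mu]_(x in Y) (ho x ^+ 2)%:E = E g)%E.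
  rewrite /E integral_mkcond [RHS]integral_mkcond; apply: eq_integral => x _.
  rewrite !patchE /g indicE; case: (boolP (x \in Y)) => [xY|_].
    by rewrite mul1r ifT// inE; apply: YX; rewrite inE in xY.
  by rewrite mul0r; case: ifP.
move=> /le_trans; apply; rewrite lee_fin /Cg le_eqVlt; apply/orP; left; apply/eqP.
by field; rewrite gt_eqF.
Qed.

(** Two functions of mass 1 with F1 <= e^u F2 force u >= 0. Applied to the kernel at two base
    points, it gives [U] and [W] the Lipschitz constant of the cost divided by r^2. *)
Let lip_aux (u : R) (F1 F2 : 'rV[R]_n -> R) : measurable_fun setT F1 ->
  measurable_fun setT F2 -> (forall z, 0 <= F1 z) -> (forall z, 0 <= F2 z) ->
  E F1 = 1%E -> E F2 = 1%E -> (forall z, X z -> F1 z <= expR u * F2 z) -> 0 <= u.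
Proof.
move=> m1 m2 F10 F20 E1 E2 h.
have : (E F1 <= E (fun z => (expR u * F2 z)%R))%E.
  by apply: Ele; [exact: m1|by meas|move=> z Xz; rewrite F10 h].
by rewrite EZ// E1 E2 mule1 lee_fin -{1}expR0 ler_expR.
Qed.

Let Ulip x x' : X x -> X x' -> U x' - U x <= K * `|x - x'| / r ^+ 2.
Proof.
move=> Xx Xx'; rewrite -subr_ge0.
apply: (lip_aux (F1 := fun z => p (x', z)) (F2 := fun z => p (x, z))).
- exact: (measurable_fun_pair2 x' mp).
- exact: (measurable_fun_pair2 x mp).
- by move=> z; exact: p0.
- by move=> z; exact: p0.
- exact: hp1.
- exact: hp1.
move=> z Xz; rewrite /p /wgt /= -expRD ler_expR.
have := Dlip1 Xx Xx' Xz; rewrite -(@ler_pM2r _ (r ^+ 2)^-1) ?invr_gt0// mulrBl.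
by lra.
Qed.

Let Wlip z z' : X z -> X z' -> W z' - W z <= K * `|z - z'| / r ^+ 2.
Proof.
move=> Xz Xz'; rewrite -subr_ge0.
apply: (lip_aux (F1 := fun x => p (x, z')) (F2 := fun x => p (x, z))).
- exact: (measurable_fun_pair1 z' mp).
- exact: (measurable_fun_pair1 z mp).
- by move=> x; exact: p0.
- by move=> x; exact: p0.
- exact: hp2.
- exact: hp2.
move=> x Xx; rewrite /p /wgt /= -expRD ler_expR.
have := Dlip2 Xx Xz Xz'; rewrite -(@ler_pM2r _ (r ^+ 2)^-1) ?invr_gt0// mulrBl.
by lra.
Qed.

(** Too weak for typical pairs, but needed only for pairs with a point outside [Y], where the
    measure O(r^2) from [Eb] compensates it. *)
Let Vlip x z : X x -> X z -> `|x - z| <= r -> `|V x - V z| <= 2 * K / r.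
Proof.
move=> Xx Xz xz.
have h : K * `|x - z| / r ^+ 2 <= K / r.
  rewrite ler_pdivrMr// (_ : K / r * r ^+ 2 = K * r); last by field; rewrite gt_eqF.
  by rewrite ler_pM2l.
have h' : K * `|z - x| / r ^+ 2 <= K / r by rewrite distrC.
have := Ulip Xx Xz; have := Ulip Xz Xx; have := Wlip Xx Xz; have := Wlip Xz Xx.
move=> /le_trans/(_ h') w1 /le_trans/(_ h) w2 /le_trans/(_ h') w3 /le_trans/(_ h) w4.
by rewrite /V -mulrA ler_norml; apply/andP; split; lra.
Qed.

Let Cu := expR K * Cg / 4 + K / 2 + 6 * K * Ceta.
Let Cd := Ceta + 2 * Lam * 3 ^+ n * Cu.
(** The weight in Young's inequality: k times the dissipation is O(r^(n+1)), and 1/(k mm) is at most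
    r exp(K) / (om(x) om(z)), of order r on each pair and hence r^(n+1) after integration over near
    pairs. *)
Let k := r ^+ n / r.
Let k0 : 0 < k. Proof. by rewrite divr_gt0. Qed.
(** A majorant in one variable: |V x - V z| <= k dis(x,z) + u(x) + u(z) at distance at most r. The
    term in [b] pays for exceptional points with the bound of [Vlip]. *)
Let u x := (r * expR K / 4) * g x + (K * r / 2 + (2 * K / r) * b x).

Let good_le x z : Y x -> Y z -> `|x - z| <= r ->
  `|V x - V z| <= k * dis (x, z) + (r * expR K / 4) * (ho x ^+ 2 + ho z ^+ 2) + K * r.
Proof.
move=> Yx Yz xz; have Xx := YX Yx; have Xz := YX Yz; set w := (x, z).
have y0 : 0 <= `|x - z| / r by rewrite divr_ge0// ltW.
have y1 : `|x - z| / r <= 1 by rewrite ler_pdivrMr// mul1r.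
have hal : `|al w| <= K * r.
  rewrite (le_trans (@al_le w Xx Xz))// ger_pMr ?mulr_gt0// exprn_ile1//.
have tE : V x - V z = t w - al w by rewrite /t /=; ring.
rewrite tE (le_trans (ler_normB _ _))// lerD//.
have mw := mm0 w.
have hinv : (mm w)^-1 <= r ^+ n * expR K * ((ho x ^+ 2 + ho z ^+ 2) / 2).
  have hx := hoom x; have hz := hoom z.
  have ox := om0 x; have oz := om0 z.
  have -> : (mm w)^-1 = r ^+ n * (ho x * ho z) * expR ((Dd x z / r ^+ 2 + Dd z x / r ^+ 2) / 2).
    apply: (@mulIf _ (mm w)); first by rewrite gt_eqF.
    rewrite mulVf ?gt_eqF// /mm /= expRN.
    set ee := expR _.
    have eN : ee * ee^-1 = 1 by rewrite mulfV// gt_eqF// expR_gt0.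
    have rN : r ^+ n * (r ^+ n)^-1 = 1 by rewrite mulfV// gt_eqF.
    transitivity ((r ^+ n * (r ^+ n)^-1) * ((ho x * om x) * (ho z * om z)) * (ee * ee^-1)).
      by rewrite hx hz eN rN !mulr1.
    by ring.
  have hD : expR ((Dd x z / r ^+ 2 + Dd z x / r ^+ 2) / 2) <= expR K.
    rewrite ler_expR ler_pdivrMr// mulr_natr mulr2n.
    have y2 : (`|x - z| / r) ^+ 2 <= 1 by rewrite exprn_ile1.
    have hK : K * (`|x - z| / r) ^+ 2 <= K by rewrite ger_pMr.
    apply: lerD; apply: (le_trans _ hK); first exact: (@Dscaled_up w).
    by rewrite distrC; exact: (@Dscaled_up (z, x)).
  have hh : ho x * ho z <= (ho x ^+ 2 + ho z ^+ 2) / 2.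
    have := sqr_ge0 (ho x - ho z); rewrite sqrrB -[_ *+ 2]mulr_natl.
    by move: (ho x ^+ 2) (ho z ^+ 2) (ho x * ho z) => ? ? ?; lra.
  apply: (@le_trans _ _ (r ^+ n * (ho x * ho z) * expR K)).
    by apply: ler_wpM2l => //; apply: mulr_ge0; [exact: ltW|apply: mulr_ge0].
  rewrite [leLHS](_ : _ = r ^+ n * expR K * (ho x * ho z)); last by ring.
  by apply: ler_wpM2l => //; apply: mulr_ge0; [exact: ltW|exact: expR_ge0].
(* From 2 s <= s^2 + 1 with s = k mm |t|, divided by 2 k mm. *)
have young : `|t w| <= k * (mm w * t w ^+ 2) / 2 + (k * mm w)^-1 / 2.
  have km : 0 < k * mm w by rewrite mulr_gt0.
  rewrite -subr_ge0 -(pmulr_rge0 _ km).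
  have -> : k * mm w * (k * (mm w * t w ^+ 2) / 2 + (k * mm w)^-1 / 2 - `|t w|)
      = (k * mm w * `|t w| - 1) ^+ 2 / 2.
    by rewrite -(real_normK (num_real (t w))); field; rewrite !gt_eqF.
  by rewrite divr_ge0 ?sqr_ge0.
apply: (le_trans young); apply: lerD.
  rewrite -mulrA ler_pM2l//.
  have : mm w * t w ^+ 2 <= 2 * dis w.
    rewrite (_ : 2 * dis w = mm w * (2 * (sh (t w) * t w))); last by rewrite /dis; ring.
    by rewrite ler_pM2l// sqr_le_sh_mul.
  by move: (mm w * t w ^+ 2) (dis w) => q1 q2; lra.
have -> : (k * mm w)^-1 / 2 = r / r ^+ n / 2 * (mm w)^-1.
  by rewrite /k; field; rewrite !gt_eqF.
have -> : r * expR K / 4 * (ho x ^+ 2 + ho z ^+ 2)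
    = r / r ^+ n / 2 * (r ^+ n * expR K * ((ho x ^+ 2 + ho z ^+ 2) / 2)).
  by field; rewrite gt_eqF.
by apply: ler_wpM2l => //; rewrite !mulr_ge0 ?invr_ge0// ltW.
Qed.

Lemma core_diff :
  (J (fun w => nearby r w * `|U w.1 - W w.1 - (U w.2 - W w.2)|)%R <= (Cd * r ^+ n.+1)%:E)%E.
Proof.
have mu_ : measurable_fun setT u by rewrite /u; meas.
have a10 : 0 <= r * expR K / 4 by rewrite divr_ge0// mulr_ge0 ?expR_ge0// ltW.
have a20 : 0 <= K * r / 2 by rewrite divr_ge0// mulr_ge0// ltW.
have a30 : 0 <= 2 * K / r by rewrite divr_ge0// ?mulr_ge0// ltW.
have u0 x : 0 <= u x.
  by apply: addr_ge0; [|apply: addr_ge0 => //]; apply: mulr_ge0.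
have Eu : (E u <= (r * Cu)%:E)%E.
  have mA : measurable_fun setT (fun x => (r * expR K / 4) * g x) by meas.
  have mB : measurable_fun setT (fun x => (2 * K / r) * b x) by meas.
  have mC : measurable_fun setT (fun x => cst (K * r / 2) x + (2 * K / r) * b x) by meas.
  have nA x : 0 <= (r * expR K / 4) * g x by apply: mulr_ge0.
  have nB x : 0 <= (2 * K / r) * b x by apply: mulr_ge0.
  have nC x : 0 <= cst (K * r / 2) x + (2 * K / r) * b x by apply: addr_ge0.
  have mc := @measurable_cst _ _ 'rV[R]_n R setT (K * r / 2).
  rewrite /u (ED mA mC nA nC) (EZ mg a10 g0) (ED mc mB (fun=> a20) nB) Ecst (EZ mb a30 b0).
  have -> : r * Cu = r * expR K / 4 * Cg + (K * r / 2 + 2 * K / r * (3 * (Ceta * r ^+ 2))).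
    by rewrite /Cu; field; rewrite gt_eqF.
  rewrite !EFinD; apply: leeD.
    by rewrite (EFinM (r * expR K / 4)); apply: lee_wpmul2l; rewrite ?lee_fin.
  apply: leeD => //.
  by rewrite (EFinM (2 * K / r)); apply: lee_wpmul2l; rewrite ?lee_fin.
have mbd : measurable_fun setT (fun w : 'rV[R]_n * 'rV[R]_n => nearby r w * (u w.1 + u w.2)).
  by meas.
have mVV : measurable_fun setT (fun w : 'rV[R]_n * 'rV[R]_n =>
    nearby r w * `|V w.1 - V w.2|) by meas.
apply: (@le_trans _ _ (J (fun w => k * dis w + nearby r w * (u w.1 + u w.2)))%R).
  apply: (dint_le mu mX); [exact: mVV|by meas|].
  move=> x z Xx Xz /=; rewrite mulr_ge0//= /nearby /=.
  case: (boolP (`|x - z| <= r)) => xz; last first.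
    by rewrite !mul0r addr0; apply: mulr_ge0; [exact: ltW|exact: dis0].
  rewrite !mul1r -/(V x) -/(V z).
  have kd : 0 <= k * dis (x, z) by apply: mulr_ge0; [exact: ltW|exact: dis0].
  have bb : ~ (Y x /\ Y z) -> 1 <= b x + b z.
    move=> nYY; have [Yx|nYx] := pselect (Y x); last first.
      by rewrite {1}/b indicE mem_set//= lerDl.
    have nYz : ~ Y z by move=> Yz; exact: nYY.
    by rewrite {2}/b indicE [z \in _]mem_set//= lerDr.
  have uE : u x + u z = (r * expR K / 4) * (g x + g z) + K * r + 2 * K / r * (b x + b z).
    by rewrite /u; field; rewrite gt_eqF.
  rewrite uE.
  have [[Yx Yz]|nYY] := pselect (Y x /\ Y z).
    have gx : g x = ho x ^+ 2 by rewrite /g indicE mem_set// mul1r.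
    have gz : g z = ho z ^+ 2 by rewrite /g indicE mem_set// mul1r.
    rewrite gx gz !addrA ler_wpDr//; last exact: good_le.
    by apply: mulr_ge0 => //; exact: addr_ge0.
  apply: (le_trans (Vlip Xx Xz xz)).
  rewrite ler_wpDl// ler_wpDl//.
    apply: addr_ge0; last by rewrite mulr_ge0// ltW.
    by apply: mulr_ge0 => //; exact: addr_ge0.
  by rewrite ler_peMr// bb.
rewrite (dintD mu mX (F := fun w => k * dis w)); last 4 first.
- by meas.
- exact: mbd.
- by move=> x z _ _; apply: mulr_ge0; [exact: ltW|exact: dis0].
- by move=> x z _ _; apply: mulr_ge0; [exact: near0|apply: addr_ge0].
rewrite (dintZ mu mX mdis (ltW k0)); last by move=> x z _ _; exact: dis0.
have L0 : 0 <= 2 * Lam * (3 * r) ^+ n.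
  by apply: mulr_ge0; [rewrite mulr_ge0|rewrite exprn_ge0// mulr_ge0// ltW].
apply: (@le_trans _ _ (k%:E * (Ceta * r ^+ 2)%:E + (2 * Lam * (3 * r) ^+ n)%:E * (r * Cu)%:E)%E).
  apply: leeD.
    by apply: lee_wpmul2l; [rewrite lee_fin ltW|exact: dissipation].
  apply: (le_trans (near_dint mu_ u0)).
  by apply: lee_wpmul2l; rewrite ?lee_fin.
rewrite -!EFinM -EFinD lee_fin le_eqVlt; apply/orP; left; apply/eqP.
rewrite /Cd /k exprMn (exprS r n); move: (r ^+ n) (3 ^+ n) => rn tn; field.
by rewrite gt_eqF.
Qed.

(** It depends on the data only, not on r, [U] or [W]; adding 1 makes it positive. *)
Definition core_constant : R := `|Cq + 4 * Cw| + `|Cq| + `|Cd| + 1.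

Lemma core_bounds :
  [/\ (E (fun x => `|U x + W x|%R) <= (n%:R * ell + core_constant)%:E)%E,
      ((n%:R * ell - core_constant)%:E <= J (fun w => `|U w.1 + W w.2|%R))%E &
      (J (fun w => nearby r w * `|U w.1 - W w.1 - (U w.2 - W w.2)|)%R
        <= (core_constant * r ^+ n.+1)%:E)%E].
Proof.
have a1 := normr_ge0 (Cq + 4 * Cw).
have a2 := normr_ge0 Cq.
have a3 := normr_ge0 Cd.
have b1 := ler_norm (Cq + 4 * Cw).
have b2 := ler_norm Cq.
have b3 := ler_norm Cd.
have cc : [/\ Cq + 4 * Cw <= core_constant, Cq <= core_constant & Cd <= core_constant].
  rewrite /core_constant; move: b1 b2 b3 a1 a2 a3.
  move: `|Cq + 4 * Cw| `|Cq| `|Cd| (Cq + 4 * Cw) Cq Cd => x1 x2 x3 x4 x5 x6 *.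
  by split; lra.
have [c1' c2 c3] := cc.
have [s1 s2] := core_sum.
split.
- by apply: (le_trans s1); rewrite lee_fin lerD2l.
- by apply: le_trans s2; rewrite lee_fin lerD2l lerN2.
- apply: (le_trans core_diff); rewrite lee_fin; apply: ler_wpM2r => //.
  by rewrite exprn_ge0// ltW.
Qed.

End Core.

(** The constant is chosen before [Y], because the full-measure set varies with eps. This is
    possible since the mesh depends only on the bound M for the larger set [X]. *)
Theorem core_estimate {R : realType} {d : nat}
    (mu : probability 'rV[R]_d.+1 R) (X : set 'rV[R]_d.+1) (M Lam : R)
    (Dd : 'rV[R]_d.+1 -> 'rV[R]_d.+1 -> R) (kap K : R) :
  0 < M -> (forall x, X x -> `|x| <= M) -> 0 <= Lam ->
  (forall (a : 'rV[R]_d.+1) (r : R), 0 < r ->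
    (mu [set x : 'rV[R]_d.+1 | forall i, (a 0 i <= x 0 i < a 0 i + r)%R]
     <= (Lam * r ^+ d.+1)%:E)%E) ->
  measurable_fun setT (fun w : 'rV[R]_d.+1 * 'rV[R]_d.+1 => Dd w.1 w.2) ->
  0 < kap -> kap <= K ->
  (forall x z, X x -> X z -> kap * `|x - z| ^+ 2 <= Dd x z) ->
  (forall x z, X x -> X z -> Dd x z <= K * `|x - z| ^+ 2) ->
  (forall x z, X x -> X z -> `|Dd x z - Dd z x| <= K * `|x - z| ^+ 3) ->
  (forall x x' z, X x -> X x' -> X z -> Dd x z - Dd x' z <= K * `|x - x'|) ->
  (forall x z z', X x -> X z -> X z' -> Dd x z - Dd x z' <= K * `|z - z'|) ->
  exists2 C : R, 0 < C & forall (Y : set 'rV[R]_d.+1) (r : R) (U W : 'rV[R]_d.+1 -> R),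
    Y `<=` X -> measurable Y -> mu Y = 1%E ->
    0 < r < 1 -> measurable_fun setT U -> measurable_fun setT W ->
    (\int[mu]_(x in Y) `|U x|%:E < +oo)%E -> (\int[mu]_(x in Y) `|W x|%:E < +oo)%E ->
    (forall x, Y x -> (\int[mu]_(z in Y) (wgt Dd r U W (x, z))%:E = 1)%E) ->
    (forall z, Y z -> (\int[mu]_(x in Y) (wgt Dd r U W (x, z))%:E = 1)%E) ->
    [/\ (\int[mu]_(x in Y) `|U x + W x|%:E <= (d.+1%:R * ln r^-1 + C)%:E)%E,
        ((d.+1%:R * ln r^-1 - C)%:E <= dint mu Y (fun w => `|U w.1 + W w.2|)%R)%E &
        (dint mu Y (fun w => nearby r w * `|U w.1 - W w.1 - (U w.2 - W w.2)|)%R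
          <= (C * r ^+ d.+2)%:E)%E].
Proof.
move=> M0 XM Lam0 muL mD kap0 kapK Dlow Dup Dasym Dlip1 Dlip2.
have [G [CN [G0 CN0 mesh]]] := exists_mesh d M0.
exists (@core_constant R d Lam kap K G CN).
  by rewrite /core_constant ltr_wpDl// !addr_ge0.
move=> Y r U W YX mY muY r01 mU mW iU iW hp1 hp2.
have KB : kernel_bounded mu Y Lam G CN.
  by apply: (@kernel_bounds R d mu Y M Lam) => // x /YX; exact: XM.
apply: (core_bounds mY muY Lam0 muL mD kap0 kapK) => //.
- by move=> x z /YX Xx /YX; exact: Dlow.
- by move=> x z /YX Xx /YX; exact: Dup.
- by move=> x z /YX Xx /YX; exact: Dasym.
- by move=> x x' z /YX Xx /YX Xx' /YX; exact: Dlip1.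
- by move=> x z z' /YX Xx /YX Xz /YX; exact: Dlip2.
Qed.

(** * The Bregman divergence of a strongly convex function *)

Section LineCalculus.
Context {R : realType}.
Implicit Types (F : R -> R).

Lemma mean_value01 F (F' : R -> R) (c : R) :
  (forall t : R, 0 <= t <= 1 -> is_derive t 1 F (F' t)) ->
  (forall t : R, 0 <= t <= 1 -> `|F' t| <= c) ->
  forall t : R, 0 <= t <= 1 -> `|F t - F 0| <= c * t.
Proof.
move=> dF bF t /andP[t0 t1].
have [||s] := @MVT_segment R F F' 0 t t0.
- by move=> s; rewrite in_itv/= => /andP[s0 st]; apply: dF; rewrite !ltW//= (lt_le_trans st).
- apply: derivable_within_continuous => s; rewrite in_itv/= => /andP[s0 st].
  by have [] := dF s (introT andP (conj s0 (le_trans st t1))).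
rewrite in_itv/= => /andP[s0 st] ->.
rewrite subr0 normrM (ger0_norm t0) ler_wpM2r// bF// s0/=.
exact: le_trans st t1.
Qed.

(* Error of the trapezoid rule. *)
Lemma trapezoid F (F' F'' F''' : R -> R) (c : R) :
  (forall t : R, 0 <= t <= 1 -> is_derive t 1 F (F' t)) ->
  (forall t : R, 0 <= t <= 1 -> is_derive t 1 F' (F'' t)) ->
  (forall t : R, 0 <= t <= 1 -> is_derive t 1 F'' (F''' t)) ->
  (forall t : R, 0 <= t <= 1 -> `|F''' t| <= c) ->
  `|2 * (F 1 - F 0) - (F' 0 + F' 1)| <= c.
Proof.
move=> d1 d2 d3 b3.
have c0 : 0 <= c by apply: le_trans (b3 0 _); rewrite ?lexx ?ler01.
(* [A] below interpolates the trapezoid error: A' = B and B' = -t F''', so the mean value bound is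
   used twice. *)
pose B t := F' t - F' 0 - t * F'' t.
have dB (t : R) : 0 <= t <= 1 -> is_derive t 1 B (- (t * F''' t)).
  move=> t01; have D1 := d1 t t01; have D2 := d2 t t01; have D3 := d3 t t01.
  apply: is_derive_eq; rewrite /GRing.scale/=; ring.
have bB t : 0 <= t <= 1 -> `|B t| <= c.
  move=> t01; have := @mean_value01 B (fun t => - (t * F''' t)) c dB.
  have B0 : B 0 = 0 by rewrite /B; ring.
  rewrite B0 => H; have {H} := H _ t t01; rewrite subr0 => /(_ _)/le_trans; apply.
    move=> s s01; rewrite normrN normrM; have /andP[s0 s1] := s01.
    by rewrite (ger0_norm s0) -[leRHS]mul1r; apply: ler_pM => //; exact: b3.
  by case/andP: t01 => t0 t1; rewrite -[leRHS]mulr1 ler_wpM2l.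
pose A t := 2 * F t - t * (F' t + F' 0).
have dA (t : R) : 0 <= t <= 1 -> is_derive t 1 A (B t).
  move=> t01; have D1 := d1 t t01; have D2 := d2 t t01.
  apply: is_derive_eq; rewrite /GRing.scale/= /B; ring.
have := @mean_value01 A B c dA bB 1; rewrite lexx ler01 mulr1 => /(_ isT).
rewrite /A (_ : _ - _ = 2 * (F 1 - F 0) - (F' 0 + F' 1))//.
ring.
Qed.

End LineCalculus.

Lemma ler_sum_ord_const {R : realType} (n : nat) (a : 'I_n -> R) (c : R) :
  (forall i, a i <= c) -> \sum_i a i <= n%:R * c.
Proof.
by move=> ac; rewrite mulr_natl -[in leRHS](card_ord n) -sumr_const; apply: ler_sum.
Qed.

Section Dotr.
Context {R : realType} {n : nat}.
Implicit Types x y z h : 'rV[R]_n.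

Lemma half_sqrE x : half_sqr x = dotr x x / 2.
Proof. by rewrite /half_sqr sqr_sqrtr// sumr_ge0// => i _; rewrite -expr2 sqr_ge0. Qed.

Lemma dotrC x y : dotr x y = dotr y x.
Proof. by apply: eq_bigr => i _; rewrite mulrC. Qed.

Lemma dotrDr x y z : dotr x (y + z) = dotr x y + dotr x z.
Proof. by rewrite /dotr -big_split; apply: eq_bigr => i _; rewrite mxE mulrDr. Qed.

Lemma dotrZr x (a : R) y : dotr x (a *: y) = a * dotr x y.
Proof. by rewrite /dotr mulr_sumr; apply: eq_bigr => i _; rewrite mxE mulrCA. Qed.

Lemma dotrBr x y z : dotr x (y - z) = dotr x y - dotr x z.
Proof. by rewrite -[- z]scaleN1r dotrDr dotrZr mulN1r. Qed.

Lemma dotrBl x y z : dotr (x - y) z = dotr x z - dotr y z.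
Proof. by rewrite !(dotrC _ z) dotrBr. Qed.

Lemma dotr_line x (t : R) h :
  dotr (x + t *: h) (x + t *: h) = dotr x x + 2 * t * dotr x h + t ^+ 2 * dotr h h.
Proof.
rewrite dotrDr dotrZr [dotr _ x]dotrC [dotr _ h]dotrC !dotrDr !dotrZr [dotr h x]dotrC.
ring.
Qed.

Lemma sqr_norm_le_dotr x : `|x| ^+ 2 <= dotr x x.
Proof.
have x0 : 0 <= dotr x x by rewrite sumr_ge0// => i _; rewrite -expr2 sqr_ge0.
rewrite -[leRHS]sqr_sqrtr// ler_sqr ?nnegrE ?sqrtr_ge0//.
apply/rV_norm_leP; first exact: sqrtr_ge0.
move=> i; rewrite -[leLHS]sqrtr_sqr ler_wsqrtr// /dotr (bigD1 i)//= -expr2 lerDl.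
by rewrite sumr_ge0// => j _; rewrite -expr2 sqr_ge0.
Qed.

Lemma dotr_le x y : `|dotr x y| <= n%:R * (`|x| * `|y|).
Proof.
rewrite (le_trans (ler_norm_sum _ _ _))//; apply: ler_sum_ord_const => i.
by rewrite normrM; apply: ler_pM => //; exact: rV_coord_le_norm.
Qed.

Lemma strongly_convexP (kappa : R) f x z (t : R) : strongly_convex kappa f -> 0 <= t <= 1 ->
  f (t *: x + (1 - t) *: z) - kappa * half_sqr (t *: x + (1 - t) *: z)
    <= t * (f x - kappa * half_sqr x) + (1 - t) * (f z - kappa * half_sqr z).
Proof.
move=> sc /andP[t0 t1]; exact: (sc (Itv01 t0 t1) x z (mem_set I) (mem_set I)).
Qed.

End Dotr.

Section Bregman.
Context {R : realType} {d : nat}.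
Local Notation n := d.+1.
Variables (kappa : R) (Om U : set 'rV[R]_n) (phi : 'rV[R]_n -> R).
Hypotheses (oOm : open Om) (bOm : bounded_set Om) (oU : open U)
  (OmU : closure Om `<=` U) (kappa0 : 0 < kappa)
  (scphi : strongly_convex kappa phi) (smphi : Ck 3 U phi).
Implicit Types (x y z u h : 'rV[R]_n) (s : seq 'I_n).

Definition partials_bounded (e M : R) x := forall u, `|u - x| < e -> U u /\
  forall s, (size s <= 3)%N -> `|partial s phi u| <= M.

Lemma partials_near x : U x -> exists e M : R, [/\ 0 < e, 0 <= M & partials_bounded e M x].
Proof.
move=> Ux.
have nU : \forall u \near x, U u by move: oU; rewrite openE; exact.
(* Index lists of length at most 3 are split into tuples, a finite family, so the neighbourhoods can
   be intersected. *)
have nP : \forall u \near x, forall (k : 'I_4) (t : k.-tuple 'I_n),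
    `|partial t phi u| <= `|partial t phi x| + 1.
  apply: (@filter_forall _ _ _ (nbhs x) (nbhs_filter x)) => k.
  apply: (@filter_forall _ _ _ (nbhs x) (nbhs_filter x)) => t.
  have cp : {for x, continuous (partial t phi)}.
    by apply: (proj2 smphi) => //; rewrite size_tuple -ltnS.
  have /cvgrPdist_le/(_ 1 ltr01) := cp; apply: filterS => u ux.
  rewrite -lerBlDl; apply: le_trans ux.
  by rewrite distrC lerB_dist.
have /nbhs_ballP[e /= e0 eP] : \forall u \near x, U u /\
    forall (k : 'I_4) (t : k.-tuple 'I_n), `|partial t phi u| <= `|partial t phi x| + 1.
  by near=> u; split; near: u.
exists e, (\sum_(k < 4) \sum_(t : k.-tuple 'I_n) (`|partial t phi x| + 1)); split=> //.
  by do 2 (apply: sumr_ge0 => ? _); rewrite addr_ge0.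
move=> u ux; have [] : U u /\ forall (k : 'I_4) (t : k.-tuple 'I_n),
    `|partial t phi u| <= `|partial t phi x| + 1.
  by apply: eP; rewrite -ball_normE /= distrC.
move=> Uu Pu; split=> // s s3.
have s4 : (size s < 4)%N by [].
have := Pu (Ordinal s4) (in_tuple s); rewrite /= => /le_trans; apply.
rewrite (bigD1 (Ordinal s4))//= (bigD1 (in_tuple s))//= -addrA lerDl addr_ge0//.
  by apply: sumr_ge0 => ? _; rewrite addr_ge0.
by do 2 (apply: sumr_ge0 => ? _); rewrite addr_ge0.
Unshelve. all: by end_near.
Qed.

(** A Lebesgue number argument: the compact closure is covered by balls of half the local radius,
    and e is the least of the half radii, capped by 1. *)
Lemma uniform_partials : exists e M : R, [/\ 0 < e, 0 <= M &
  forall x, closure Om x -> partials_bounded e M x].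
Proof.
have ex x : exists p : R * R, [/\ 0 < p.1, 0 <= p.2 & closure Om x ->
    partials_bounded p.1 p.2 x].
  have [/OmU Ux|nx] := pselect (closure Om x); last by exists (1, 0).
  by have [e [M [? ? ?]]] := partials_near Ux; exists (e, M).
have [p pP] := choice ex.
have p10 x : 0 < (p x).1 by have [] := pP x.
have p20 x : 0 <= (p x).2 by have [] := pP x.
have := closure_compact_rV bOm; rewrite compact_cover
  => /(_ _ (closure Om) (fun x => ball x ((p x).1 / 2))).
move=> [|x clx|D DOm Dcov].
- by move=> x _; exact: ball_open.
- by exists x => //; apply: ballxx; rewrite divr_gt0.
pose s := finmap.enum_fset D.
have mingt : 0 < \big[Num.min/1]_(x <- s) ((p x).1 / 2).
  by elim/big_ind: _ => // [a b a0 b0|x _]; [rewrite lt_min a0|rewrite divr_gt0].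
exists (\big[Num.min/1]_(x <- s) ((p x).1 / 2)), (\sum_(x <- s) (p x).2); split=> //.
  by apply: sumr_ge0.
move=> x /Dcov[y /= yD]; rewrite -ball_normE /= => yx u ux.
have cly : closure Om y by have := DOm y yD; rewrite inE.
have [Uu Pu] : U u /\ forall s, (size s <= 3)%N -> `|partial s phi u| <= (p y).2.
  have [_ _ /(_ cly)] := pP y; apply.
  rewrite (splitr (p y).1) (_ : u - y = (u - x) - (y - x)); last by rewrite opprB addrA subrK.
  rewrite (le_lt_trans (ler_normB _ _))// ltrD//.
  by apply: (lt_le_trans ux); apply: (bigmin_inf_seq _ y).
split=> // t /Pu /le_trans; apply.
by rewrite (big_rem y)//= lerDl sumr_ge0.
Qed.

Section Local.
Variables (e M : R).
Hypotheses (e0 : 0 < e) (M0 : 0 <= M) (PB : forall x, closure Om x -> partials_bounded e M x).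

Lemma partial_lip s x y : (size s < 3)%N -> closure Om x -> `|y - x| < e ->
  `|partial s phi y - partial s phi x| <= n%:R * M * `|y - x|.
Proof.
move=> s3 clx yx; have [|xi xiP ->] := @box_mvt R n (partial s phi) x y.
  move=> u i ux; apply: (proj1 smphi) => //.
  by have [] := PB clx (le_lt_trans ux yx).
rewrite (le_trans (ler_norm_sum _ _ _))// -mulrA; apply: ler_sum_ord_const => i.
rewrite normrM mulrC; apply: ler_pM => //.
  have [_ /(_ (i :: s))] := PB clx (le_lt_trans (xiP i) yx); exact.
by have := rV_coord_le_norm (y - x) i; rewrite !mxE.
Qed.

Lemma taylor2 x y : closure Om x -> `|y - x| < e ->
  `|phi y - phi x - dotr (grad phi x) (y - x)| <= n%:R ^+ 2 * M * `|y - x| ^+ 2.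
Proof.
move=> clx yx; have [|xi xiP ->] := @box_mvt R n phi x y.
  move=> u i ux; apply: (proj1 smphi [::]) => //.
  by have [] := PB clx (le_lt_trans ux yx).
rewrite /dotr -sumrB (_ : n%:R ^+ 2 * M * `|y - x| ^+ 2
    = n%:R * (`|y - x| * (n%:R * M * `|y - x|))); last by ring.
rewrite (le_trans (ler_norm_sum _ _ _))//; apply: ler_sum_ord_const => i.
have -> : (y 0 i - x 0 i) * 'D_(delta_mx 0 i) phi (xi i) - grad phi x 0 i * (y - x) 0 i
    = (y - x) 0 i * (partial [:: i] phi (xi i) - partial [:: i] phi x).
  by rewrite !mxE /=; ring.
rewrite normrM; apply: ler_pM => //; first exact: rV_coord_le_norm.
apply: (le_trans (partial_lip _ clx (le_lt_trans (xiP i) yx))) => //.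
by rewrite ler_wpM2l// mulr_ge0.
Qed.

Lemma is_derive_partial_line s x h (t : R) : (size s < 3)%N -> U (x + t *: h) ->
  is_derive t 1 (fun t : R => partial s phi (x + t *: h))
    (\sum_i h 0 i * partial (i :: s) phi (x + t *: h)).
Proof.
move=> s3 Ut.
have /nbhs_ballP[r /= r0 rP] : nbhs (x + t *: h) U by move: oU; rewrite openE; exact.
have H : is_derive (x + t *: h) h (partial s phi) (\sum_i h 0 i * partial (i :: s) phi (x + t *: h)).
  apply: (@is_derive_partials R n _ _ _ r r0).
  - move=> u i ur; apply: (proj1 smphi) => //; apply: rP.
    by rewrite -ball_normE /= distrC.
  - by move=> i; exact: (proj2 smphi (i :: s)).
have [dH HE] := H.
by rewrite -HE; exact: is_derive_line.
Qed.

Lemma is_derive_lincomb (F F' : 'I_n -> R -> R) h (t : R) :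
  (forall i, is_derive t 1 (F i) (F' i t)) ->
  is_derive t 1 (fun t => \sum_i h 0 i * F i t) (\sum_i h 0 i * F' i t).
Proof.
move=> dF.
have -> : (fun t => \sum_i h 0 i * F i t) = \sum_i (h 0 i \*: F i).
  by apply/funext => u; rewrite fct_sumE.
by apply: is_derive_sum => i; exact: is_deriveZ.
Qed.

(** The quantity is the asymmetry of the Bregman divergence. It is the trapezoid error of [phi]
    along the segment, hence of third order. *)
Lemma trapezoid_grad x h : closure Om x -> `|h| < e ->
  `|2 * (phi (x + h) - phi x) - (dotr (grad phi x) h + dotr (grad phi (x + h)) h)|
    <= n%:R ^+ 3 * M * `|h| ^+ 3.
Proof.
move=> clx he.
have near t : 0 <= t <= 1 -> `|x + t *: h - x| < e.
  move=> /andP[t0 t1]; rewrite addrAC subrr add0r normrZ ger0_norm//.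
  by apply: le_lt_trans he; rewrite -[leRHS]mul1r ler_wpM2r.
have Uh t : 0 <= t <= 1 -> U (x + t *: h) by move=> /near /(PB clx)[].
pose P s t := partial s phi (x + t *: h).
have := @trapezoid R (P [::]) (fun t => \sum_i h 0 i * P [:: i] t)
  (fun t => \sum_i h 0 i * \sum_j h 0 j * P [:: j; i] t)
  (fun t => \sum_i h 0 i * \sum_j h 0 j * \sum_k h 0 k * P [:: k; j; i] t)
  (n%:R ^+ 3 * M * `|h| ^+ 3).
have -> : dotr (grad phi x) h = \sum_i h 0 i * P [:: i] 0.
  by apply: eq_bigr => i _; rewrite mxE mulrC /P scale0r addr0.
have -> : dotr (grad phi (x + h)) h = \sum_i h 0 i * P [:: i] 1.
  by apply: eq_bigr => i _; rewrite mxE mulrC /P scale1r.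
have -> : P [::] 1 = phi (x + h) by rewrite /P scale1r.
have -> : P [::] 0 = phi x by rewrite /P scale0r addr0.
apply.
- by move=> t t01; exact: (is_derive_partial_line (s := [::]) isT (Uh t t01)).
- move=> t t01.
  apply: (@is_derive_lincomb (fun i => P [:: i]) (fun i t => \sum_j h 0 j * P [:: j; i] t)) => i.
  exact: (is_derive_partial_line (s := [:: i]) isT (Uh t t01)).
- move=> t t01.
  apply: (@is_derive_lincomb (fun i t => \sum_j h 0 j * P [:: j; i] t)
    (fun i t => \sum_j h 0 j * \sum_k h 0 k * P [:: k; j; i] t)) => i.
  apply: (@is_derive_lincomb (fun j => P [:: j; i])
    (fun j t => \sum_k h 0 k * P [:: k; j; i] t)) => j.
  exact: (is_derive_partial_line (s := [:: j; i]) isT (Uh t t01)).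
move=> t t01.
have sumb (a : 'I_n -> R) (c : R) : 0 <= c -> (forall i, `|a i| <= c) ->
    `|\sum_i h 0 i * a i| <= n%:R * (`|h| * c).
  move=> c0 ac; rewrite (le_trans (ler_norm_sum _ _ _))//; apply: ler_sum_ord_const => i.
  by rewrite normrM; apply: ler_pM => //; exact: rV_coord_le_norm.
have -> : n%:R ^+ 3 * M * `|h| ^+ 3 = n%:R * (`|h| * (n%:R * (`|h| * (n%:R * (`|h| * M))))) by ring.
apply: (@sumb _) => [|i]; first by rewrite !mulr_ge0.
apply: (@sumb _) => [|j]; first by rewrite !mulr_ge0.
apply: (@sumb _) => // k.
have [_ /(_ [:: k; j; i])] := PB clx (near t t01); exact.
Qed.

Definition bregman x z := phi x - phi z - dotr (grad phi z) (x - z).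

(** Strong convexity bounds phi at z + t h; subtracting the Taylor expansion, dividing by t and
    letting t tend to 0 gives the claim. Convexity is global, so x need not be near [Om], which
    [conjugate_grad] uses. *)
Lemma bregman_lower x z : closure Om z -> kappa / 2 * dotr (x - z) (x - z) <= bregman x z.
Proof.
move=> clz; set h := x - z.
have xE t : z + t *: h = t *: x + (1 - t) *: z.
  by rewrite /h scalerBr scalerBl scale1r addrCA.
have conv t : 0 <= t <= 1 ->
    phi (z + t *: h) - phi z <= t * (phi x - phi z) - kappa / 2 * (t * (1 - t)) * dotr h h.
  move=> t01; have := strongly_convexP x z scphi t01; rewrite -xE.
  have -> : half_sqr x = half_sqr (z + 1 *: h) by rewrite scale1r /h addrC subrK.
  by rewrite !half_sqrE !dotr_line; move: (dotr _ _) (dotr _ _) (dotr _ _) => p q w; nra.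
have h0 := normr_ge0 h.
have key a : 0 < a -> kappa / 2 * dotr h h <= bregman x z + a.
  move=> a0; pose c := n%:R ^+ 2 * M * `|h| ^+ 2 + kappa / 2 * dotr h h.
  have c0 : 0 <= c.
    rewrite addr_ge0 ?mulr_ge0 ?exprn_ge0//; first by rewrite ltW// divr_gt0.
    exact: le_trans (sqr_norm_le_dotr h).
  (* The second bound keeps z + t h within the Taylor radius e, the third makes the total error t c
     at most a. *)
  pose t := Num.min 1 (Num.min (e / (`|h| + 1) / 2) (a / (c + 1))).
  have c1 : 0 < c + 1 by rewrite ltr_wpDl.
  have t0 : 0 < t by rewrite !lt_min ltr01 !divr_gt0.
  have t1 : t <= 1 by rewrite ge_min lexx.
  have te : t * `|h| < e.
    have : t <= e / (`|h| + 1) / 2 by rewrite !ge_min lexx orbT.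
    rewrite ler_pdivlMr// ler_pdivlMr// => H; apply: lt_le_trans (_ : t * (2 * (`|h| + 1)) <= _).
      by rewrite ltr_pM2l//; lra.
    by rewrite mulrA.
  have tc : t * c <= a.
    have : t <= a / (c + 1) by rewrite !ge_min lexx !orbT.
    by rewrite ler_pdivlMr// => H; apply: le_trans H; rewrite ler_pM2l// lerDl.
  have := taylor2 (y := z + t *: h) clz.
  have -> : z + t *: h - z = t *: h by rewrite addrAC subrr add0r.
  rewrite normrZ (ger0_norm (ltW t0)) => /(_ te).
  rewrite dotrZr exprMn => /ler_normlP[H _].
  have := conv t; rewrite (ltW t0) t1 => /(_ isT) H2.
  rewrite -(ler_pM2l t0) /bregman -/h.
  move: tc; rewrite -(ler_pM2l t0) /c => tc.
  move: H H2 tc; move: (dotr h h) (dotr _ h) (phi x) (phi z) (phi (z + _)) => p q f1 f2 f3.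
  lra.
by apply/ler_addgt0Pr => a a0; exact: key.
Qed.

Variable B : R.
Hypotheses (B0 : 0 < B) (OmB : forall x, Om x -> `|x| <= B).

Let cl x : Om x -> closure Om x. Proof. exact: subset_closure. Qed.

(** [Om] need not be convex, so Taylor bounds are used only at distance less than e. Beyond it,
    bounded quantities are absorbed into a power of the distance divided by e. *)
Let far_le (a N : R) k : 0 <= a -> e <= N -> a <= a / e ^+ k * N ^+ k.
Proof.
move=> a0 eN; rewrite mulrAC ler_pdivlMr ?exprn_gt0// ler_wpM2l//.
by rewrite lerXn2r// nnegrE ltW// (lt_le_trans e0).
Qed.

Let bounded_partial s x : (size s <= 3)%N -> Om x -> `|partial s phi x| <= M.
Proof.
by move=> s3 /cl clx; apply: (proj2 (PB clx (u := x) _)); rewrite ?subrr ?normr0.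
Qed.

Let L := n%:R * M + 2 * M / e ^+ 1.

Let L0 : 0 <= L.
Proof. by rewrite /L expr1 addr_ge0 ?divr_ge0 ?mulr_ge0// ltW. Qed.

Lemma partial_lip_global s x y : (size s < 3)%N -> Om x -> Om y ->
  `|partial s phi y - partial s phi x| <= L * `|y - x|.
Proof.
move=> s3 Omx Omy; have N0 := normr_ge0 (y - x); have nM : 0 <= n%:R * M by rewrite mulr_ge0.
have M20 : 0 <= 2 * M by rewrite mulr_ge0.
rewrite /L [leRHS]mulrDl; have [yx|yx] := ltP `|y - x| e.
  apply: (le_trans (partial_lip s3 (cl Omx) yx)); rewrite lerDl.
  by rewrite mulr_ge0// divr_ge0// expr1 ltW.
rewrite (le_trans (ler_normB _ _))//.
apply: (@le_trans _ _ (2 * M)).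
  by rewrite mulr_natl mulr2n lerD// bounded_partial// ltnW.
apply: (le_trans (far_le 1 M20 yx)); rewrite expr1 expr1 lerDr.
by rewrite mulr_ge0.
Qed.

Lemma grad_bounded x : Om x -> `|grad phi x| <= M.
Proof.
move=> Omx; apply/rV_norm_leP => // i; rewrite mxE.
exact: (bounded_partial (s := [:: i])).
Qed.

Lemma grad_lip x y : Om x -> Om y -> `|grad phi y - grad phi x| <= L * `|y - x|.
Proof.
move=> Omx Omy; apply/rV_norm_leP => [|i]; first by rewrite mulr_ge0.
rewrite !mxE; exact: (partial_lip_global (s := [:: i])).
Qed.

Let dotr_grad x h : Om x -> `|dotr (grad phi x) h| <= n%:R * M * `|h|.
Proof.
move=> Omx; apply: (le_trans (dotr_le _ _)); rewrite -mulrA ler_wpM2l// ler_wpM2r//.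
exact: grad_bounded.
Qed.

Lemma bregman_upper : exists2 K : R, 0 <= K &
  forall x z, Om x -> Om z -> bregman x z <= K * `|x - z| ^+ 2.
Proof.
have M20 : 0 <= 2 * M by rewrite mulr_ge0.
have nM : 0 <= n%:R * M by rewrite mulr_ge0.
exists (n%:R ^+ 2 * M + (2 * M / e ^+ 2 + n%:R * M / e ^+ 1)).
  by rewrite !addr_ge0 ?divr_ge0 ?mulr_ge0 ?exprn_ge0// ltW.
move=> x z Omx Omz; have N0 := normr_ge0 (x - z).
apply: (le_trans (ler_norm _)); rewrite [leRHS]mulrDl.
have [xz|xz] := ltP `|x - z| e.
  apply: (le_trans (taylor2 (cl Omz) xz)); rewrite lerDl.
  by rewrite mulr_ge0 ?exprn_ge0// addr_ge0// divr_ge0 ?exprn_ge0// ltW.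
apply: le_trans (_ : 2 * M + n%:R * M * `|x - z| <= _).
  rewrite (le_trans (ler_normB _ _))// lerD ?dotr_grad//.
  rewrite (le_trans (ler_normB _ _))// mulr_natl mulr2n lerD//;
    exact: (bounded_partial (s := [::])).
apply: (@le_trans _ _ ((2 * M / e ^+ 2 + n%:R * M / e ^+ 1) * `|x - z| ^+ 2)).
  rewrite [leRHS]mulrDl; apply: lerD; first exact: far_le.
  rewrite [X in _ <= X](_ : _ = n%:R * M / e ^+ 1 * `|x - z| ^+ 1 * `|x - z|); last by rewrite !expr1; ring.
  by rewrite ler_wpM2r// far_le.
by rewrite lerDr mulr_ge0 ?exprn_ge0 ?mulr_ge0.
Qed.

Lemma bregman_asym : exists2 K : R, 0 <= K &
  forall x z, Om x -> Om z -> `|bregman x z - bregman z x| <= K * `|x - z| ^+ 3.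
Proof.
have M20 : 0 <= 4 * M by rewrite mulr_ge0.
have nM : 0 <= 2 * (n%:R * M) by rewrite !mulr_ge0.
exists (n%:R ^+ 3 * M + (4 * M / e ^+ 3 + 2 * (n%:R * M) / e ^+ 2)).
  by rewrite !addr_ge0 ?divr_ge0 ?mulr_ge0 ?exprn_ge0// ltW.
move=> x z Omx Omz; have N0 := normr_ge0 (x - z).
have -> : bregman x z - bregman z x = 2 * (phi x - phi z)
    - (dotr (grad phi z) (x - z) + dotr (grad phi x) (x - z)).
  by rewrite /bregman !dotrBr; ring.
rewrite [leRHS]mulrDl; have [xz|xz] := ltP `|x - z| e.
  have := trapezoid_grad (cl Omz) xz.
  have -> : z + (x - z) = x by rewrite addrC subrK.
  move=> /le_trans; apply; rewrite lerDl.
  by rewrite mulr_ge0 ?exprn_ge0// addr_ge0// divr_ge0 ?exprn_ge0// ltW.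
apply: le_trans (_ : 4 * M + 2 * (n%:R * M) * `|x - z| <= _).
  rewrite (le_trans (ler_normB _ _))// lerD//.
    rewrite normrM ger0_norm// (_ : 4 * M = 2 * (M + M)); last by ring.
    rewrite ler_wpM2l// (le_trans (ler_normB _ _))// lerD//;
      exact: (bounded_partial (s := [::])).
  rewrite (le_trans (ler_normD _ _))//.
  rewrite [leRHS](_ : _ = n%:R * M * `|x - z| + n%:R * M * `|x - z|); last by ring.
  by rewrite lerD// dotr_grad.
apply: (@le_trans _ _ ((4 * M / e ^+ 3 + 2 * (n%:R * M) / e ^+ 2) * `|x - z| ^+ 3)).
  rewrite [leRHS]mulrDl; apply: lerD; first exact: far_le.
  rewrite [X in _ <= X](_ : _ = 2 * (n%:R * M) / e ^+ 2 * `|x - z| ^+ 2 * `|x - z|); last by ring.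
  by rewrite ler_wpM2r// far_le.
by rewrite lerDr mulr_ge0 ?exprn_ge0 ?mulr_ge0 ?exprn_ge0.
Qed.

Lemma bregman_lip_left : exists2 K : R, 0 <= K &
  forall x x' z, Om x -> Om x' -> Om z -> bregman x z - bregman x' z <= K * `|x - x'|.
Proof.
exists (L + n%:R * M); first by rewrite addr_ge0 ?mulr_ge0.
move=> x x' z Omx Omx' Omz.
have -> : bregman x z - bregman x' z = (phi x - phi x') - dotr (grad phi z) (x - x').
  by rewrite /bregman !dotrBr; ring.
apply: (le_trans (ler_norm _)); rewrite (le_trans (ler_normB _ _))// [leRHS]mulrDl lerD//.
  exact: (partial_lip_global (s := [::])).
exact: dotr_grad.
Qed.

Lemma bregman_lip_right : exists2 K : R, 0 <= K &
  forall x z z', Om x -> Om z -> Om z' -> bregman x z - bregman x z' <= K * `|z - z'|.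
Proof.
exists (L + n%:R * L * (2 * B) + n%:R * M).
  apply: addr_ge0; last exact: mulr_ge0.
  by apply: addr_ge0 => //; apply: mulr_ge0; [exact: mulr_ge0|rewrite mulr_ge0// ltW].
move=> x z z' Omx Omz Omz'.
have -> : bregman x z - bregman x z' = (phi z' - phi z)
    + dotr (grad phi z' - grad phi z) (x - z') + dotr (grad phi z) (z - z').
  by rewrite /bregman dotrBl !dotrBr; ring.
apply: (le_trans (ler_norm _)); rewrite (le_trans (ler_normD _ _))//.
rewrite [leRHS]mulrDl; apply: lerD; last exact: dotr_grad.
rewrite [leRHS]mulrDl.
rewrite (le_trans (ler_normD _ _))// lerD//.
  by rewrite [`|z - z'|]distrC; exact: (partial_lip_global (s := [::])).
apply: (le_trans (dotr_le _ _)).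
rewrite [leRHS](_ : _ = n%:R * (L * `|z - z'| * (2 * B))); last by ring.
rewrite ler_wpM2l//; apply: ler_pM => //.
  by rewrite [`|z - z'|]distrC; exact: grad_lip.
by rewrite (le_trans (ler_normB _ _))// mulr_natl mulr2n lerD// OmB.
Qed.

End Local.

Lemma bounded_phi_grad : exists2 M : R, 0 <= M &
  forall x, Om x -> `|phi x| <= M /\ `|grad phi x| <= M.
Proof.
have [e [M [e0 M0 PB]]] := uniform_partials.
exists M => // x Omx; split; last exact: (grad_bounded e0 M0 PB Omx).
have xx : `|x - x| < e by rewrite subrr normr0.
have [_ /(_ [::])] := PB x (subset_closure Omx) x xx; exact.
Qed.

(** Nonnegativity of the Bregman divergence says that z attains the supremum. *)
Lemma conjugate_grad z : Om z -> conjugate phi (grad phi z) = (dotr (grad phi z) z - phi z)%:E.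
Proof.
move=> Omz; have [e [M [e0 M0 PB]]] := uniform_partials.
apply/le_anti/andP; split; last by apply: ereal_sup_ubound; exists z.
apply: ge_ereal_sup => _ [x _ <-]; rewrite lee_fin.
have := bregman_lower e0 M0 PB x (subset_closure Omz).
have : 0 <= kappa / 2 * dotr (x - z) (x - z).
  rewrite mulr_ge0//; first by rewrite ltW// divr_gt0.
  exact: le_trans (sqr_norm_le_dotr _).
rewrite /bregman [dotr (grad _ _) _]dotrBr.
by move: (dotr (x - z) _) => p; lra.
Qed.

Lemma bregman_estimates : exists2 K : R, kappa / 2 <= K &
  [/\ forall x z, Om x -> Om z -> kappa / 2 * `|x - z| ^+ 2 <= bregman x z,
      forall x z, Om x -> Om z -> bregman x z <= K * `|x - z| ^+ 2,
      forall x z, Om x -> Om z -> `|bregman x z - bregman z x| <= K * `|x - z| ^+ 3,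
      forall x x' z, Om x -> Om x' -> Om z -> bregman x z - bregman x' z <= K * `|x - x'| &
      forall x z z', Om x -> Om z -> Om z' -> bregman x z - bregman x z' <= K * `|z - z'|].
Proof.
have [e [M [e0 M0 PB]]] := uniform_partials.
have [B B0 OmB] := bounded_setP bOm.
have [K1 K10 H1] := bregman_upper e0 M0 PB.
have [K2 K20 H2] := bregman_asym e0 M0 PB.
have [K3 K30 H3] := bregman_lip_left e0 M0 PB.
have [K4 K40 H4] := bregman_lip_right e0 M0 PB B0 OmB.
have k2 : 0 <= kappa / 2 by rewrite ltW// divr_gt0.
exists (K1 + K2 + K3 + K4 + kappa / 2); first lra.
split.
- move=> x z _ Omz; apply: le_trans (bregman_lower e0 M0 PB x (subset_closure Omz)).
  by rewrite ler_wpM2l// sqr_norm_le_dotr.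
- move=> x z Omx Omz; apply: (le_trans (H1 x z Omx Omz)); rewrite ler_wpM2r ?exprn_ge0//; lra.
- move=> x z Omx Omz; apply: (le_trans (H2 x z Omx Omz)); rewrite ler_wpM2r ?exprn_ge0//; lra.
- move=> x x' z Omx Omx' Omz; apply: (le_trans (H3 x x' z Omx Omx' Omz)); rewrite ler_wpM2r//; lra.
- move=> x z z' Omx Omz Omz'; apply: (le_trans (H4 x z z' Omx Omz Omz')); rewrite ler_wpM2r//; lra.
Qed.

End Bregman.

(** * Optimality conditions for Schroedinger potentials *)

(** Test with t = c s; the chosen s gives both |t| <= a and K s < 1. *)
Lemma linear_le_quadratic0 {R : realType} (c K a : R) : 0 < a -> 0 <= K ->
  (forall t, `|t| <= a -> t * c <= K * t ^+ 2) -> c = 0.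
Proof.
move=> a0 K0 H; apply/eqP; apply: contraT => c0.
have c0' : 0 < `|c| by rewrite normr_gt0.
have D0 : 0 < K + `|c| / a + 1 by rewrite ltr_wpDl// addr_ge0// ltW// divr_gt0.
pose s := (K + `|c| / a + 1)^-1.
have s0 : 0 < s by rewrite invr_gt0.
have sE : (K + `|c| / a + 1) * s = 1 by rewrite divff// gt_eqF.
have := H (c * s).
have -> : `|c * s| <= a.
  rewrite normrM (gtr0_norm s0) ler_pdivrMr// mulrDr mulrDr mulrCA divff ?gt_eqF// !mulr1.
  by have := mulr_ge0 (ltW a0) K0; lra.
move=> /(_ isT); have -> : c * s * c = s * c ^+ 2 by ring.
have -> : K * (c * s) ^+ 2 = K * s * (s * c ^+ 2) by ring.
have sc : 0 < s * c ^+ 2 by rewrite mulr_gt0// exprn_even_gt0.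
rewrite -[leLHS]mul1r ler_pM2r//.
have : 0 <= `|c| / a * s by rewrite mulr_ge0 ?divr_ge0// ltW.
by move: sE; rewrite !mulrDl mul1r; lra.
Qed.

Lemma expR_le_quadratic {R : realType} (t : R) : t <= 1 / 2 -> expR t <= 1 + t + 2 * t ^+ 2.
Proof.
move=> t2; have p : 0 < 1 - t by lra.
have H : 1 - t <= (expR t)^-1 by rewrite -expRN; exact: expR_ge1Dx.
have e0 := expR_gt0 t.
have : expR t * (1 - t) <= 1 by rewrite -ler_pdivlMl// mulr1.
rewrite -ler_pdivlMr// => /le_trans; apply; rewrite ler_pdivrMr//; nra.
Qed.

Section FirstOrder.
Context {R : realType} {n : nat}.
Variables (mu nu : probability 'rV[R]_n R) (Om Om' : set 'rV[R]_n) (eps : R).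
Hypotheses (mOm : measurable Om) (mOm' : measurable Om') (eps0 : 0 < eps).
Implicit Types f g : 'rV[R]_n -> R.

Definition gibbs f g (w : 'rV[R]_n * 'rV[R]_n) : R :=
  expR ((f w.1 + g w.2 - half_sqr (w.1 - w.2)) / eps).

Let I f g : \bar R := (\int[(mu \x nu)%E]_(w in Om `*` Om') (gibbs f g w)%:E)%E.

Lemma measurable_half_sqr d (T : measurableType d) (h : T -> 'rV[R]_n) :
  measurable_fun setT h -> measurable_fun setT (fun t => half_sqr (h t)).
Proof.
move=> mh; under eq_fun do rewrite half_sqrE.
by apply: measurable_funM; [exact: measurable_dotr|exact: measurable_cst].
Qed.

Lemma measurable_gibbs f g : measurable_fun setT f -> measurable_fun setT g ->
  measurable_fun setT (gibbs f g).
Proof.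
move=> mf mg; rewrite /gibbs.
apply: (measurableT_comp (@measurable_expR R)); apply: measurable_funM; last exact: measurable_cst.
apply: measurable_funB; first by meas.
by apply: measurable_half_sqr; apply: measurable_rV_sub; [exact: measurable_fst|exact: measurable_snd].
Qed.

Let mOO : measurable (Om `*` Om'). Proof. exact: measurableX. Qed.

Let mE (F : 'rV[R]_n * 'rV[R]_n -> R) : measurable_fun setT F ->
  measurable_fun (Om `*` Om') (EFin \o F).
Proof. by move=> mF; apply/measurable_EFinP; exact: measurable_funTS. Qed.

Let mass1 : ((mu \x nu)%E (Om `*` Om') <= 1)%E.
Proof.
rewrite product_measure1E// -[leRHS]mule1; apply: lee_pmul => //; exact: probability_le1.
Qed.

Let I0_le1 : (I (cst 0%R) (cst 0%R) <= 1)%E.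
Proof.
apply: le_trans mass1; rewrite -[leRHS]mul1e -(integral_cst (mu \x nu)%E mOO 1%E).
apply: ge0_le_integral => //.
- by move=> w _; rewrite lee_fin expR_ge0.
- by apply: mE; exact: measurable_gibbs.
- move=> w _; rewrite lee_fin /gibbs /= -[leRHS]expR0 ler_expR.
  rewrite !add0r mulNr oppr_le0 divr_ge0 ?(ltW eps0)//.
  by rewrite half_sqrE divr_ge0// (le_trans _ (sqr_norm_le_dotr _))// sqr_ge0.
Qed.

Variables (f g : 'rV[R]_n -> R).
Hypotheses (mf : measurable_fun setT f) (mg : measurable_fun setT g)
  (pot : schroedinger_potentials mu nu Om Om' eps f g).

Let fi : mu.-integrable Om (EFin \o f). Proof. by case: pot => -[]. Qed.
Let gi : nu.-integrable Om' (EFin \o g). Proof. by case: pot => -[]. Qed.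

(** Otherwise the objective would be -oo, whereas the pair (0, 0) has a finite value, its Gibbs
    integral being at most 1. *)
Let gibbs_finite : (I f g < +oo)%E.
Proof.
have adm0 : dual_admissible mu nu Om Om' (cst 0) (cst 0).
  by split; exact: integrable0.
have := (proj2 pot) _ _ adm0.
have -> : dual_objective mu nu Om Om' eps (cst 0) (cst 0)
    = (- (eps%:E * I (cst 0%R) (cst 0%R)) + eps%:E)%E.
  by rewrite /dual_objective (@integral0 _ _ _ mu) (@integral0 _ _ _ nu) add0e add0e.
rewrite /dual_objective -/(I f g) => H.
rewrite ltNge leye_eq; apply/eqP => Ioo; move: H; rewrite Ioo.
rewrite gt0_muley ?lte_fin//.
have /fineK <- := integrable_fin_num mOm fi; have /fineK <- := integrable_fin_num mOm' gi.
rewrite -EFinD /= addeNy leeNy_eq.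
have I0fin : I (cst 0%R) (cst 0%R) \is a fin_num.
  rewrite ge0_fin_numE; first exact: le_lt_trans I0_le1 (ltry 1).
  by apply: integral_ge0 => w _; rewrite lee_fin expR_ge0.
by rewrite -(fineK I0fin) -EFinM -EFinN -EFinD.
Qed.

Section Perturbation.
Variables (A B : set 'rV[R]_n).
Hypotheses (mA : measurable A) (mB : measurable B) (AOm : A `<=` Om) (BOm : B `<=` Om').

Let h (w : 'rV[R]_n * 'rV[R]_n) : R := \1_A w.1 + \1_B w.2.

Let mh : measurable_fun setT h.
Proof.
by apply: measurable_funD; apply: measurableT_comp => //; exact: measurable_indic.
Qed.

Let h0 w : 0 <= h w. Proof. by rewrite addr_ge0. Qed.
Let h2 w : h w <= 2.
Proof. by rewrite /h !indicE; do 2 case: (_ \in _); rewrite /= ?addr0 ?add0r ?lexx//; lra. Qed.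

Let p := gibbs f g.
Let mp : measurable_fun setT p. Proof. exact: measurable_gibbs. Qed.
Let p0 w : 0 <= p w. Proof. exact: expR_ge0. Qed.
Let H : \bar R := (\int[(mu \x nu)%E]_(w in Om `*` Om') (p w * h w)%:E)%E.
Let ft (t : R) x := f x + eps * t * \1_A x.
Let gt_ (t : R) y := g y + eps * t * \1_B y.

Let gibbsE t w : gibbs (ft t) (gt_ t) w = p w * expR (t * h w).
Proof.
rewrite /p /gibbs -expRD; congr expR; rewrite /ft /gt_ /h.
by field; rewrite gt_eqF.
Qed.

Let integrable_perturb (m : probability 'rV[R]_n R) D C u (t : R) : measurable D -> measurable C ->
  C `<=` D -> m.-integrable D (EFin \o u) ->
  m.-integrable D (EFin \o (fun x => u x + t * \1_C x)) /\
  (\int[m]_(x in D) (u x + t * \1_C x)%:E = \int[m]_(x in D) (u x)%:E + t%:E * m C)%E.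
Proof.
move=> mD mC CD ui.
have iC : m.-integrable D (fun x => t%:E * (\1_C x)%:E)%E.
  apply: integrableZl => //; apply: (@integrableS _ _ _ _ setT) => //.
  exact: integrable_indic.
have E : EFin \o (fun x => u x + t * \1_C x) = ((EFin \o u) \+ (fun x => t%:E * (\1_C x)%:E))%E.
  by apply/funext => x /=; rewrite EFinD EFinM.
split; first by rewrite E; exact: integrableD.
rewrite (_ : (fun x => (u x + t * \1_C x)%:E) = EFin \o (fun x => u x + t * \1_C x))// E.
rewrite integralD// integralZl//; last first.
  by apply: (@integrableS _ _ _ _ setT) => //; exact: integrable_indic.
by rewrite integral_indic// setIidl.
Qed.

(** Perturbing by eps t times the indicators of [A] and [B], optimality gives t (mu A + nu B - H) <=
    8 I t^2 for small t of either sign. A quadratic upper bound on the exponential replaces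
    differentiation under the integral. *)
Lemma gibbs_first_order : H = (mu A + nu B)%E.
Proof.
have I0 : (0 <= I f g)%E by apply: integral_ge0 => w _; rewrite lee_fin.
have Ifin : I f g \is a fin_num by rewrite ge0_fin_numE.
have H0 : (0 <= H)%E by apply: integral_ge0 => w _; rewrite lee_fin mulr_ge0.
have Hfin : H \is a fin_num.
  rewrite ge0_fin_numE//; apply: (@le_lt_trans _ _ (2%:E * I f g)%E); last first.
    by rewrite lte_mul_pinfty.
  rewrite -ge0_integralZl//; last 2 first.
  - exact: mE.
  - by move=> w _; rewrite lee_fin.
  apply: ge0_le_integral => //.
  - by move=> w _; rewrite lee_fin mulr_ge0.
  - by apply: mE; meas.
  - by apply: (@mE (fun w => 2 * p w)); meas.
  - by move=> w _; rewrite -EFinM lee_fin mulrC ler_wpM2r.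
have mAfin : mu A \is a fin_num by exact: fin_num_measure.
have mBfin : nu B \is a fin_num by exact: fin_num_measure.
set i := fine (I f g); set c := fine H; set a := fine (mu A); set b := fine (nu B).
have Ii : I f g = i%:E by rewrite fineK.
have Hc : H = c%:E by rewrite fineK.
have Aa : mu A = a%:E by rewrite fineK.
have Bb : nu B = b%:E by rewrite fineK.
have i0 : 0 <= i by rewrite -lee_fin -Ii.
have c0 : 0 <= c by rewrite -lee_fin -Hc.
have key t : `|t| <= 1 / 4 -> t * (a + b - c) <= 8 * i * t ^+ 2.
  move=> t4.
  have mgt : measurable_fun setT (gibbs (ft t) (gt_ t)).
    by apply: measurable_gibbs; [rewrite /ft|rewrite /gt_]; meas; exact: measurable_indic.
  (* Since h <= 2 and |t| <= 1/4, t h <= 1/2 as [expR_le_quadratic] requires, and 2 (t h)^2 <= 8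
     t^2. *)
  have pt w : gibbs (ft t) (gt_ t) w <= p w * (1 + t * h w + 8 * t ^+ 2).
    rewrite gibbsE ler_wpM2l//; apply: (le_trans (expR_le_quadratic _)).
      move: t4 => /ler_normlP[t1 t2]; have := h0 w; have := h2 w; nra.
    rewrite lerD2l exprMn mulrCA [leRHS]mulrC ler_wpM2l ?sqr_ge0//.
    by have := h0 w; have := h2 w; nra.
  have It : exists2 j, I (ft t) (gt_ t) = j%:E & j - i <= 8 * t ^+ 2 * i + t * c.
    have Ige : (0 <= I (ft t) (gt_ t))%E by apply: integral_ge0 => w _; rewrite lee_fin expR_ge0.
    have t20 : 0 <= 1 + 8 * t ^+ 2 by rewrite addr_ge0// mulr_ge0// sqr_ge0.
    have E1 : (\int[(mu \x nu)%E]_(w in Om `*` Om') ((1 + 8 * t ^+ 2) * p w)%:E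
        = ((1 + 8 * t ^+ 2) * i)%:E)%E.
      under eq_integral do rewrite EFinM.
      rewrite ge0_integralZl//; last 2 first.
      - exact: mE.
      - by move=> w _; rewrite lee_fin.
      by rewrite -/(I f g) Ii.
    have E2 s : 0 <= s -> (\int[(mu \x nu)%E]_(w in Om `*` Om') (s * (p w * h w))%:E
        = (s * c)%:E)%E.
      move=> s0; under eq_integral do rewrite EFinM.
      rewrite ge0_integralZl//; last 2 first.
      - by apply: mE; meas.
      - by move=> w _; rewrite lee_fin mulr_ge0.
      by rewrite -/H Hc.
    (* Splitting by sign keeps all integrands nonnegative: for negative t the linear term moves to
       the other side. *)
    have [t0|/ltW t0] := leP 0 t.
      have le : (I (ft t) (gt_ t) <= ((1 + 8 * t ^+ 2) * i + t * c)%:E)%E.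
        rewrite EFinD -E1 -(E2 _ t0) -ge0_integralD//; last 4 first.
        - by move=> w _; rewrite lee_fin mulr_ge0.
        - by apply: mE; meas.
        - by move=> w _; rewrite lee_fin !mulr_ge0.
        - by apply: mE; meas.
        apply: ge0_le_integral => //.
        - by move=> w _; rewrite lee_fin expR_ge0.
        - exact: mE.
        - by apply: (@mE (fun w => (1 + 8 * t ^+ 2) * p w + t * (p w * h w))); meas.
        - move=> w _; rewrite -EFinD lee_fin; apply: (le_trans (pt w)).
          by rewrite le_eqVlt; apply/orP; left; apply/eqP; ring.
      have Fin : I (ft t) (gt_ t) \is a fin_num.
        by rewrite (ge0_fin_numE Ige); exact: le_lt_trans le (ltry _).
      exists (fine (I (ft t) (gt_ t))); first exact: esym (fineK Fin).
      by move: le; rewrite -{1}(fineK Fin) lee_fin; lra.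
    have nt0 : 0 <= - t by rewrite oppr_ge0.
    have le : (I (ft t) (gt_ t) + (- t * c)%:E <= ((1 + 8 * t ^+ 2) * i)%:E)%E.
      rewrite -E1 -(E2 _ nt0) -ge0_integralD//; last 4 first.
      - by move=> w _; rewrite lee_fin expR_ge0.
      - exact: mE.
      - by move=> w _; rewrite lee_fin !mulr_ge0.
      - by apply: mE; meas.
      apply: ge0_le_integral => //.
      - by move=> w _; rewrite -EFinD lee_fin addr_ge0 ?expR_ge0// !mulr_ge0.
      - by apply: (@mE (fun w => gibbs (ft t) (gt_ t) w + - t * (p w * h w))); meas.
      - by apply: (@mE (fun w => (1 + 8 * t ^+ 2) * p w)); meas.
      - move=> w _; rewrite -EFinD lee_fin -lerBrDr; apply: (le_trans (pt w)).
        by rewrite le_eqVlt; apply/orP; left; apply/eqP; ring.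
    have Fin : I (ft t) (gt_ t) \is a fin_num.
      rewrite (ge0_fin_numE Ige); apply: (@le_lt_trans _ _ (I (ft t) (gt_ t) + (- t * c)%:E)%E).
        by rewrite leeDl// lee_fin mulr_ge0.
      exact: le_lt_trans le (ltry _).
    exists (fine (I (ft t) (gt_ t))); first exact: esym (fineK Fin).
    by move: le; rewrite -{1}(fineK Fin) -EFinD lee_fin; lra.
  have [j Ij ji] := It.
  have [fti ftE] := @integrable_perturb mu Om A f (eps * t) mOm mA AOm fi.
  have [gti gtE] := @integrable_perturb nu Om' B g (eps * t) mOm' mB BOm gi.
  have := (proj2 pot) (ft t) (gt_ t) (conj fti gti).
  rewrite /dual_objective -/(I f g) -/(I (ft t) (gt_ t)) ftE gtE Ij Ii Aa Bb.
  have /fineK <- := integrable_fin_num mOm fi; have /fineK <- := integrable_fin_num mOm' gi.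
  rewrite -!EFinM -!EFinD lee_fin => le.
  have : eps * (t * (a + b) - (j - i)) <= eps * 0 by lra.
  by rewrite ler_pM2l//; lra.
have : a + b - c = 0.
  apply: (@linear_le_quadratic0 R _ (8 * i) (1 / 4)); [lra| |exact: key].
  exact: mulr_ge0.
by move=> E; rewrite Hc Aa Bb -EFinD; congr EFin; lra.
Qed.

End Perturbation.

Let restrict_in d (T : measurableType d) (m : {measure set T -> \bar R}) (D C : set T)
    (F : T -> \bar R) (F0 : forall x, (0 <= F x)%E) : C `<=` D ->
  (\int[m]_(x in D) (F x * (\1_C x)%:E) = \int[m]_(x in C) F x)%E.
Proof.
move=> CD; rewrite integral_mkcond [RHS]integral_mkcond; apply: eq_integral => x _.
rewrite !patchE indicE; case: (boolP (x \in C)) => xC /=.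
  by rewrite ifT ?mule1// inE; apply: CD; rewrite -inE.
by rewrite mule0; case: ifP.
Qed.

Let ae_one (m : probability 'rV[R]_n R) (D : set 'rV[R]_n) (q : 'rV[R]_n -> \bar R) :
  measurable D -> measurable_fun D q ->
  (forall C, C `<=` D -> measurable C -> \int[m]_(x in C) q x = m C)%E ->
  exists2 N, measurable N /\ m N = 0%E & forall x, D x -> ~ N x -> q x = 1%E.
Proof.
move=> mD mq H.
have i1 : m.-integrable D (cst 1%E).
  apply/integrableP; split; first exact: measurable_cst.
  rewrite (eq_integral (cst 1%E)) => [|x _]; last by rewrite /= normr1.
  rewrite (integral_cst m mD 1%E) mul1e; exact: le_lt_trans (probability_le1 m mD) (ltry 1).
have [|N [mN N0 sub]] := @integral_ae_eq _ _ _ m D mD q _ i1 mq.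
  by move=> C CD mC; rewrite (integral_cst m mC 1%E) mul1e H.
exists N => // x Dx nN; apply: contrapT => nq; apply: nN; apply: sub => /=.
by move=> /(_ Dx)/esym.
Qed.

Let mI (C : set 'rV[R]_n) : measurable C -> measurable_fun setT (\1_C : 'rV[R]_n -> R).
Proof. by move=> mC; exact: measurable_indic. Qed.

(** With the second set empty, the first-order condition says that the inner integral has the same
    integral as 1 over every measurable subset of [Om]; [ae_one] concludes. *)
Lemma gibbs_marginal1 : exists2 N, measurable N /\ mu N = 0%E &
  forall x, Om x -> ~ N x -> (\int[nu]_(y in Om') (gibbs f g (x, y))%:E = 1)%E.
Proof.
have mk := measurable_gibbs mf mg.
have k0 w : 0 <= gibbs f g w by exact: expR_ge0.
apply: ae_one => //; first exact: tonelli_inner_measurable.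
move=> C CD mC; have := gibbs_first_order mC measurable0 CD (@sub0set _ _).
rewrite measure0 adde0 => <-.
have mkh : measurable_fun setT (fun w : 'rV[R]_n * 'rV[R]_n =>
    gibbs f g w * (\1_C w.1 + \1_set0 w.2)).
  apply: measurable_funM; first exact: mk.
  by apply: measurable_funD; [exact: (measurableT_comp (mI mC) measurable_fst)
    |exact: (measurableT_comp (mI measurable0) measurable_snd)].
have kh0 x y : Om x -> Om' y -> 0 <= gibbs f g (x, y) * (\1_C x + \1_set0 y).
  by move=> _ _; rewrite mulr_ge0// addr_ge0.
rewrite (tonelli_in _ _ mOm mOm' mkh kh0).
rewrite -(@restrict_in _ _ _ Om C) => //; last first.
  by move=> x; apply: integral_ge0 => y _; rewrite lee_fin.
apply: eq_integral => x _; rewrite -ge0_integralZr//; last 2 first.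
- by apply/measurable_EFinP; apply: measurable_funTS; exact: (measurableT_comp mk (measurable_pair1 x)).
- by move=> y _; rewrite lee_fin.
by apply: eq_integral => y _; rewrite indic0 addr0 EFinM.
Qed.

Lemma gibbs_marginal2 : exists2 N, measurable N /\ nu N = 0%E &
  forall y, Om' y -> ~ N y -> (\int[mu]_(x in Om) (gibbs f g (x, y))%:E = 1)%E.
Proof.
have mk := measurable_gibbs mf mg.
have k0 w : 0 <= gibbs f g w by exact: expR_ge0.
have mk' : measurable_fun setT (fun w : 'rV[R]_n * 'rV[R]_n => gibbs f g (w.2, w.1)).
  by apply: (measurableT_comp mk); exact: measurable_swap.
apply: ae_one => //; first exact: (tonelli_inner_measurable mu mOm' mOm mk').
move=> C CD mC; have := gibbs_first_order measurable0 mC (@sub0set _ _) CD.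
rewrite measure0 add0e => <-.
have mkh : measurable_fun setT (fun w : 'rV[R]_n * 'rV[R]_n =>
    gibbs f g w * (\1_set0 w.1 + \1_C w.2)).
  apply: measurable_funM; first exact: mk.
  by apply: measurable_funD; [exact: (measurableT_comp (mI measurable0) measurable_fst)
    |exact: (measurableT_comp (mI mC) measurable_snd)].
have kh0 x y : Om x -> Om' y -> 0 <= gibbs f g (x, y) * (\1_set0 x + \1_C y).
  by move=> _ _; rewrite mulr_ge0// addr_ge0.
rewrite (tonelli_in _ _ mOm mOm' mkh kh0) (tonelli_in_swap _ _ mOm mOm' mkh kh0).
rewrite -(@restrict_in _ _ _ Om' C) => //; last first.
  by move=> y; apply: integral_ge0 => x _; rewrite lee_fin.
apply: eq_integral => y _; rewrite -ge0_integralZr//; last 2 first.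
- by apply/measurable_EFinP; apply: measurable_funTS; exact: (measurableT_comp mk (measurable_pair2 y)).
- by move=> x _; rewrite lee_fin.
by apply: eq_integral => x _; rewrite indic0 add0r EFinM.
Qed.

End FirstOrder.

(** Potentials are known to be measurable only on their domains; extension by zero makes them
    measurable everywhere and changes neither the objective nor optimality. *)
Lemma potentials_restrict {R : realType} {n : nat} (mu nu : probability 'rV[R]_n R)
    (Om Om' : set 'rV[R]_n) (eps : R) f g : measurable Om -> measurable Om' ->
  schroedinger_potentials mu nu Om Om' eps f g ->
  schroedinger_potentials mu nu Om Om' eps (f \_ Om) (g \_ Om').
Proof.
move=> mOm mOm' [[fi gi] pot].
have E : dual_objective mu nu Om Om' eps (f \_ Om) (g \_ Om')
    = dual_objective mu nu Om Om' eps f g.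
  rewrite /dual_objective; congr (_ + _ - _ * _ + _)%E.
  - by apply: eq_integral => x xOm; rewrite patchE xOm.
  - by apply: eq_integral => x xOm; rewrite patchE xOm.
  - by apply: eq_integral => -[x y]; rewrite in_setX => /andP[/= xOm yOm]; rewrite !patchE xOm yOm.
split; last by move=> f' g' /pot; rewrite E.
split.
- by apply: eq_integrable fi => // x xOm; rewrite /= patchE xOm.
- by apply: eq_integrable gi => // x xOm; rewrite /= patchE xOm.
Qed.

(** * Transport by the gradient *)

Lemma open_sigma_compact {R : realType} {d : nat} (Om : set 'rV[R]_d.+1) :
  open Om -> bounded_set Om ->
  exists K : nat -> set 'rV[R]_d.+1, (forall k, compact (K k)) /\ \bigcup_k K k = Om.
Proof.
move=> oOm bOm.
pose K k : set 'rV[R]_d.+1 := [set x | forall y, `|x - y| < k.+1%:R^-1 -> Om y].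
exists K; split; last first.
  apply/seteqP; split=> [x [k _ Kx]|x Omx].
    by apply: Kx; rewrite subrr normr0 invr_gt0.
  move: (oOm); rewrite openE => /(_ _ Omx) /nbhs_ballP[e /= e0 sub].
  have [k ke] := ltr_add_invr e0; rewrite add0r in ke.
  by exists k => // y xy; apply: sub; rewrite -ball_normE /=; exact: lt_trans ke.
move=> k; apply: bounded_closed_compact.
  have [M [Mr HM]] := bOm; exists M; split=> // N MN x Kx; apply: (HM N MN).
  by apply: Kx; rewrite subrr normr0 invr_gt0.
rewrite -openC openE => x /= nKx.
have [y [xy nOmy]] : exists y, `|x - y| < k.+1%:R^-1 /\ ~ Om y.
  apply: contrapT => nex; apply: nKx => y xy; apply: contrapT => nOmy.
  by apply: nex; exists y.
have e0 : 0 < k.+1%:R^-1 - `|x - y| by rewrite subr_gt0.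
apply/nbhs_ballP; exists (k.+1%:R^-1 - `|x - y|) => //= z; rewrite -ball_normE /= => xz Kz.
apply: nOmy; apply: Kz; rewrite (_ : z - y = (x - y) - (x - z)); last first.
  by rewrite opprB [RHS]addrC subrKA.
rewrite (le_lt_trans (ler_normB _ _))//.
by move: xz; rewrite ltrBrDl.
Qed.

Section Transport.
Context {R : realType} {d : nat}.
Local Notation n := d.+1.
Variables (mu nu : probability 'rV[R]_n R) (Om : set 'rV[R]_n) (T : 'rV[R]_n -> 'rV[R]_n).
Hypotheses (oOm : open Om) (bOm : bounded_set Om) (muOm : mu Om = 1%E)
  (cT : forall i x, Om x -> {for x, continuous (fun u => T u 0 i)})
  (hnu : forall A, measurable A -> nu A = mu (Om `&` T @^-1` A)).

Let mOm : measurable Om. Proof. exact: open_measurable_rV. Qed.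

Let contT x : Om x -> {for x, continuous T}.
Proof.
move=> Omx.
apply: (proj2 (@cvgrPdist_le R 'rV[R]_n _ (nbhs x) (nbhs_filter x) T (T x))) => e e0.
have : \forall u \near x, forall i, `|T x 0 i - T u 0 i| <= e.
  apply: (@filter_forall _ _ _ (nbhs x) (nbhs_filter x)) => i.
  by have /cvgrPdist_le/(_ e e0) := cT (i := i) Omx.
apply: filterS => u Tu; apply/rV_norm_leP; first exact: ltW.
by move=> i; have := Tu i; rewrite !mxE.
Qed.

(** An open bounded set is a countable union of compacts, so its continuous image is a countable
    union of compact, hence closed, sets. *)
Lemma measurable_image_open : measurable (T @` Om).
Proof.
have [K [cK KE]] := open_sigma_compact oOm bOm.
have KOm k : K k `<=` Om by rewrite -KE; exact: bigcup_sup.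
rewrite -KE image_bigcup; apply: bigcup_measurable => k _.
rewrite -[T @` _]setCK; apply: measurableC; apply: open_measurable_rV; rewrite openC.
apply: compact_closed; first exact: norm_hausdorff.
apply: continuous_compact => //; apply: continuous_in_subspaceT => x; rewrite inE => /KOm.
exact: contT.
Qed.

(** The gradient is controlled only on [Om]; the cut-off gives a map measurable on the whole space,
    with the same push-forward of [mu]. *)
Definition truncated_map x : 'rV[R]_n := if x \in Om then T x else 0.

Local Notation T' := truncated_map.

Lemma truncated_mapE x : Om x -> T' x = T x.
Proof. by move=> Omx; rewrite /truncated_map mem_set. Qed.

Lemma measurable_truncated_map : measurable_fun setT T'.
Proof.
apply: measurable_fun_coord => i.
have -> : (fun t => T' t 0 i) = (fun t => T t 0 i) \_ Om.
  by apply/funext => t; rewrite patchE /truncated_map; case: ifP => //; rewrite mxE.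
apply/(measurable_restrictT _ _).1; first exact: mOm.
by apply: open_measurable_fun => // x; exact: cT.
Qed.

Let nuE A : measurable A -> nu A = mu (T' @^-1` A).
Proof.
move=> mA; rewrite hnu//.
have mTA : measurable (T' @^-1` A).
  by rewrite -[_ @^-1` _]setTI; exact: measurable_truncated_map.
have muC : mu (~` Om) = 0%E by rewrite probability_setC// muOm subee.
have -> : Om `&` T @^-1` A = T' @^-1` A `&` Om.
  apply/seteqP; split=> x /=; first by move=> [Omx Ax]; rewrite truncated_mapE.
  by move=> [Ax Omx]; move: Ax; rewrite truncated_mapE.
apply/le_anti/andP; split.
  by apply: le_measure; rewrite ?inE//; exact: measurableI.
have -> : mu (T' @^-1` A `&` Om) = (mu (T' @^-1` A `&` Om) + mu (~` Om))%E by rewrite muC adde0.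
have mI : measurable (T' @^-1` A `&` Om) by exact: measurableI.
have mC : measurable (~` Om) by exact: measurableC.
apply: le_trans (measureU2 mu mI mC); apply: le_measure; rewrite ?inE//.
  exact: measurableU.
by move=> x Ax; have [Omx|nOmx] := pselect (Om x); [left|right].
Qed.

Lemma integral_transport (G : 'rV[R]_n -> \bar R) :
  measurable_fun (T @` Om) G -> (forall y, (T @` Om) y -> 0 <= G y)%E ->
  (\int[nu]_(y in T @` Om) G y = \int[mu]_(z in Om) G (T z))%E.
Proof.
move=> mG G0; have mIm := measurable_image_open.
have -> : (\int[nu]_(y in T @` Om) G y
    = \int[pushforward mu T']_(y in T @` Om) G y)%E.
  apply: eq_measure_integral => [|mT A mA _]; [exact: measurable_truncated_map|exact: nuE].
rewrite (ge0_integral_pushforward measurable_truncated_map)//; last first.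
  by move=> y; rewrite inE; exact: G0.
have sub : Om `<=` T' @^-1` (T @` Om).
  by move=> x Omx; rewrite /preimage /= truncated_mapE//; exists x.
have mpre : measurable (T' @^-1` (T @` Om)).
  by rewrite -[_ @^-1` _]setTI; exact: measurable_truncated_map.
have muC : mu (~` Om) = 0%E by rewrite probability_setC// muOm subee.
rewrite (ge0_negligible_integral (N := ~` Om))//; last 3 first.
- exact: measurableC.
- apply: (measurable_comp mIm _ mG); first by move=> _ [x hx <-].
  exact: measurable_funTS measurable_truncated_map.
- by move=> x /=; exact: G0.
have -> : T' @^-1` (T @` Om) `\` ~` Om = Om.
  by rewrite setDE setCK setIidr.
by apply: eq_integral => x; rewrite inE => Omx; rewrite /= truncated_mapE.
Qed.

Lemma double_integral_transport (F : 'rV[R]_n * 'rV[R]_n -> R) :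
  measurable_fun setT F -> (forall w, 0 <= F w) ->
  (\int[(mu \x nu)%E]_(w in Om `*` (T @` Om)) (F w)%:E
    = \int[(mu \x mu)%E]_(w in Om `*` Om) (F (w.1, T' w.2))%:E)%E.
Proof.
move=> mF F0; have mIm := measurable_image_open.
have mF' : measurable_fun setT (fun w : 'rV[R]_n * 'rV[R]_n => F (w.1, T' w.2)).
  apply: (measurableT_comp mF); apply: measurable_fun_pair; first exact: measurable_fst.
  exact: (measurableT_comp measurable_truncated_map measurable_snd).
rewrite (tonelli_in mu nu mOm mIm mF) ?(tonelli_in mu mu mOm mOm mF')//.
apply: eq_integral => x _; rewrite (integral_transport (G := fun y => (F (x, y))%:E)).
- by apply: eq_integral => z; rewrite inE => Omz; rewrite truncated_mapE.
- apply/measurable_EFinP; apply: measurable_funTS.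
  exact: (measurableT_comp mF (measurable_pair1 x)).
- by move=> y _; rewrite lee_fin.
Qed.

Lemma integrable_transport (g : 'rV[R]_n -> R) : measurable_fun setT g ->
  nu.-integrable (T @` Om) (EFin \o g) -> mu.-integrable Om (EFin \o (g \o T')).
Proof.
move=> mg /integrableP[_ gfin]; have mT := measurable_truncated_map.
apply/integrableP; split.
  by apply/measurable_EFinP; apply: measurable_funTS; exact: measurableT_comp.
rewrite (eq_integral (fun z => `|(g (T z))%:E|)%E).
  rewrite -(integral_transport (G := fun y => `|(g y)%:E|)%E)//.
  apply: measurableT_comp => //; apply/measurable_EFinP; exact: measurable_funTS.
by move=> z; rewrite inE => Omz; rewrite /= truncated_mapE.
Qed.

End Transport.

(** * Comparison with Lebesgue measure *)

(** The measures are compared only inside [D]; restricting both to [D] makes the comparison hold for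
    all sets without changing the integrals. *)
Lemma le_measure_integral_in d (T : measurableType d) (R : realType)
    (m1 m2 : {measure set T -> \bar R}) (D : set T) (f : T -> \bar R) :
  measurable D -> (forall A, A `<=` D -> measurable A -> (m1 A <= m2 A)%E) ->
  measurable_fun D f -> (forall x, D x -> 0 <= f x)%E ->
  (\int[m1]_(x in D) f x <= \int[m2]_(x in D) f x)%E.
Proof.
move=> mD m12 mf f0.
have mr (m : {measure set T -> \bar R}) :
    (\int[m]_(x in D) f x = \int[mrestr m mD]_(x in D) (f \_ D) x)%E.
  transitivity (\int[m]_(x in D) (f \_ D) x)%E.
    by apply: eq_integral => x xD; rewrite patchE xD.
  apply: eq_measure_integral => A mA AD; rewrite /= /mrestr.
  by congr (m _); apply/esym/setIidl.
rewrite !mr; apply: ge0_le_measure_integral => //.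
- move=> S mS; rewrite /= /mrestr; apply: m12; first exact: subIsetr.
  exact: measurableI.
- by move=> x; rewrite patchE; case: ifPn => //; rewrite inE; exact: f0.
- by apply/(measurable_restrictT _ _).1.
Qed.

Section FullMeasure.
Context {R : realType} {d : nat}.
Local Notation n := d.+1.
Variables (mu : probability 'rV[R]_n R) (X Y : set 'rV[R]_n).
Hypotheses (mX : measurable X) (mY : measurable Y) (YX : Y `<=` X) (XY0 : mu (X `\` Y) = 0%E).

Lemma integral_full (h : 'rV[R]_n -> \bar R) : measurable_fun X h ->
  (forall x, X x -> 0 <= h x)%E ->
  (\int[mu]_(x in X) h x = \int[mu]_(x in Y) h x)%E.
Proof.
move=> mh h0; rewrite (ge0_negligible_integral (N := X `\` Y))//; last exact: measurableD.
by rewrite setDD setIidr.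
Qed.

Lemma dint_full (F : 'rV[R]_n * 'rV[R]_n -> R) : measurable_fun setT F -> (forall w, 0 <= F w) -> dint mu X F = dint mu Y F.
Proof.
move=> mF F0; rewrite /dint (tonelli_in mu mu mX mX mF (fun x z _ _ => F0 (x, z))).
rewrite (tonelli_in mu mu mY mY mF (fun x z _ _ => F0 (x, z))) integral_full; last 2 first.
- exact: (tonelli_inner_measurable mu mX mX mF (fun x z _ _ => F0 (x, z))).
- by move=> x _; apply: integral_ge0 => z _; rewrite lee_fin.
apply: eq_integral => x _; apply: integral_full.
- apply/measurable_EFinP; apply: measurable_funTS.
  exact: (measurableT_comp mF (measurable_pair1 x)).
- by move=> z _; rewrite lee_fin.
Qed.

End FullMeasure.

Section Density.
Context {R : realType} {d : nat}.
Local Notation n := d.+1.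
Local Notation L := (@lebesgue_rV R n).
Variables (mu : probability 'rV[R]_n R) (Om : set 'rV[R]_n) (rho : 'rV[R]_n -> R) (lam Lam : R).
Hypotheses (mOm : measurable Om) (lam0 : 0 < lam) (mrho : measurable_fun Om rho)
  (lam_rho : forall x, Om x -> lam <= rho x) (rho_Lam : forall x, Om x -> rho x <= Lam)
  (Lam0 : 0 <= Lam)
  (hmu : forall A, measurable A -> mu A = (\int[L]_(x in A `&` Om) (rho x)%:E)%E).

Let rho0 x : Om x -> 0 <= rho x.
Proof. by move=> /lam_rho; exact: le_trans (ltW lam0). Qed.

Lemma density_ge A : A `<=` Om -> measurable A -> (lam%:E * L A <= mu A)%E.
Proof.
move=> AOm mA; rewrite hmu// setIidl// -(integral_cst L mA).
apply: ge0_le_integral => //.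
- by move=> x _; rewrite lee_fin ltW.
- by apply/measurable_EFinP; apply: measurable_funS mrho.
- by move=> x Ax; rewrite lee_fin; exact/lam_rho/AOm.
Qed.

Lemma density_le A : measurable A -> (mu A <= Lam%:E * L (A `&` Om))%E.
Proof.
move=> mA; have mI : measurable (A `&` Om) by exact: measurableI.
rewrite hmu// -(integral_cst L mI).
apply: ge0_le_integral => //.
- by move=> x [_ Omx]; rewrite lee_fin rho0.
- by apply/measurable_EFinP; apply: measurable_funS mrho => // x [].
- by move=> x [_ Omx]; rewrite lee_fin rho_Lam.
Qed.

Lemma density_cube (a : 'rV[R]_n) (r : R) : 0 < r ->
  (mu [set x : 'rV[R]_n | forall i, (a 0 i <= x 0 i < a 0 i + r)%R] <= (Lam * r ^+ n)%:E)%E.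
Proof.
move=> r0; have mc := measurable_cube a r.
apply: (le_trans (density_le mc)); rewrite EFinM -(lebesgue_rV_cube a (ltW r0)).
apply: lee_wpmul2l; first by rewrite lee_fin.
by apply: le_measure; rewrite ?inE//; exact: measurableI.
Qed.

Lemma density_integral_ge (h : 'rV[R]_n -> \bar R) : measurable_fun Om h ->
  (forall x, Om x -> 0 <= h x)%E ->
  (lam%:E * \int[L]_(x in Om) h x <= \int[mu]_(x in Om) h x)%E.
Proof.
move=> mh h0; rewrite (_ : lam%:E = (NngNum (ltW lam0))%:num%:E)//.
rewrite -ge0_integral_mscale//; apply: le_measure_integral_in => //.
exact: density_ge.
Qed.

Lemma density_integral_le (h : 'rV[R]_n -> \bar R) : measurable_fun Om h ->
  (forall x, Om x -> 0 <= h x)%E ->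
  (\int[mu]_(x in Om) h x <= Lam%:E * \int[L]_(x in Om) h x)%E.
Proof.
move=> mh h0; rewrite (_ : Lam%:E = (NngNum Lam0)%:num%:E)//.
rewrite -ge0_integral_mscale//; apply: le_measure_integral_in => //.
by move=> A AOm mA; have := density_le mA; rewrite setIidl.
Qed.

Let mF1 (F : 'rV[R]_n * 'rV[R]_n -> R) x : measurable_fun setT F -> measurable_fun Om (fun z => (F (x, z) : R)%:E).
Proof.
move=> mF; apply/measurable_EFinP; apply: measurable_funTS.
exact: (measurableT_comp mF (measurable_pair1 x)).
Qed.

Lemma dint_le_lebesgue (F : 'rV[R]_n * 'rV[R]_n -> R) : measurable_fun setT F -> (forall w, 0 <= F w) ->
  (dint mu Om F <= (Lam ^+ 2)%:E * \int[L]_(x in Om) \int[L]_(z in Om) (F (x, z))%:E)%E.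
Proof.
move=> mF F0; rewrite /dint (tonelli_in mu mu mOm mOm mF)//.
have mL := tonelli_inner_measurable L mOm mOm mF (fun x z _ _ => F0 (x, z)).
have mM := tonelli_inner_measurable mu mOm mOm mF (fun x z _ _ => F0 (x, z)).
have i0 (m : {measure set 'rV[R]_n -> \bar R}) x : (0 <= \int[m]_(z in Om) (F (x, z))%:E)%E.
  by apply: integral_ge0 => z _; rewrite lee_fin.
apply: (@le_trans _ _ (\int[mu]_(x in Om) (Lam%:E * \int[L]_(z in Om) (F (x, z))%:E))%E).
  apply: ge0_le_integral => //.
  - exact: measurable_funeM.
  - by move=> x _; apply: density_integral_le => //; [exact: mF1|move=> z _; rewrite lee_fin].
rewrite ge0_integralZl// expr2 EFinM -muleA; apply: lee_wpmul2l; first by rewrite lee_fin.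
exact: density_integral_le.
Qed.

Lemma lebesgue_le_dint (F : 'rV[R]_n * 'rV[R]_n -> R) : measurable_fun setT F -> (forall w, 0 <= F w) ->
  ((lam ^+ 2)%:E * \int[L]_(x in Om) \int[L]_(z in Om) (F (x, z))%:E <= dint mu Om F)%E.
Proof.
move=> mF F0; rewrite /dint (tonelli_in mu mu mOm mOm mF)//.
have mL := tonelli_inner_measurable L mOm mOm mF (fun x z _ _ => F0 (x, z)).
have mM := tonelli_inner_measurable mu mOm mOm mF (fun x z _ _ => F0 (x, z)).
have i0 (m : {measure set 'rV[R]_n -> \bar R}) x : (0 <= \int[m]_(z in Om) (F (x, z))%:E)%E.
  by apply: integral_ge0 => z _; rewrite lee_fin.
apply: (@le_trans _ _ (\int[mu]_(x in Om) (lam%:E * \int[L]_(z in Om) (F (x, z))%:E))%E); last first.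
  apply: ge0_le_integral => //.
  - by move=> x _; rewrite mule_ge0// lee_fin ltW.
  - exact: measurable_funeM.
  - by move=> x _; apply: density_integral_ge => //; [exact: mF1|move=> z _; rewrite lee_fin].
rewrite ge0_integralZl//; last by rewrite lee_fin ltW.
rewrite expr2 EFinM -muleA; apply: lee_wpmul2l; first by rewrite lee_fin ltW.
exact: density_integral_ge.
Qed.

End Density.

(** The continuous extension of the density is bounded on the compact closure. *)
Lemma bounded_of_closure_extension {R : realType} {d : nat} (k : nat) (alpha : R)
    (Om : set 'rV[R]_d.+1) (rho : 'rV[R]_d.+1 -> R) : bounded_set Om ->
  Ck_holder_closure k alpha Om rho ->
  exists2 Lam : R, 0 <= Lam & forall x, Om x -> rho x <= Lam.
Proof.
move=> bOm [_ /(_ [::] isT)[g [cg gE]] _].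
have := continuous_compact cg (closure_compact_rV bOm) => /compact_bounded[M [Mr HM]].
exists (`|M| + 1); first by rewrite addr_ge0.
move=> x Omx; rewrite -[rho x](gE x Omx); apply: (le_trans (ler_norm _)).
apply: (HM (`|M| + 1)); first by rewrite ltr_pwDr// ler_norm.
by exists x => //; exact: subset_closure.
Qed.

(* The supremum defining the conjugate is attained in Om at the points of grad phi (Om);
   restricting it to the bounded set Om makes it Lipschitz on the whole space. *)
Lemma measurable_conjugate {R : realType} {d : nat} (Om : set 'rV[R]_d.+1)
    (phi : 'rV[R]_d.+1 -> R) (B M : R) : Om !=set0 ->
  (forall x, Om x -> `|x| <= B) -> (forall x, Om x -> `|phi x| <= M) ->
  (forall x z, Om x -> Om z -> 0 <= bregman phi x z) ->
  exists2 c : 'rV[R]_d.+1 -> R, measurable_fun setT c &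
    forall z, Om z -> c (grad phi z) = dotr (grad phi z) z - phi z.
Proof.
move=> [x0 Omx0] OmB OmM pos.
have B0 : 0 <= B by apply: le_trans (OmB _ Omx0).
pose S y := [set dotr y x - phi x | x in Om].
have S0 y : S y !=set0 by exists (dotr y x0 - phi x0); exists x0.
have Sub y : has_ubound (S y).
  exists (d.+1%:R * (`|y| * B) + M) => _ [x Omx <-].
  apply: (le_trans (ler_norm _)); rewrite (le_trans (ler_normB _ _))// lerD ?OmM//.
  apply: (le_trans (dotr_le _ _)); rewrite ler_wpM2l// ler_wpM2l//.
  exact: OmB.
have lip y y' : sup (S y) <= sup (S y') + d.+1%:R * B * `|y - y'|.
  apply: ge_sup => // _ [x Omx <-].
  have -> : dotr y x - phi x = (dotr y' x - phi x) + dotr (y - y') x.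
    by rewrite dotrBl; ring.
  apply: lerD; first by apply: ub_le_sup => //; exists x.
  apply: (le_trans (ler_norm _)); apply: (le_trans (dotr_le _ _)).
  by rewrite -mulrA ler_wpM2l// mulrC ler_wpM2r// OmB.
exists (fun y => sup (S y)); last first.
  move=> z Omz; apply/le_anti/andP; split; last by apply: ub_le_sup => //; exists z.
  apply: ge_sup => // _ [x Omx <-].
  by have := pos x z Omx Omz; rewrite /bregman dotrBr; lra.
apply: open_measurable_fun => [|y _]; first exact: openT.
apply: (proj2 (@cvgrPdist_le R R _ (nbhs y) (nbhs_filter y) (fun y => sup (S y)) (sup (S y)))) => e e0.
have D0 : 0 < d.+1%:R * B + 1 by rewrite ltr_wpDl// mulr_ge0.
have /nbhs_ballP : nbhs y (ball y (e / (d.+1%:R * B + 1))).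
  by apply: nbhsx_ballx; rewrite divr_gt0.
move=> [r /= r0 rP]; apply/nbhs_ballP; exists r => // u /rP.
rewrite -ball_normE /= ltr_pdivlMr// => yu.
have le : d.+1%:R * B * `|y - u| <= e.
  by move: yu; rewrite mulrDr mulr1 mulrC; have := normr_ge0 (y - u); lra.
apply/ler_normlP; split.
  by have := lip u y; rewrite distrC; lra.
by have := lip y u; lra.
Qed.

(** * The rescaled potentials *)

Section Potentials.
Context {R : realType} {d : nat}.
Local Notation n := d.+1.
Variables (mu nu : probability 'rV[R]_n R) (Om : set 'rV[R]_n) (phi c f g : 'rV[R]_n -> R)
  (eps r M B : R).
Local Notation T := (grad phi).
Local Notation T' := (truncated_map Om T).
Hypotheses (oOm : open Om) (bOm : bounded_set Om) (muOm : mu Om = 1%E)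
  (cphi : forall x, Om x -> {for x, continuous phi})
  (cT : forall i x, Om x -> {for x, continuous (fun u => T u 0 i)})
  (hnu : forall A, measurable A -> nu A = mu (Om `&` T @^-1` A))
  (eps0 : 0 < eps) (epsE : r ^+ 2 = eps)
  (mf : measurable_fun setT f) (mg : measurable_fun setT g) (mc : measurable_fun setT c)
  (cE : forall z, Om z -> c (T z) = dotr (T z) z - phi z)
  (pot : schroedinger_potentials mu nu Om (T @` Om) eps f g)
  (OmB : forall x, Om x -> `|x| <= B)
  (OmM : forall x, Om x -> `|phi x| <= M /\ `|T x| <= M).

Let mOm : measurable Om. Proof. exact: open_measurable_rV. Qed.
Let mIm : measurable (T @` Om). Proof. exact: measurable_image_open. Qed.
Let mT : measurable_fun setT T'. Proof. exact: measurable_truncated_map. Qed.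

Lemma measurable_truncated_phi : measurable_fun setT (phi \_ Om).
Proof.
apply/(measurable_restrictT _ _).1; first exact: mOm.
exact: open_measurable_fun.
Qed.
Let mphi := measurable_truncated_phi.

Definition truncated_bregman x z := (phi \_ Om) x - (phi \_ Om) z - dotr (T' z) (x - z).

Lemma truncated_bregmanE x z : Om x -> Om z -> truncated_bregman x z = bregman phi x z.
Proof.
by move=> Omx Omz; rewrite /truncated_bregman !patchE !mem_set// truncated_mapE.
Qed.

Lemma measurable_truncated_bregman :
  measurable_fun setT (fun w : 'rV[R]_n * 'rV[R]_n => truncated_bregman w.1 w.2).
Proof.
apply: measurable_funB; first by meas.
apply: measurable_dotr; first exact: (measurableT_comp mT measurable_snd).
exact: measurable_rV_sub.
Qed.

Definition scaled_left x := (half_sqr x - f x - (phi \_ Om) x) / eps.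
(** [c] is a measurable real-valued function that agrees with the conjugate of [phi] on the image of
    [Om]. *)
Definition right_gap y := half_sqr y - g y - c y.
Definition scaled_right z := right_gap (T' z) / eps.
Local Notation U := scaled_left.
Local Notation W := scaled_right.

Lemma measurable_scaled_left : measurable_fun setT U.
Proof.
apply: measurable_funM; last exact: measurable_cst.
by do 2 (apply: measurable_funB => //); exact: measurable_half_sqr.
Qed.

Lemma measurable_right_gap : measurable_fun setT right_gap.
Proof. by do 2 (apply: measurable_funB => //); exact: measurable_half_sqr. Qed.

Lemma measurable_scaled_right : measurable_fun setT W.
Proof.
apply: measurable_funM; last exact: measurable_cst.
exact: (measurableT_comp measurable_right_gap mT).
Qed.

(** Expanding the squares, the cross term <x, T z> combines with phi(x) and c(T z) into minus the
    Bregman divergence: pulling back by T turns the Gibbs density into [wgt]. *)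
Let gibbs_wgt x z : Om x -> Om z ->
  gibbs eps f g (x, T z) = wgt truncated_bregman r U W (x, z).
Proof.
move=> Omx Omz; rewrite /gibbs /wgt /= truncated_bregmanE// epsE; congr expR.
rewrite /scaled_right /right_gap truncated_mapE// /scaled_left patchE mem_set//.
rewrite cE// /bregman !half_sqrE !(dotrBr, dotrBl) [dotr x (T z)]dotrC.
by field; rewrite gt_eqF.
Qed.

(** Two null sets are removed: the one for the first marginal, and the preimage under T of the one
    for the second, which is [mu]-null because [nu] is the push-forward. *)
Lemma full_marginals : exists Y, [/\ Y `<=` Om, measurable Y, mu (Om `\` Y) = 0%E,
  forall x, Y x -> (\int[mu]_(z in Y) (wgt truncated_bregman r U W (x, z))%:E = 1)%E &
  forall z, Y z -> (\int[mu]_(x in Y) (wgt truncated_bregman r U W (x, z))%:E = 1)%E].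
Proof.
have [N1 [mN1 N10] H1] := gibbs_marginal1 mOm mIm eps0 mf mg pot.
have [N2 [mN2 N20] H2] := gibbs_marginal2 mOm mIm eps0 mf mg pot.
have mN2' : measurable (T' @^-1` N2) by rewrite -[_ @^-1` _]setTI; exact: mT.
pose Y := Om `\` (N1 `|` T' @^-1` N2).
have YOm : Y `<=` Om by move=> x [].
have mN : measurable (N1 `|` T' @^-1` N2) by exact: measurableU.
have mY : measurable Y by exact: measurableD.
have OmY0 : mu (Om `\` Y) = 0%E.
  have sub : Om `\` Y `<=` N1 `|` (Om `&` T' @^-1` N2).
    move=> x [Omx nYx]; apply: contrapT => nx; apply: nYx; split=> // -[N1x|N2x].
      by apply: nx; left.
    by apply: nx; right.
  have N2E : Om `&` T' @^-1` N2 = Om `&` T @^-1` N2.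
    by apply/seteqP; split=> x [Omx /= h]; split=> //; move: h; rewrite /= truncated_mapE.
  have mI : measurable (Om `&` T' @^-1` N2) by exact: measurableI.
  apply/eqP; rewrite -measure_le0.
  apply: (@le_trans _ _ (mu (N1 `|` (Om `&` T' @^-1` N2)))).
    by apply: le_measure; rewrite ?inE//; [exact: measurableD|exact: measurableU].
  apply: (@le_trans _ _ (mu N1 + mu (Om `&` T' @^-1` N2))%E); first exact: measureU2.
  by rewrite N10 N2E -hnu// N20 adde0.
have mG := measurable_gibbs eps mf mg.
have mw : measurable_fun setT (wgt truncated_bregman r U W).
  have mD := measurable_truncated_bregman.
  have mU := measurable_scaled_left; have mW := measurable_scaled_right.
  rewrite /wgt; apply: (measurableT_comp (@measurable_expR R)).
  apply: measurable_funB; last exact: (measurableT_comp mW measurable_snd).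
  apply: measurable_funB; last exact: (measurableT_comp mU measurable_fst).
  apply: measurableT_comp; first exact: oppr_measurable.
  by apply: measurable_funM => //; exact: measurable_cst.
exists Y; split=> //.
- move=> x [Omx nN]; rewrite -(integral_full mOm mY YOm OmY0); last 2 first.
  + by apply/measurable_EFinP; apply: measurable_funTS; exact: (measurableT_comp mw (measurable_pair1 x)).
  + by move=> z _; rewrite lee_fin expR_ge0.
  rewrite -(H1 x Omx); last by move=> N1x; apply: nN; left.
  rewrite (integral_transport oOm bOm muOm cT hnu (G := fun y => (gibbs eps f g (x, y))%:E)).
  + by apply: eq_integral => z; rewrite inE => Omz; rewrite gibbs_wgt.
  + by apply/measurable_EFinP; apply: measurable_funTS; exact: (measurableT_comp mG (measurable_pair1 x)).
  + by move=> y _; rewrite lee_fin expR_ge0.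
- move=> z [Omz nN]; rewrite -(integral_full mOm mY YOm OmY0); last 2 first.
  + by apply/measurable_EFinP; apply: measurable_funTS; exact: (measurableT_comp mw (measurable_pair2 z)).
  + by move=> x _; rewrite lee_fin expR_ge0.
  rewrite -(H2 (T z)); last 2 first.
  + by exists z.
  + by move=> N2z; apply: nN; right; rewrite /= truncated_mapE.
  by apply: eq_integral => x; rewrite inE => Omx; rewrite gibbs_wgt.
Qed.

Let integral_finite (u v : 'rV[R]_n -> R) (k : R) : measurable_fun setT v ->
  mu.-integrable Om (EFin \o u) -> (forall x, Om x -> `|v x| <= `|u x| + k) ->
  (\int[mu]_(x in Om) `|v x|%:E < +oo)%E.
Proof.
move=> mv ui vu; have ui1 : mu.-integrable Om (EFin \o (fun x => `|u x| + `|k|)).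
  have -> : EFin \o (fun x => `|u x| + `|k|) = ((fun x => `|(EFin \o u) x|) \+ cst (`|k|%:E))%E.
    by apply/funext => x /=; rewrite EFinD.
  apply: integrableD => //; first exact: integrable_abse.
  apply/integrableP; split; first exact: measurable_cst.
  rewrite (eq_integral (cst `|k|%:E)) => [|x _]; last by rewrite /= normr_id.
  rewrite (integral_cst mu mOm) [X in (_ * X)%E](_ : _ = 1%E); last exact: muOm.
  by rewrite mule1 ltry.
have /integrableP[_] : mu.-integrable Om (EFin \o v).
  apply: (le_integrable mOm _ _ ui1).
  - by apply/measurable_EFinP; exact: measurable_funTS.
  - move=> x Omx /=; rewrite lee_fin [leRHS]ger0_norm ?addr_ge0//.
    by apply: (le_trans (vu x Omx)); rewrite lerD2l ler_norm.
by [].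
Qed.

Let half_sqr_le (x : 'rV[R]_n) (b : R) : `|x| <= b -> `|half_sqr x| <= n%:R * (b * b) / 2.
Proof.
move=> xb; rewrite half_sqrE normrM [`|2^-1|]ger0_norm// ler_wpM2r//.
by apply: (le_trans (dotr_le _ _)); rewrite ler_wpM2l// ler_pM.
Qed.

Lemma scaled_left_finite : (\int[mu]_(x in Om) `|U x|%:E < +oo)%E.
Proof.
have fi : mu.-integrable Om (EFin \o (fun x => eps^-1 * f x)).
  rewrite (_ : EFin \o _ = (fun x => eps^-1%:E * (EFin \o f) x)%E).
    by apply: integrableZl => //; case: pot => -[].
  by apply/funext => x; rewrite /= EFinM.
apply: (integral_finite (k := eps^-1 * (n%:R * (B * B) / 2 + M)) measurable_scaled_left fi).
move=> x Omx; rewrite /scaled_left patchE mem_set// mulrC !normrM.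
have e10 : 0 <= eps^-1 by rewrite invr_ge0 ltW.
rewrite [`|eps^-1|]ger0_norm// -mulrDr; apply: ler_wpM2l => //.
have [pM _] := OmM Omx; have hx := half_sqr_le (OmB Omx).
rewrite (_ : half_sqr x - f x - phi x = (half_sqr x - phi x) - f x); last by ring.
rewrite (le_trans (ler_normB _ _))// addrC lerD2l (le_trans (ler_normB _ _))//.
exact: lerD.
Qed.

Lemma scaled_right_finite : (\int[mu]_(x in Om) `|W x|%:E < +oo)%E.
Proof.
have gi : mu.-integrable Om (EFin \o (fun x => eps^-1 * g (T' x))).
  rewrite (_ : EFin \o _ = (fun x => eps^-1%:E * (EFin \o (g \o T')) x)%E).
    apply: integrableZl => //.
    by apply: (integrable_transport oOm bOm muOm cT hnu mg); case: pot => -[].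
  by apply/funext => x; rewrite /= EFinM.
apply: (integral_finite (k := eps^-1 * (n%:R * (M * M) / 2 + (n%:R * (M * B) + M)))
  measurable_scaled_right gi).
move=> z Omz; rewrite /scaled_right /right_gap truncated_mapE// cE//.
rewrite mulrC !normrM.
have e10 : 0 <= eps^-1 by rewrite invr_ge0 ltW.
rewrite [`|eps^-1|]ger0_norm// -mulrDr; apply: ler_wpM2l => //.
have [pM TM] := OmM Omz; have hx := half_sqr_le TM.
rewrite (_ : half_sqr (T z) - g (T z) - (dotr (T z) z - phi z)
  = (half_sqr (T z) - (dotr (T z) z - phi z)) - g (T z)); last by ring.
rewrite (le_trans (ler_normB _ _))// addrC lerD2l (le_trans (ler_normB _ _))//.
apply: lerD => //; rewrite (le_trans (ler_normB _ _))//; apply: lerD => //.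
apply: (le_trans (dotr_le _ _)); rewrite ler_wpM2l//; apply: ler_pM => //.
exact: OmB.
Qed.

Lemma gap_dint (h1 h2 : 'rV[R]_n -> R) : 
  (forall z, Om z -> conjugate phi (T z) = (dotr (T z) z - phi z)%:E) ->
  (forall x, Om x -> h1 x = half_sqr x - f x) ->
  (forall y, (T @` Om) y -> h2 y = half_sqr y - g y) ->
  ('N[(mu \x nu)%E]_1 [(oplus (EFin \o h1) (EFin \o h2)
      \- oplus (EFin \o phi) (conjugate phi)) \_ (Om `*` (T @` Om))]
    = eps%:E * dint mu Om (fun w => `|U w.1 + W w.2|)%R)%E.
Proof.
move=> conjE h1E h2E.
pose F (w : 'rV[R]_n * 'rV[R]_n) := `|(half_sqr w.1 - f w.1 - (phi \_ Om) w.1) + right_gap w.2|.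
have mF : measurable_fun setT F.
  apply: (measurableT_comp (@normr_measurable _ _)); apply: measurable_funD.
    apply: measurable_funB; last by meas.
    apply: measurable_funB; last by meas.
    exact: measurable_half_sqr.
  exact: (measurableT_comp measurable_right_gap measurable_snd).
rewrite Lnorm1; transitivity (\int[(mu \x nu)%E]_(w in Om `*` (T @` Om)) (F w)%:E)%E.
  rewrite [RHS]integral_mkcond; apply: eq_integral => -[x y] _.
  rewrite !patchE; case: ifPn => [|_]; last by rewrite abse0.
  rewrite in_setX => /andP[/=]; rewrite !inE => Omx [z Omz <-].
  rewrite /oplus /= conjE// h1E// h2E// /F /= patchE mem_set// /right_gap cE//.
  by congr (`|_|%:E); ring.
rewrite (double_integral_transport oOm bOm muOm cT hnu mF)//; last by move=> w; exact: normr_ge0.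
have mU := measurable_scaled_left; have mW := measurable_scaled_right.
rewrite -(dintZ mu mOm (F := fun w => `|U w.1 + W w.2|))//; last 2 first.
- by meas.
- exact: ltW.
apply: eq_integral => -[x z] _; rewrite /F /= /scaled_left /scaled_right -mulrDl normrM.
by rewrite [`|eps^-1|]gtr0_norm ?invr_gt0// mulrCA divff ?gt_eqF// mulr1.
Qed.

End Potentials.

(** The density bounds allow passing to Lebesgue measure and back; the loss in the Poincare
    inequality cancels the power of r in the local estimate. *)
Lemma dint_oscillation_le {R : realType} {d : nat} (mu : probability 'rV[R]_d.+1 R)
    (Om : set 'rV[R]_d.+1) (rho V : 'rV[R]_d.+1 -> R) (lam Lam C r b : R) :
  open Om -> 0 < lam -> 0 <= Lam -> measurable_fun Om rho ->
  (forall x, Om x -> lam <= rho x) -> (forall x, Om x -> rho x <= Lam) ->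
  (forall A, measurable A -> mu A = (\int[lebesgue_rV d.+1]_(x in A `&` Om) (rho x)%:E)%E) ->
  0 < r -> 0 <= C -> measurable_fun setT V ->
  (oscillation V Om Om <= (C * r^-1 ^+ d.+2)%:E * local_oscillation Om V r)%E ->
  (dint mu Om (fun w => nearby r w * `|V w.1 - V w.2|)%R <= (b * r ^+ d.+2)%:E)%E ->
  (dint mu Om (fun w => `|V w.1 - V w.2|)%R <= (Lam ^+ 2 * C * (lam ^+ 2)^-1 * b)%:E)%E.
Proof.
move=> oOm lam0 Lam0 mrho lam_rho rho_Lam hmu r0 C0 mV osc near.
have mOm := open_measurable_rV oOm.
have mF : measurable_fun setT (fun w : 'rV[R]_d.+1 * 'rV[R]_d.+1 => `|V w.1 - V w.2|) by meas.
have mnear : measurable_fun setT (nearby r : 'rV[R]_d.+1 * 'rV[R]_d.+1 -> R).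
  exact: measurable_near.
have mG : measurable_fun setT (fun w : 'rV[R]_d.+1 * 'rV[R]_d.+1 => nearby r w * `|V w.1 - V w.2|).
  by meas.
have lam2 : 0 < lam ^+ 2 by rewrite exprn_gt0.
have G0 (w : 'rV[R]_d.+1 * 'rV[R]_d.+1) : 0 <= nearby r w * `|V w.1 - V w.2|.
  by rewrite mulr_ge0// ler0n.
have := lebesgue_le_dint mOm lam0 mrho lam_rho hmu mG G0 => /le_trans /(_ near).
rewrite -lee_pdivlMl// -EFinM => loc.
apply: (le_trans (dint_le_lebesgue mOm lam0 mrho lam_rho rho_Lam Lam0 hmu mF (fun w => normr_ge0 _))).
rewrite (_ : Lam ^+ 2 * C * _ * b = Lam ^+ 2 * (C * ((lam ^+ 2)^-1 * b))); last by ring.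
rewrite (EFinM (Lam ^+ 2)); apply: lee_wpmul2l; first by rewrite lee_fin exprn_ge0.
apply: (le_trans osc).
have -> : C * ((lam ^+ 2)^-1 * b) = (C * r^-1 ^+ d.+2) * ((lam ^+ 2)^-1 * (b * r ^+ d.+2)).
  by rewrite exprVn; move: (r ^+ d.+2) (exprn_gt0 d.+2 r0) => q q0; field; rewrite !gt_eqF.
rewrite (EFinM (C * _)); apply: lee_wpmul2l.
  by rewrite lee_fin mulr_ge0// exprn_ge0// invr_ge0 ltW.
apply: le_trans loc; rewrite /local_oscillation le_eqVlt; apply/orP; left; apply/eqP.
apply: eq_integral => x _; apply: eq_integral => z _.
by rewrite mulrC.
Qed.

(** Here l stands for ln(1/r), so 2l is ln(1/eps). The threshold on l keeps [C0] below l/2, so the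
    logarithm dominates in the lower bound. *)
Lemma log_absorbs {R : realType} (n C0 C1 l : R) :
  1 <= n -> 0 < C0 -> 0 <= C1 -> 2 * C0 + 1 <= l ->
  (4 + n + C0 + C1)^-1 * (2 * l) <= n * l - C0 /\
  2^-1 * (n * l + C0 + (n * l + C0) + C1) <= (4 + n + C0 + C1) * (2 * l).
Proof.
move=> n1 C00 C10 l1; have l0 : 1 <= l by lra.
have nl : l <= n * l by rewrite ler_peMl//; lra.
split.
  rewrite ler_pdivrMl; last lra.
  apply: (@le_trans _ _ (4 * (n * l - C0))); first lra.
  by apply: ler_wpM2r; lra.
have : C0 <= C0 * l by rewrite ler_peMr// ltW.
have : C1 <= C1 * l by rewrite ler_peMr.
rewrite (_ : _ * (2 * l) = 8 * l + 2 * (n * l) + 2 * (C0 * l) + 2 * (C1 * l)); last by ring.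
by move: nl; move: (n * l) (C0 * l) (C1 * l) => *; lra.
Qed.

(** * Assembly of the two bounds *)

Theorem theorem2p12 (R : realType) (d : nat) (alpha kappa lambda : R)
    (Omega : set 'rV[R]_d.+1) (phi rho : 'rV[R]_d.+1 -> R)
    (mu nu : probability 'rV[R]_d.+1 R)
    (f g : R -> 'rV[R]_d.+1 -> R)
    (halpha : 0 < alpha < 1)
    (hOmega_open : open Omega)
    (hOmega_bounded : bounded_set Omega)
    (hOmega_connected : connected Omega)
    (hOmega_boundary : Ck_holder_boundary 2 alpha Omega)
    (hkappa : 0 < kappa)
    (hphi_convex : strongly_convex kappa phi)
    (hphi_smooth : exists U : set 'rV[R]_d.+1,
       [/\ open U, closure Omega `<=` U & Ck_holder 3 alpha U phi])
    (hrho_smooth : Ck_holder_closure 1 alpha Omega rho)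
    (hlambda : 0 < lambda)
    (hrho_lower : forall x, Omega x -> lambda <= rho x)
    (hmu : forall A, measurable A ->
       mu A = (\int[lebesgue_rV d.+1]_(x in A `&` Omega) (rho x)%:E)%E)
    (hnu : forall A, measurable A ->
       nu A = mu (Omega `&` grad phi @^-1` A))
    (hpot : forall eps, 0 < eps ->
       schroedinger_potentials mu nu Omega (grad phi @` Omega) eps
         (f eps) (g eps)) :
  exists C eps0 : R, [/\ 0 < C, 0 < eps0 &
    forall eps, 0 < eps < eps0 ->
      let phi_eps x := half_sqr x - f eps x in
      let psi_eps y := half_sqr y - g eps y in
      let gap := ('N[(mu \x nu)%E]_1
        [(oplus (EFin \o phi_eps) (EFin \o psi_eps)
          \- oplus (EFin \o phi) (conjugate phi))
         \_ (Omega `*` (grad phi @` Omega))])%E in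
      ((C^-1 * (eps * ln eps^-1))%:E <= gap)%E /\
      (gap <= (C * (eps * ln eps^-1))%:E)%E].
Proof.
have [U [oU OmU smphi']] := hphi_smooth.
have smphi : Ck 3 U phi := proj1 smphi'.
have mOm := open_measurable_rV hOmega_open.
have muOm : mu Omega = 1%E.
  have := hmu _ (@measurableT _ 'rV[R]_d.+1); rewrite setTI probability_setT => ->.
  by rewrite hmu// setIid.
have Om0 : Omega !=set0.
  apply/set0P/eqP => E; move: muOm; rewrite E measure0 => /eqP.
  by rewrite eqe eq_sym oner_eq0.
have OmU' : Omega `<=` U by move=> x Omx; exact/OmU/subset_closure.
have cphi x : Omega x -> {for x, continuous phi}.
  by move=> /OmU'; exact: (proj2 smphi [::]).
have cT i x : Omega x -> {for x, continuous (fun u => grad phi u 0 i)}.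
  move=> /OmU' Ux; have := proj2 smphi [:: i] x isT Ux.
  rewrite (_ : partial [:: i] phi = (fun u => grad phi u 0 i))//.
  by apply/funext => u; rewrite mxE.
have [B B0 OmB] := bounded_setP hOmega_bounded.
have [M M0 OmM] := bounded_phi_grad hOmega_bounded oU OmU smphi.
have [Lam Lam0 rho_Lam] := bounded_of_closure_extension hOmega_bounded hrho_smooth.
have mrho : measurable_fun Omega rho.
  apply: open_measurable_fun => // x Omx; have [[_ crho] _ _] := hrho_smooth.
  exact: (crho [::]).
have [K kapK [Dlow Dup Dasym Dlip1 Dlip2]] :=
  bregman_estimates hOmega_bounded oU OmU hkappa hphi_convex smphi.
have kap0 : 0 < kappa / 2 by rewrite divr_gt0.
have pos x z : Omega x -> Omega z -> 0 <= bregman phi x z.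
  by move=> Omx Omz; apply: le_trans (Dlow x z Omx Omz); rewrite mulr_ge0 ?exprn_ge0// ltW.
have [c mc cE] := measurable_conjugate Om0 OmB (fun x Omx => proj1 (OmM x Omx)) pos.
have conjE z : Omega z -> conjugate phi (grad phi z) = (dotr (grad phi z) z - phi z)%:E.
  exact: (conjugate_grad hOmega_bounded oU OmU hkappa hphi_convex smphi).
have cube := density_cube mOm hlambda mrho hrho_lower rho_Lam Lam0 hmu.
pose D := truncated_bregman Omega phi.
have DE := truncated_bregmanE (Om := Omega) phi.
have mD : measurable_fun setT (fun w : 'rV[R]_d.+1 * 'rV[R]_d.+1 => D w.1 w.2).
  exact: measurable_truncated_bregman.
have [C0 C00 core] : exists2 C : R, 0 < C & forall (Y : set 'rV[R]_d.+1) (r : R) (U W : 'rV[R]_d.+1 -> R),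
    Y `<=` Omega -> measurable Y -> mu Y = 1%E ->
    0 < r < 1 -> measurable_fun setT U -> measurable_fun setT W ->
    (\int[mu]_(x in Y) `|U x|%:E < +oo)%E -> (\int[mu]_(x in Y) `|W x|%:E < +oo)%E ->
    (forall x, Y x -> (\int[mu]_(z in Y) (wgt D r U W (x, z))%:E = 1)%E) ->
    (forall z, Y z -> (\int[mu]_(x in Y) (wgt D r U W (x, z))%:E = 1)%E) ->
    [/\ (\int[mu]_(x in Y) `|U x + W x|%:E <= (d.+1%:R * ln r^-1 + C)%:E)%E,
        ((d.+1%:R * ln r^-1 - C)%:E <= dint mu Y (fun w => `|U w.1 + W w.2|)%R)%E &
        (dint mu Y (fun w => nearby r w * `|U w.1 - W w.1 - (U w.2 - W w.2)|)%R
          <= (C * r ^+ d.+2)%:E)%E].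
  apply: (core_estimate B0 OmB Lam0 cube mD kap0 kapK).
  - by move=> x z Ox Oz; rewrite /D DE//; exact: Dlow.
  - by move=> x z Ox Oz; rewrite /D DE//; exact: Dup.
  - by move=> x z Ox Oz; rewrite /D !DE//; exact: Dasym.
  - by move=> x x' z Ox Ox' Oz; rewrite /D !DE//; exact: Dlip1.
  - by move=> x z z' Ox Oz Oz'; rewrite /D !DE//; exact: Dlip2.
have [Cp [rp [Cp0 rp0 poin]]] :=
  poincare hOmega_open hOmega_bounded hOmega_connected hOmega_boundary.
pose C1 := Lam ^+ 2 * Cp * (lambda ^+ 2)^-1 * C0.
have C10 : 0 <= C1.
  by rewrite /C1 !mulr_ge0 ?invr_ge0 ?exprn_ge0 ?sqr_ge0 ?(ltW hlambda) ?(ltW C00) ?(ltW Cp0).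
have rp2 : 0 < rp ^+ 2 by rewrite exprn_gt0.
have d0 : 0 <= d%:R :> R by [].
(* The three bounds on eps = r^2 give in turn r < 1, r below the Poincare threshold [rp], and 2 [C0]
   + 1 <= ln(1/r). *)
exists (4 + d.+1%:R + C0 + C1), (Num.min 1 (Num.min (rp ^+ 2) (expR (- (2 * (2 * C0 + 1)))))).
split.
- by rewrite -[d.+1%:R]natr1; lra.
- by rewrite !lt_min ltr01 rp2 expR_gt0.
move=> eps /andP[eps0]; rewrite !lt_min => /and3P[eps1 epsrp epsexp] phi_eps psi_eps gap.
pose r := Num.sqrt eps.
have epsE : r ^+ 2 = eps by rewrite sqr_sqrtr// ltW.
have r0 : 0 < r by rewrite sqrtr_gt0.
have r1 : r < 1 by rewrite -(ltr_pXn2r (n := 2))// ?nnegrE ?(ltW r0)// epsE expr1n.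
have rrp : r < rp by rewrite -(ltr_pXn2r (n := 2))// ?nnegrE ?(ltW r0) ?(ltW rp0)// epsE.
pose l := ln r^-1.
have lnE : ln eps^-1 = 2 * l.
  by rewrite /l !lnV ?posrE// -epsE lnXn// mulrN mulr_natl.
have l1 : 2 * C0 + 1 <= l.
  have : ln eps < - (2 * (2 * C0 + 1)).
    by rewrite -[ltRHS]expRK ltr_ln ?posrE ?expR_gt0.
  by have := lnE; rewrite lnV ?posrE//; lra.
have mIm : measurable (grad phi @` Omega) by exact: measurable_image_open.
have [[fi gi] _] := hpot eps eps0.
pose fO := f eps \_ Omega; pose gO := g eps \_ (grad phi @` Omega).
have mfO : measurable_fun setT fO.
  apply/(measurable_restrictT _ _).1; first exact: mOm.
  by apply/measurable_EFinP; case/integrableP: fi.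
have mgO : measurable_fun setT gO.
  apply/(measurable_restrictT _ _).1; first exact: mIm.
  by apply/measurable_EFinP; case/integrableP: gi.
have pot := potentials_restrict mOm mIm (hpot eps eps0).
have [Y [YOm mY OmY0 p1 p2]] := full_marginals hOmega_open hOmega_bounded muOm cphi cT hnu
  eps0 epsE mfO mgO mc cE pot.
pose A := scaled_left Omega phi fO eps.
pose W := scaled_right Omega phi c gO eps.
have mA : measurable_fun setT A by exact: measurable_scaled_left.
have mW : measurable_fun setT W by exact: measurable_scaled_right.
have muY : mu Y = 1%E.
  apply/le_anti/andP; split; first exact: probability_le1.
  have mOY : measurable (Omega `\` Y) by exact: measurableD.
  have := measureU2 mu mY mOY; rewrite [X in (_ <= _ + X)%E](_ : _ = 0%E); last exact: OmY0.
  by rewrite adde0 setDUK// => H; rewrite -muOm.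
have finY (h : 'rV[R]_d.+1 -> R) : measurable_fun setT h -> (\int[mu]_(x in Omega) `|h x|%:E < +oo)%E ->
    (\int[mu]_(x in Y) `|h x|%:E < +oo)%E.
  move=> mh; rewrite (integral_full mOm mY YOm OmY0)//.
  apply/measurable_EFinP; apply: measurable_funTS.
  exact: (measurableT_comp (@normr_measurable _ _)).
have iA := finY A mA (scaled_left_finite hOmega_open muOm cphi eps0 mfO pot OmB OmM).
have iW := finY W mW (scaled_right_finite hOmega_open hOmega_bounded muOm cT hnu
  eps0 mgO mc cE pot OmB OmM).
have [|s1 s2 s3] := core Y r A W YOm mY muY _ mA mW iA iW p1 p2; first by rewrite r0.
have gapE : gap = (eps%:E * dint mu Omega (fun w => `|A w.1 + W w.2|)%R)%E.
  apply: (gap_dint hOmega_open hOmega_bounded muOm cphi cT hnu eps0 mfO mgO mc cE conjE).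
  - by move=> x Omx; rewrite /phi_eps /fO patchE mem_set.
  - by move=> y Ty; rewrite /psi_eps /gO patchE mem_set.
have mAW : measurable_fun setT (fun w : 'rV[R]_d.+1 * 'rV[R]_d.+1 => `|A w.1 + W w.2|) by meas.
rewrite gapE lnE (dint_full mOm mY YOm OmY0 mAW (fun w => normr_ge0 _)).
have n1 : 1 <= d.+1%:R :> R by rewrite ler1n.
split.
  rewrite mulrCA EFinM; apply: lee_wpmul2l; first by rewrite lee_fin ltW.
  by apply: le_trans s2; rewrite lee_fin -/l; case: (log_absorbs n1 C00 C10 l1).
pose V x := A x - W x.
have mV : measurable_fun setT V by rewrite /V; meas.
have mVV : measurable_fun setT (fun w : 'rV[R]_d.+1 * 'rV[R]_d.+1 => `|V w.1 - V w.2|) by meas.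
have mnear : measurable_fun setT (nearby r : 'rV[R]_d.+1 * 'rV[R]_d.+1 -> R).
  exact: measurable_near.
have osc := poin r V (introT andP (conj r0 rrp)) mV.
(* The Poincare inequality lives on the open set [Omega], the kernel estimates on [Y]; the
   difference is null, so double integrals can be exchanged. *)
have s3' : (dint mu Omega (fun w => nearby r w * `|V w.1 - V w.2|)%R <= (C0 * r ^+ d.+2)%:E)%E.
  rewrite (dint_full mOm mY YOm OmY0)//; first by meas.
  by move=> w; rewrite mulr_ge0// ler0n.
have := dint_oscillation_le hOmega_open hlambda Lam0 mrho hrho_lower rho_Lam hmu r0 (ltW Cp0)
  mV osc s3'.
rewrite -/C1 (dint_full mOm mY YOm OmY0 mVV (fun w => normr_ge0 _)) => s4.
rewrite mulrCA EFinM; apply: lee_wpmul2l; first by rewrite lee_fin ltW.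
pose S x := `|A x + W x|.
have mS : measurable_fun setT S by rewrite /S; meas.
have S0 x : 0 <= S x by exact: normr_ge0.
(* The factor 1 puts a function of one variable in product form, so that [dint_prod] and [mu Y = 1]
   integrate out the other variable. *)
pose one : 'rV[R]_d.+1 -> R := fun=> 1.
have mone : measurable_fun setT one by exact: measurable_cst.
have ES1 : (dint mu Y (fun w => S w.1 * one w.2)%R <= (d.+1%:R * l + C0)%:E)%E.
  rewrite (dint_prod mu mY mS mone)//.
  by rewrite (integral_cst mu mY 1%E) [X in (_ * (_ * X))%E](_ : _ = 1%E) ?mule1.
have ES2 : (dint mu Y (fun w => one w.1 * S w.2)%R <= (d.+1%:R * l + C0)%:E)%E.
  rewrite (dint_prod mu mY mone mS)//.
  by rewrite (integral_cst mu mY 1%E) [X in (_ * X * _)%E](_ : _ = 1%E) ?mule1 ?mul1e.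
have m1 : measurable_fun setT (fun w : 'rV[R]_d.+1 * 'rV[R]_d.+1 => S w.1 * one w.2) by meas.
have m2 : measurable_fun setT (fun w : 'rV[R]_d.+1 * 'rV[R]_d.+1 => one w.1 * S w.2) by meas.
have le1 : (dint mu Y (fun w => `|A w.1 + W w.2|)%R
    <= dint mu Y (fun w => 2^-1 * ((S w.1 * one w.2 + one w.1 * S w.2) + `|V w.1 - V w.2|))%R)%E.
  apply: (dint_le mu mY) => //; first by meas.
  move=> x z _ _ /=; rewrite normr_ge0/= mulr1 mul1r /S /V.
  rewrite (_ : A x + W z = 2^-1 * (((A x + W x) + (A z + W z)) + (A x - W x - (A z - W z)))).
    rewrite normrM ger0_norm// ler_wpM2l// (le_trans (ler_normD _ _))// lerD2r.
    exact: ler_normD.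
  by field.
apply: (le_trans le1).
rewrite (dintZ mu mY (F := fun w => (S w.1 * one w.2 + one w.1 * S w.2) + `|V w.1 - V w.2|))//;
  last 2 first.
- by meas.
- by move=> x z _ _ /=; rewrite !addr_ge0// ?mulr1 ?mul1r.
rewrite (dintD mu mY (F := fun w => S w.1 * one w.2 + one w.1 * S w.2))//; last 2 first.
- by meas.
- by move=> x z _ _ /=; rewrite addr_ge0// ?mulr1 ?mul1r.
rewrite (dintD mu mY m1 m2)//; last 2 first.
- by move=> x z _ _ /=; rewrite mulr1.
- by move=> x z _ _ /=; rewrite mul1r.
apply: (@le_trans _ _ (2^-1%:E * ((d.+1%:R * l + C0)%:E + (d.+1%:R * l + C0)%:E + C1%:E))%E).
  by apply: lee_wpmul2l; [rewrite lee_fin|apply: leeD => //; exact: leeD].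
rewrite -!EFinD -EFinM lee_fin.
by case: (log_absorbs n1 C00 C10 l1).
Qed.
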